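(* Let $X$ be a Banach space with finite cotype. Let $T\colon X\to X$ be a Ritt operator with a bounded $H^{\infty}(B_\gamma)$ functional calculus for some $\gamma\in\bigl(0,\frac{\pi}{2}\bigr)$. Then for every integer $m\geq 1$ there is a constant $C>0$ such that $\|x\|_{T,m}\leq C\|x\|$ for all $x\in X$.
   Context: Let $X$ be a complex Banach space and $B(X)$ the algebra of bounded operators on $X$; write $R(\lambda,T)=(\lambda I-T)^{-1}$. An operator $T\in B(X)$ is a Ritt operator if the two sets $\{T^n : n\geq 0\}$ and $\{n(T^n-T^{n-1}) : n\geq 1\}$ are bounded. For $\gamma\in(0,\frac{\pi}{2})$, $B_\gamma$ (Stolz domain) is the interior of the convex hull of $1$ and the disc $D(0,\sin\gamma)=\{|z|<\sin\gamma\}$. A Ritt operator $T$ is of type $\alpha\in(0,\frac{\pi}{2})$ if $\sigma(T)\subset\overline{B_\alpha}$ and for every $\beta\in(\alpha,\frac{\pi}{2})$ the set $\{(\lambda-1)R(\lambda,T) : \lambda\in\mathbb{C}\setminus\overline{B_\beta}\}$ is bounded (every Ritt operator is of some type $\alpha$). $H^\infty_0(B_\gamma)$ is the space of bounded holomorphic $\varphi\colon B_\gamma\to\mathbb{C}$ for which there are $s,c>0$ with $|\varphi(\lambda)|\leq c|1-\lambda|^s$ on $B_\gamma$. If $T$ is a Ritt operator of type $\alpha<\gamma$ and $\varphi\in H^\infty_0(B_\gamma)$, set $\varphi(T)=\frac{1}{2\pi i}\int_{\partial B_\beta}\varphi(\lambda)R(\lambda,T)\,d\lambda$ with $\beta\in(\alpha,\gamma)$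 and $\partial B_\beta$ oriented counterclockwise (independent of $\beta$). $T$ admits a bounded $H^\infty(B_\gamma)$ functional calculus if $T$ is of type $\alpha$ for some $\alpha<\gamma$ and there is $K>0$ with $\|\varphi(T)\|\leq K\sup_{\lambda\in B_\gamma}|\varphi(\lambda)|$ for all $\varphi\in H^\infty_0(B_\gamma)$. Let $(\varepsilon_k)_{k\geq 1}$ be independent Rademacher variables on a probability space $(\mathcal{M},d\mathbb{P})$. $\mathrm{Rad}(X)$ is the closed span of $\{\varepsilon_k\otimes x : k\geq 1,x\in X\}$ in $L^2(\mathcal{M};X)$, with the $L^2(\mathcal{M};X)$-norm. For $T\in B(X)$, an integer $m\geq 1$ and $x\in X$, set $$\|x\|_{T,m}=\Bigl\|\sum_{k=1}^\infty k^{m-\frac12}\,\varepsilon_k\otimes T^{k-1}(I-T)^m(x)\Bigr\|_{\mathrm{Rad}(X)}$$ if the series converges in $L^2(\mathcal{M};X)$, and $\|x\|_{T,m}=\infty$ otherwise. *)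

(* Defs.v *)
From HB Require Import structures.
From mathcomp Require Import all_boot all_order all_algebra.
From mathcomp Require Import finmap complex.
From mathcomp Require Import all_classical all_reals all_analysis.

Set Implicit Arguments.
Unset Strict Implicit.
Unset Printing Implicit Defensive.

Import Order.TTheory GRing.Theory Num.Theory.
Import numFieldNormedType.Exports.

Local Open Scope classical_set_scope.
Local Open Scope ring_scope.
Local Open Scope complex_scope.

(* A complex Banach space is a [completeNormedModType R[i]], whose norm takes
   values in R[i]; [rnorm] is the same norm with values in R. On R[i] itself
   it is the modulus. *)
Definition rnorm (R : realType) (V : normedZmodType R[i]) (v : V) : R :=
  complex.Re `|v|.

Section BoundedOperators.
Context (R : realType) (X : completeNormedModType R[i]).
Implicit Types (S T : X -> X) (z : R[i]).

(* B(X) is the set of functions X -> X satisfying this predicate; sums, scalar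
   multiples and powers are those of the function space X -> X. *)
Definition bounded_operator S : Prop := linear S /\ continuous S.

Definition opnorm S : \bar R :=
  ereal_sup [set (rnorm (S x))%:E | x in [set x : X | rnorm x <= 1]].

Definition bounded_family (F : set (X -> X)) : Prop :=
  exists M : R, forall S, F S -> (opnorm S <= M%:E)%E.

Definition is_resolvent T z S : Prop :=
  [/\ bounded_operator S,
      forall x, S (z *: x - T x) = x &
      forall x, z *: S x - T (S x) = x].

(* (z I - T)^-1, and 0 when z is in the spectrum of T. *)
Definition resolvent z T : X -> X :=
  xget (0 : X -> X) [set S | is_resolvent T z S].

Definition spectrum T : set R[i]^o :=
  [set z | ~ exists S, is_resolvent T z S].

Definition ritt T : Prop :=
  [/\ bounded_operator T,
      bounded_family [set iter n T | n in [set: nat]] &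
      bounded_family
        [set (n%:R : R[i]) *: (iter n T - iter n.-1 T : X -> X)
        | n in [set n : nat | (0 < n)%N]]].

End BoundedOperators.

(* Convexity over R[i]^o is the usual real convexity: the scalars in [0, 1] for
   the order of R[i] are the real numbers of [0, 1]. *)
Definition stolz (R : realType) (gamma : R) : set R[i]^o :=
  (smallest (@convex_set R[i] R[i]^o)
     ([set 1] `|` [set z : R[i]^o | rnorm z < sin gamma]))^°.

Definition ritt_type (R : realType) (X : completeNormedModType R[i])
    (T : X -> X) (alpha : R) : Prop :=
  [/\ ritt T, 0 < alpha < pi / 2,
      spectrum T `<=` closure (stolz alpha) &
      forall beta, alpha < beta < pi / 2 ->
        bounded_family
          [set (z - 1) *: resolvent z T | z in ~` closure (stolz beta)]].

Section FunctionalCalculus.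
Context (R : realType) (X : completeNormedModType R[i]).
Implicit Types (T S : X -> X) (phi : R[i]^o -> R[i]^o) (beta gamma : R).

(* The boundary of [stolz beta], run once counterclockwise from 1 to 1 for
   t in [0, 3]: the lines through 1 that are tangent to the circle of radius
   sin beta touch it at the points of argument +-(pi/2 - beta). *)
Definition stolz_path beta (t : R) : R[i] :=
  let r := sin beta in
  let theta := pi / 2 - beta in
  let cis (u : R) : R[i] := cos u +i* sin u in
  if t <= 1 then 1 + t%:C * (r%:C * cis theta - 1)
  else if t <= 2 then
    r%:C * cis (theta + (t - 1) * (pi *+ 2 - theta *+ 2))
  else r%:C * cis (- theta) + (t - 2)%:C * (1 - r%:C * cis (- theta)).

(* S is the integral of F(z) dz along g restricted to [a, b]: limit, in operator
   norm, of the Riemann-Stieltjes sums over tagged partitions. *)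
Definition is_path_integral (F : R[i] -> X -> X) (g : R -> R[i]) (a b : R) S
    : Prop :=
  forall e : R, 0 < e -> exists2 d : R, 0 < d &
  forall (n : nat) (t xi : nat -> R),
    t 0%N = a -> t n = b ->
    (forall i, (i < n)%N ->
      t i <= xi i <= t i.+1 /\ t i.+1 - t i < d) ->
  (opnorm ((\sum_(i < n) (g (t i.+1) - g (t i)) *: F (g (xi i)) - S)%R)
    < e%:E)%E.

(* The integral is improper at both ends, since the resolvent may be singular
   at 1. *)
Definition is_improper_path_integral (F : R[i] -> X -> X) (g : R -> R[i])
    (a b : R) S : Prop :=
  exists I : R -> R -> X -> X,
    (forall u v, a < u -> u < v -> v < b -> is_path_integral F g u v (I u v)) /\
    (forall e : R, 0 < e -> exists2 d : R, 0 < d &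
      forall u v, a < u < a + d -> b - d < v < b -> u < v ->
      (opnorm (I u v - S)%R < e%:E)%E).

Definition improper_path_integral (F : R[i] -> X -> X) (g : R -> R[i])
    (a b : R) : X -> X :=
  xget (0 : X -> X)
    [set S | bounded_operator S /\ is_improper_path_integral F g a b S].

Definition Hinfty0 gamma phi : Prop :=
  [/\ forall z, stolz gamma z -> derivable phi z 1,
      exists M : R, forall z, stolz gamma z -> rnorm (phi z) <= M &
      exists s c : R, [/\ 0 < s, 0 < c &
        forall z, stolz gamma z -> rnorm (phi z) <= c * rnorm (1 - z) `^ s]].

Definition calculus T beta phi : X -> X :=
  (0 +i* (pi *+ 2))^-1 *:
    improper_path_integral (fun z => phi z *: resolvent z T)
      (stolz_path beta) 0 3.

Definition bounded_Hinfty_calculus gamma T : Prop :=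
  exists alpha : R, [/\ ritt_type T alpha, alpha < gamma &
    exists2 K : R, 0 < K &
    forall phi, Hinfty0 gamma phi ->
    forall beta, alpha < beta < gamma ->
    (opnorm (calculus T beta phi)
      <= (K * sup [set rnorm (phi z) | z in stolz gamma])%:E)%E].

End FunctionalCalculus.

Section Rademacher.
Context (R : realType) (d : measure_display) (M : measurableType d).
Context (P : probability M R) (eps : nat -> {RV P >-> R}).

Definition independent_variables : Prop :=
  forall (J : {fset nat}) (A : nat -> set R),
    (forall k, measurable (A k)) ->
    P (\bigcap_(k in [set` J]) (eps k @^-1` A k)) =
    (\prod_(k <- J) P (eps k @^-1` A k))%E.

(* The sequence is indexed from 0: [eps k] is the (k+1)-st variable. *)
Definition rademacher_sequence : Prop :=
  independent_variables /\
  forall k, P (eps k @^-1` [set 1]) = (2^-1)%:E /\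
            P (eps k @^-1` [set -1]) = (2^-1)%:E.

Context (X : completeNormedModType R[i]).
Implicit Types (f s : M -> X) (x : nat -> X).

Definition simple_function s : Prop :=
  finite_set (range s) /\ forall y, measurable (s @^-1` [set y]).

Definition strongly_measurable f : Prop :=
  exists2 s : nat -> M -> X, forall n, simple_function (s n) &
    forall w, s n w @[n --> \oo] --> f w.

Definition L2norm f : \bar R := Lnorm P 2%:E (fun w => (rnorm (f w))%:E).

(* f represents an element of L^2(M; X). *)
Definition in_L2 f : Prop := strongly_measurable f /\ (L2norm f < +oo)%E.

Definition rademacher_sum x (n : nat) : M -> X :=
  fun w => \sum_(k < n) (eps k w)%:C *: x k.

Definition is_rademacher_series x f : Prop :=
  in_L2 f /\ L2norm (rademacher_sum x n - f) @[n --> \oo] --> 0%E.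

(* Norm in Rad(X) of the sum of the series, +oo if it diverges in L^2(M; X);
   the sum is unique up to almost everywhere equality. *)
Definition rademacher_norm x : \bar R :=
  if pselect (exists f, is_rademacher_series x f) is left H
  then L2norm (projT1 (cid H)) else +oo%E.

Definition cotype (q : R) : Prop :=
  exists2 C : R, 0 < C & forall (n : nat) (x : nat -> X),
    (((\sum_(k < n) rnorm (x k) `^ q) `^ q^-1)%R%:E
      <= C%:E * L2norm (rademacher_sum x n))%E.

Definition finite_cotype : Prop := exists2 q : R, 2 <= q & cotype q.

(* ||x||_{T,m}, with summation index shifted by one: k stands for k - 1. *)
Definition square_function (T : X -> X) (m : nat) (y : X) : \bar R :=
  rademacher_norm (fun k =>
    ((k.+1%:R : R) `^ (m%:R - 2^-1))%:C *:
      iter k T (iter m (fun v => v - T v) y)).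

End Rademacher.

Arguments finite_cotype {R d M P} eps X.

(* Main.v *)
From HB Require Import structures.
Require Import Defs.
From mathcomp Require Import all_boot all_order all_algebra.
From mathcomp Require Import finmap complex ring lra zify.
From mathcomp Require Import all_classical all_reals all_analysis measurable_realfun.

(* The calculus is needed on polynomials only. With a factor (1 - z)^3, the map
   p(z) R(z, T) has a primitive along the contour that is defined up to the ends,
   so that p(T) is the algebraic value and the hypothesis becomes
   |p(T)| <= K sup |p| on the Stolz domain B, for p divisible by 1 - z. On B one
   has |1 - z| <= C (1 - |z|), hence sum_j 2^(jm) |z|^(2^j - 1) |1 - z|^m is
   bounded, and the vectors y_j = 2^(jm) T^(2^j - 1) (I - T)^m x, one for each
   dyadic block of exponents, satisfy |sum_j a_j y_j| <= K |x| if |a_j| <= 1.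
   Inside the block of j, T^k differs from T^(2^j - 1) by a sum of powers
   T^i (I - T), which leaves sums sum_j eta_j y_j with eta_j a Rademacher sum over
   the block, of variance at most 1. Its tail is exponential; cutting eta_j into
   the layers t <= |eta_j| <= t + 1, which live on sets of probability at most
   8 / 2^t, cotype gives each layer a factor rho^t with rho < 1, so the layers can
   be summed. Finally the series converges since many disjoint blocks of large
   norm would contradict cotype. *)

Set Implicit Arguments.
Unset Strict Implicit.
Unset Printing Implicit Defensive.

Import Order.TTheory GRing.Theory Num.Theory.
Import numFieldNormedType.Exports HBSimple.
Local Open Scope classical_set_scope.
Local Open Scope ring_scope.
Local Open Scope complex_scope.

(** The hypothesis bounds [calculus], an improper integral picked by [xget] with default 0, so it
    says nothing of p(T) until that integral is shown to exist. A primitive with a quadratic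
    remainder settles this: Riemann sums over any tagged partition telescope up to the mesh, so
    existence and value come together. With E = I - T, E^3 R(z, T) is z^-1 E^3 plus the derivative
    of a function that is Lipschitz up to z = 1 and so has no increment over the closed contour.
    Hence the value only depends on the winding number around 0. In the block sums the obstacle is
    that the eta_j are unbounded: the estimate for |a_j| <= 1 does not apply to them, and in a space
    such as c_0 it does not extend to them with a constant free of the number of blocks. The way out
    is that coefficients bounded by 1 with disjoint supports add up, with any signs, to a
    coefficient bounded by 1. A rare layer has many measure-preserving shifts of disjoint supports;
    their signed sums obey the bound K of a single one, and cotype turns this into a gain. *)

Local Notation Re := complex.Re.
Local Notation Im := complex.Im.

(** * The norm with real values *)

Section RealNorm.
Context (R : realType) (V : normedZmodType R[i]).
Implicit Types u v : V.

Lemma normE v : `|v| = (rnorm v)%:C.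
Proof.
have := normr_ge0 v; rewrite /rnorm lecE /= => /andP[/eqP i0 _].
by case: `|v| i0 => a b /= ->.
Qed.

Lemma rnorm_ge0 v : 0 <= rnorm v.
Proof. by rewrite -ler0c -normE. Qed.

Lemma rnorm0 : rnorm (0 : V) = 0.
Proof. by rewrite /rnorm normr0. Qed.

Lemma rnormN v : rnorm (- v) = rnorm v.
Proof. by rewrite /rnorm normrN. Qed.

Lemma rnormB u v : rnorm (u - v) = rnorm (v - u).
Proof. by rewrite /rnorm distrC. Qed.

Lemma ler_rnormD u v : rnorm (u + v) <= rnorm u + rnorm v.
Proof. by have := ler_normD u v; rewrite !normE -(rmorphD (real_complex R)) lecR. Qed.

Lemma ler_rnormB u v : rnorm (u - v) <= rnorm u + rnorm v.
Proof. by rewrite (le_trans (ler_rnormD _ _))// rnormN. Qed.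

Lemma ler_rdist w u v : rnorm (u - v) <= rnorm (u - w) + rnorm (w - v).
Proof. by rewrite -[u in leLHS](subrK w) -addrA ler_rnormD. Qed.

Lemma ler_rnorm_sum (I : Type) (r : seq I) (Q : pred I) (F : I -> V) :
  rnorm (\sum_(i <- r | Q i) F i) <= \sum_(i <- r | Q i) rnorm (F i).
Proof.
elim/big_rec2: _ => [|i y x _ h]; first by rewrite rnorm0.
by rewrite (le_trans (ler_rnormD _ _))// lerD2l.
Qed.

Lemma rnorm_eq0 v : rnorm v = 0 -> v = 0.
Proof. by move=> h; apply/eqP; rewrite -normr_eq0 normE h. Qed.

End RealNorm.

Section ComplexModulus.
Context (R : realType).
Implicit Types z w : R[i].

Lemma rnormE z : rnorm z = Num.sqrt (Re z ^+ 2 + Im z ^+ 2).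
Proof. by rewrite /rnorm normc_def. Qed.

Lemma rnormM z w : rnorm (z * w) = rnorm z * rnorm w.
Proof. by rewrite /rnorm normrM !normE -(rmorphM (real_complex R)). Qed.

Lemma rnorm1 : rnorm (1 : R[i]) = 1.
Proof. by rewrite /rnorm normr1. Qed.

Lemma rnormX z n : rnorm (z ^+ n) = rnorm z ^+ n.
Proof. by elim: n => [|n IH]; rewrite ?expr0 ?rnorm1// !exprS rnormM IH. Qed.

Lemma rnormV z : rnorm z^-1 = (rnorm z)^-1.
Proof. by rewrite /rnorm normfV normE -fmorphV. Qed.

Lemma rnormR (a : R) : rnorm (a%:C : R[i]) = `|a|.
Proof. by rewrite rnormE /= expr0n /= addr0 sqrtr_sqr. Qed.

Lemma rnormRM (a : R) z : rnorm (a%:C * z) = `|a| * rnorm z.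
Proof. by rewrite rnormM rnormR. Qed.

Lemma rnorm_nat n : rnorm (n%:R : R[i]) = n%:R.
Proof. by rewrite -(rmorph_nat (real_complex R)) rnormR normr_nat. Qed.

Lemma normRe_le z : `|Re z| <= rnorm z.
Proof. by have := normc_ge_Re z; rewrite normE lecR. Qed.

Lemma rnorm_le_ReIm z : rnorm z <= `|Re z| + `|Im z|.
Proof.
rewrite rnormE -[leRHS]ger0_norm ?addr_ge0// -sqrtr_sqr ler_wsqrtr// sqrrD.
rewrite !real_normK ?num_real//.
have := mulr_ge0 (normr_ge0 (Re z)) (normr_ge0 (Im z)); lra.
Qed.

End ComplexModulus.

Section NormedModule.
Context (R : realType) (X : normedModType R[i]).
Implicit Types (u v x : X) (S T : X -> X).

Lemma rnormZ (a : R[i]) x : rnorm (a *: x) = rnorm a * rnorm x.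
Proof. by rewrite /rnorm normrZ !normE -(rmorphM (real_complex R)). Qed.

Lemma rnormRZ (a : R) x : rnorm (a%:C *: x) = `|a| * rnorm x.
Proof. by rewrite rnormZ rnormR. Qed.

(** Positive elements of R[i] are real, so real epsilons suffice. *)
Lemma real_cvgP (u : nat -> X) (l : X) :
  (forall e : R, 0 < e -> exists N, forall n, (N <= n)%N -> rnorm (u n - l) < e)
  <-> u n @[n --> \oo] --> l.
Proof.
split=> [h|/cvgrPdist_lt h e e0].
  apply/cvgrPdist_lt => e; case: e => a b; rewrite ltcE /= => /andP[/eqP -> a0].
  have [N hN] := h a a0; exists N => // n /= Nn.
  by rewrite distrC normE -/(a%:C) ltcR hN.
have := h e%:C; rewrite ltcR => /(_ e0)[N _ hN]; exists N => n Nn.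
by have := hN n Nn; rewrite /= distrC normE ltcR.
Qed.

End NormedModule.

Section Banach.
Context (R : realType) (X : completeNormedModType R[i]).

Lemma geometric_cauchy_cvg (u : nat -> X) (c : R) :
  (forall n, rnorm (u n.+1 - u n) <= c / 2 ^+ n) ->
  exists l, forall n, rnorm (u n - l) <= c *+ 2 / 2 ^+ n.
Proof.
move=> hu.
have c0 : 0 <= c by have := le_trans (rnorm_ge0 _) (hu 0%N); rewrite divr1.
(* A difference, so that the induction closes: c / 2^n is 2c / 2^n - 2c / 2^(n+1). *)
have hd n k : rnorm (u (n + k)%N - u n) <= c *+ 2 / 2 ^+ n - c *+ 2 / 2 ^+ (n + k).
  elim: k => [|k IH]; first by rewrite addn0 !subrr rnorm0.
  rewrite (le_trans (ler_rdist (u (n + k)%N) _ _))//.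
  rewrite addnS (le_trans (lerD (hu _) IH))// exprS invfM.
  have := exprn_gt0 (n + k) (ltr0n R 2); set y : R := 2 ^+ _ => y0.
  set z := _ / 2 ^+ n; rewrite le_eqVlt; apply/orP; left; apply/eqP.
  by field; rewrite gt_eqF.
have hd' n k : rnorm (u (n + k)%N - u n) <= c *+ 2 / 2 ^+ n.
  apply: (le_trans (hd n k)).
  by rewrite gerBl divr_ge0 ?mulrn_wge0 ?exprn_ge0.
have small (e : R) : 0 < e -> exists n, c *+ 2 / 2 ^+ n < e.
  move=> e0; exists (Num.Def.archi_bound (c *+ 2 / e)).
  rewrite ltr_pdivrMr ?exprn_gt0// mulrC -ltr_pdivrMr//.
  have h : 0 <= c *+ 2 / e by rewrite divr_ge0 ?mulrn_wge0// ltW.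
  apply: lt_trans (archi_boundP h) _.
  by rewrite -natrX ltr_nat ltn_expl.
have /cauchy_cvgP cv : cauchy (u n @[n --> \oo]).
  apply/cauchyP => e; case: e => a b; rewrite ltcE /= => /andP[/eqP b0 a0].
  have [n hn] := small a a0; exists (u n); exists n => // k /= nk.
  rewrite -ball_normE /= normE b0 -/(a%:C) ltcR rnormB -(subnKC nk).
  exact: le_lt_trans (hd' _ _) hn.
exists (lim (u n @[n --> \oo])) => n.
apply/ler_addgt0Pr => e e0.
have /real_cvgP/(_ e e0)[N hN] := cv.
rewrite (le_trans (ler_rdist (u (n + N)%N) _ _))// lerD//.
  by rewrite rnormB.
by rewrite ltW// hN// leq_addl.
Qed.

End Banach.

Section LinearMaps.
Context (K : pzRingType) (V W : lmodType K) (S : V -> W).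
Hypothesis S_linear : linear S.

Lemma linear_fun0 : S 0 = 0.
Proof. by have := S_linear (-1) 0 0; rewrite scaler0 addr0 scaleN1r addNr. Qed.

Lemma linear_funZ a x : S (a *: x) = a *: S x.
Proof. by have := S_linear a x 0; rewrite linear_fun0 !addr0. Qed.

Lemma linear_funD x y : S (x + y) = S x + S y.
Proof. by have := S_linear 1 x y; rewrite !scale1r. Qed.

Lemma linear_funN x : S (- x) = - S x.
Proof. by rewrite -scaleN1r linear_funZ scaleN1r. Qed.

Lemma linear_funB x y : S (x - y) = S x - S y.
Proof. by rewrite linear_funD linear_funN. Qed.

Lemma linear_fun_sum (I : Type) (r : seq I) (Q : pred I) (F : I -> V) :
  S (\sum_(i <- r | Q i) F i) = \sum_(i <- r | Q i) S (F i).
Proof.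
by elim/big_rec2: _ => [|i y x _ <-]; rewrite ?linear_fun0 ?linear_funD.
Qed.

End LinearMaps.

Lemma ler_addgeom (R : realType) (a b c : R) :
  (forall n, a <= b + c / 2 ^+ n) -> a <= b.
Proof.
move=> h; apply/ler_addgt0Pr => e e0.
have h0 : 0 <= `|c| / e by rewrite divr_ge0// ltW.
apply: le_trans (h (Num.Def.archi_bound (`|c| / e))) _; rewrite lerD2l.
rewrite ler_pdivrMr ?exprn_gt0// (le_trans (ler_norm c))//.
rewrite mulrC -ler_pdivrMr// (le_trans (ltW (archi_boundP h0)))//.
by rewrite -natrX ler_nat ltnW// ltn_expl.
Qed.

(** * Integrals over [0, 1] as limits of dyadic sums *)

Section DyadicIntegral.
Context (R : realType) (X : completeNormedModType R[i]).
Implicit Types (f g h : R -> X) (l : X) (n : nat).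

Definition dyadic_sum f n : X :=
  ((2 ^+ n)^-1)%:C *: \sum_(0 <= k < 2 ^ n) f (k%:R / 2 ^+ n).

(** The rate is part of the notion: the integrands below are Lipschitz or have a primitive with
    quadratic remainder, and with a rate uniqueness and bounds follow from [ler_addgeom]. *)
Definition has_integral f l : Prop :=
  exists c, forall n, rnorm (dyadic_sum f n - l) <= c / 2 ^+ n.

Let sum_double (F : nat -> X) n :
  \sum_(0 <= k < 2 * n) F k = \sum_(0 <= k < n) (F k.*2 + F k.*2.+1).
Proof.
elim: n => [|n IH]; first by rewrite muln0 !big_nil.
by rewrite mulnS !addSn add0n !big_nat_recr//= IH -muln2 mulnC !addrA.
Qed.

Let dyad_in n k : (0 <= k < 2 ^ n)%N -> 0 <= (k%:R / 2 ^+ n : R) <= 1.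
Proof.
move=> /= kn; rewrite divr_ge0 ?exprn_ge0//= ler_pdivrMr ?exprn_gt0// mul1r.
by rewrite -natrX ler_nat ltnW.
Qed.

Let rnorm_avg (F : nat -> X) n c : (forall k, (0 <= k < 2 ^ n)%N -> rnorm (F k) <= c) ->
  rnorm (((2 ^+ n)^-1)%:C *: \sum_(0 <= k < 2 ^ n) F k) <= c.
Proof.
move=> hF; rewrite rnormRZ ger0_norm ?invr_ge0 ?exprn_ge0//.
rewrite mulrC ler_pdivrMr ?exprn_gt0//.
apply: le_trans (ler_rnorm_sum _ _ _) _.
apply: (@le_trans _ _ (\sum_(0 <= k < 2 ^ n) c)).
  by rewrite !big_nat ler_sum.
by rewrite sumr_const_nat subn0 -natrX mulr_natr.
Qed.

(** Halving the mesh replaces each value by its mean with the value at the new midpoint, so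
    consecutive sums differ by at most c / 2^n. *)
Lemma has_integral_ex f c :
  (forall u v, 0 <= u <= 1 -> 0 <= v <= 1 -> rnorm (f u - f v) <= c * `|u - v|) ->
  exists l, has_integral f l.
Proof.
move=> lf; have [|l hl] := @geometric_cauchy_cvg _ _ (dyadic_sum f) c; last by exists l, (c *+ 2).
move=> n.
have -> : dyadic_sum f n.+1 - dyadic_sum f n =
    (2^-1 : R)%:C *: (((2 ^+ n)^-1)%:C *: \sum_(0 <= k < 2 ^ n)
       (f (k.*2.+1%:R / 2 ^+ n.+1) - f (k%:R / 2 ^+ n))).
  have half : ((2 ^+ n.+1)^-1 : R)%:C = (2^-1 : R)%:C * ((2 ^+ n)^-1 : R)%:C :> R[i].
    by rewrite -rmorphM exprS invfM.
  have -> : dyadic_sum f n = (2^-1 : R)%:C *: (((2 ^+ n)^-1)%:C *: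
      \sum_(0 <= k < 2 ^ n) (f (k%:R / 2 ^+ n) *+ 2)).
    rewrite /dyadic_sum sumrMnl -(scaler_nat 2 (\sum_(_ <= _ < _) _)) !scalerA; congr (_ *: _).
    have -> : 2%:R = (2 : R)%:C :> R[i] by rewrite rmorph_nat.
    by rewrite mulrAC -rmorphM mulVf ?mul1r.
  rewrite /dyadic_sum half -scalerA -scalerBr -scalerBr; congr (_ *: (_ *: _)).
  rewrite expnS sum_double -sumrB; apply: eq_bigr => k _.
  have -> : k.*2%:R / 2 ^+ n.+1 = k%:R / 2 ^+ n :> R.
    by rewrite exprS invfM -mul2n natrM mulrACA divff ?mul1r.
  by rewrite mulr2n opprD addrA [_ + f _]addrC addrK.
rewrite rnormRZ ger0_norm ?invr_ge0//.
suff h : rnorm (((2 ^+ n)^-1)%:C *: (\sum_(0 <= k < 2 ^ n)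
       (f (k.*2.+1%:R / 2 ^+ n.+1) - f (k%:R / 2 ^+ n)))) <= c / 2 ^+ n.
  by rewrite (le_trans _ h)// ler_piMl ?rnorm_ge0// invf_le1// ler1n.
apply: rnorm_avg => k kn; have := dyad_in kn; move: kn => /= kn kn1.
have kn2 : 0 <= (k.*2.+1%:R / 2 ^+ n.+1 : R) <= 1.
  by apply: dyad_in; rewrite /= expnS; lia.
have := lf _ _ kn2 kn1.
have -> : k.*2.+1%:R / 2 ^+ n.+1 - k%:R / 2 ^+ n = (2 ^+ n.+1)^-1 :> R.
  have := exprn_gt0 n (ltr0n R 2); rewrite exprS -[k.*2.+1%:R]natr1 -muln2 natrM.
  set y := _ ^+ _ => y0; field; rewrite gt_eqF//.
rewrite ger0_norm ?invr_ge0 ?exprn_ge0// => h.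
have c0 : 0 <= c / 2 ^+ n.+1 := le_trans (rnorm_ge0 _) h.
apply: (le_trans h); move: c0; rewrite exprS invfM mulrCA pmulr_rge0// => c0.
by rewrite ler_piMl// invf_le1// ler1n.
Qed.

Lemma has_integral_unique f l l' : has_integral f l -> has_integral f l' -> l = l'.
Proof.
move=> [c hc] [d hd]; apply/eqP; rewrite -subr_eq0; apply/eqP/rnorm_eq0/le_anti.
rewrite rnorm_ge0 andbT; apply: (@ler_addgeom _ _ _ (c + d)) => n.
rewrite add0r mulrDl; apply: le_trans (ler_rdist (dyadic_sum f n) _ _) _.
by rewrite lerD// rnormB.
Qed.

Lemma has_integral_linear (a : R[i]) f g l k : has_integral f l -> has_integral g k ->
  has_integral (fun u => a *: f u + g u) (a *: l + k).
Proof.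
move=> [c hc] [d hd]; exists (rnorm a * c + d) => n.
have -> : dyadic_sum (fun u => a *: f u + g u) n - (a *: l + k) =
    a *: (dyadic_sum f n - l) + (dyadic_sum g n - k).
  rewrite /dyadic_sum big_split/= -scaler_sumr scalerDr !scalerBr !scalerA opprD.
  by rewrite [_%:C * a]mulrC addrACA.
apply: le_trans (ler_rnormD _ _) _; rewrite rnormZ mulrDl lerD// -mulrA.
by rewrite ler_wpM2l ?rnorm_ge0.
Qed.

Lemma has_integral_le f l c : has_integral f l ->
  (forall u, 0 <= u <= 1 -> rnorm (f u) <= c) -> rnorm l <= c.
Proof.
move=> [d hd] hf; apply: (@ler_addgeom _ _ _ d) => n.
rewrite -(subrK (dyadic_sum f n) l) addrC (le_trans (ler_rnormD _ _))// lerD// ?[rnorm (l - _)]rnormB//.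
by apply: rnorm_avg => k /dyad_in; exact: hf.
Qed.

(** Each of the 2^n cells leaves a remainder of at most c / 4^n. *)
Lemma has_integral_ftc f h c :
  (forall u v, 0 <= u <= 1 -> 0 <= v <= 1 ->
    rnorm (h v - h u - (v - u)%:C *: f u) <= c * (v - u) ^+ 2) ->
  has_integral f (h 1 - h 0).
Proof.
move=> hf; exists c => n.
have p2 : 0 < 2 ^+ n :> R by rewrite exprn_gt0.
have -> : h 1 - h 0 = \sum_(0 <= k < 2 ^ n) (h (k.+1%:R / 2 ^+ n) - h (k%:R / 2 ^+ n)).
  rewrite (telescope_sumr (fun k => h (k%:R / 2 ^+ n)))//.
  by rewrite natrX mulfV ?gt_eqF// mul0r.
rewrite /dyadic_sum scaler_sumr -sumrB.
apply: le_trans (ler_rnorm_sum _ _ _) _.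
apply: (@le_trans _ _ (\sum_(0 <= k < 2 ^ n) (c / (2 ^+ n) ^+ 2))).
  rewrite !big_nat ler_sum// => k kn.
  have kn' : 0 <= (k.+1%:R / 2 ^+ n : R) <= 1.
    rewrite divr_ge0 ?exprn_ge0//= ler_pdivrMr ?exprn_gt0// mul1r.
    by rewrite -natrX ler_nat.
  have := hf _ _ (dyad_in kn) kn'.
  have -> : k.+1%:R / 2 ^+ n - k%:R / 2 ^+ n = (2 ^+ n)^-1 :> R.
    by rewrite -mulrBl -natrB ?leqnSn// subSnn mul1r.
  by rewrite exprVn; apply: le_trans; rewrite rnormB.
rewrite sumr_const_nat subn0 -[_ *+ (2 ^ n)]mulr_natr natrX -mulrA expr2 invfM -mulrA mulVf ?mulr1//.
Qed.

End DyadicIntegral.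

(** * A primitive of the resolvent *)

Section ResolventPrimitive.
Context (R : realType) (X : completeNormedModType R[i]).
Context (T : X -> X) (cT : R) (T_linear : linear T)
  (T_le : forall x, rnorm (T x) <= cT * rnorm x) (cT_ge0 : 0 <= cT).
Context (L : set R[i]) (D : R[i] -> R -> X -> X) (B : R) (B_ge0 : 0 <= B).
Let dom l (u : R) := L l /\ 0 <= u <= 1.
Let E x := x - T x.
(* D l u = (l - u T)^-1. With E = I - T,
   E^3 (l - T)^-1 - l^-1 E^3 = int_0^1 E^3 T D(l, u)^2 du, and the integral of the
   right-hand side in l is [- log_part l]; only three factors E, one for each of
   the resolvents in [log_part_derive], make the bounds uniform up to l = 1. *)
Hypothesis D_linear : forall l u, dom l u -> linear (D l u).
Hypothesis D_l : forall l u x, dom l u -> D l u (l *: x - u%:C *: T x) = x.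
Hypothesis D_r : forall l u x, dom l u -> l *: D l u x - u%:C *: T (D l u x) = x.
Hypothesis ED_le : forall l u x, dom l u -> rnorm (E (D l u x)) <= B * rnorm x.

Let E_linear : linear E.
Proof. by move=> a x y; rewrite /E T_linear scalerBr addrACA opprD. Qed.

Lemma parametric_resolventC l u x : dom l u -> D l u (T x) = T (D l u x).
Proof.
move=> h; rewrite -{1}[x](D_r x h) (linear_funB T_linear) !(linear_funZ T_linear).
by rewrite D_l.
Qed.

Let D_E l u x : dom l u -> D l u (E x) = E (D l u x).
Proof. by move=> h; rewrite /E (linear_funB (D_linear h)) parametric_resolventC. Qed.

(** The resolvent identity A^-1 - B^-1 = A^-1 B^-1 (B - A) for A = l - u T and B = m - v T: one
    identity for variations of both parameters. *)
Lemma parametric_resolventB l u m v x : dom l u -> dom m v ->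
  D l u x - D m v x = D l u (D m v ((m - l) *: x - (v - u)%:C *: T x)).
Proof.
move=> hl hm; rewrite -{1}[x](D_r x hm) (linear_funB (D_linear hm)).
rewrite (linear_funZ (D_linear hm)) (linear_funZ (D_linear hm)).
rewrite parametric_resolventC//; set y := D m v x.
have -> : m *: y - v%:C *: T y =
    (l *: y - u%:C *: T y) + ((m - l) *: y - (v - u)%:C *: T y).
  by rewrite rmorphB !scalerBl addrACA [l *: y + _]addrC subrK -opprD [u%:C *: _ + _]addrC subrK.
by rewrite (linear_funD (D_linear hl) (l *: y - _)) D_l// [y + _]addrC addrK.
Qed.

Let G x := E (E (E (T x))).
Let ET x : E (T x) = T (E x). Proof. by rewrite /E (linear_funB T_linear). Qed.

Let G_linear : linear G.
Proof. by move=> a x y; rewrite /G T_linear !E_linear. Qed.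

Let GD3 l u m v n w x : dom l u -> dom m v -> dom n w ->
  rnorm (G (D l u (D m v (D n w x)))) <= cT * B ^+ 3 * rnorm x.
Proof.
move=> hl hm hn.
have -> : G (D l u (D m v (D n w x))) = T (E (D l u (E (D m v (E (D n w x)))))).
  by rewrite /G !ET !D_E.
rewrite -!mulrA (le_trans (T_le _))// ler_wpM2l//.
rewrite (le_trans (ED_le _ hl))// ler_wpM2l//.
by rewrite (le_trans (ED_le _ hm))// ler_wpM2l// ED_le.
Qed.

Let cE := 1 + cT.
Let E_le x : rnorm (E x) <= cE * rnorm x.
Proof. by rewrite mulrDl mul1r (le_trans (ler_rnormB _ _))// lerD2l. Qed.

Let GD2 l u m v x : dom l u -> dom m v ->
  rnorm (G (D l u (D m v x))) <= cT * (B ^+ 2 * cE) * rnorm x.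
Proof.
move=> hl hm.
have -> : G (D l u (D m v x)) = T (E (D l u (E (D m v (E x))))).
  by rewrite /G !ET !D_E.
rewrite -!mulrA (le_trans (T_le _))// ler_wpM2l//.
rewrite (le_trans (ED_le _ hl))// ler_wpM2l//.
by rewrite (le_trans (ED_le _ hm))// ler_wpM2l.
Qed.

Lemma log_integrand_integral_ex l x : L l -> exists y, has_integral (fun u => G (D l u x)) y.
Proof.
move=> hl; apply: (@has_integral_ex _ _ _ (cT * (B ^+ 2 * cE) * (cT * rnorm x))) => u v hu hv.
have du : dom l u by []. have dv : dom l v by [].
rewrite -(linear_funB G_linear) (parametric_resolventB _ du dv) subrr scale0r sub0r.
rewrite (linear_funN (D_linear dv)) (linear_funN (D_linear du)) (linear_funN G_linear) rnormN.
rewrite (le_trans (GD2 _ du dv))// -[leRHS]mulrA ler_wpM2l ?mulr_ge0 ?exprn_ge0 ?addr_ge0//.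
by rewrite rnormRZ distrC mulrC ler_wpM2r.
Qed.

Definition log_part l x := xget 0 [set y | has_integral (fun u => G (D l u x)) y].

Lemma log_partP l x : L l -> has_integral (fun u => G (D l u x)) (log_part l x).
Proof. by move=> hl; apply: (xgetPex 0); exact: log_integrand_integral_ex. Qed.

Lemma log_part_linear l : L l -> linear (log_part l).
Proof.
move=> hl a x y; have h := has_integral_linear a (log_partP x hl) (log_partP y hl).
apply: has_integral_unique (log_partP _ hl) _.
(* [D_linear] is known for u in [0, 1] only, so the integrands are compared at the dyadic nodes and
   not as functions. *)
case: h => c hc; exists c => n; move: (hc n); congr (rnorm (_ - _) <= _).
rewrite /dyadic_sum; congr (_ *: _); rewrite !big_nat; apply: eq_bigr => k kn.
rewrite -G_linear -D_linear//; split=> //.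
rewrite divr_ge0 ?exprn_ge0//= ler_pdivrMr ?exprn_gt0// mul1r.
by rewrite -natrX ler_nat ltnW.
Qed.

Let has_integralB f g (y z : X) : has_integral f y -> has_integral g z ->
  has_integral (fun u => f u - g u) (y - z).
Proof.
move=> hf hg; rewrite addrC -scaleN1r; have [c hc] := has_integral_linear (-1) hg hf.
exists c => n; move: (hc n); congr (rnorm (_ - _) <= _).
by rewrite /dyadic_sum; congr (_ *: _); apply: eq_bigr => k _; rewrite scaleN1r addrC.
Qed.

Let integral_resolventB l m x : L l -> L m ->
  has_integral (fun u => (m - l) *: G (D l u (D m u x))) (log_part l x - log_part m x).
Proof.
move=> hl hm; have [c hc] := has_integralB (log_partP x hl) (log_partP x hm).
exists c => n; move: (hc n); congr (rnorm (_ - _) <= _).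
rewrite /dyadic_sum; congr (_ *: _); rewrite !big_nat; apply: eq_bigr => k kn.
set u := _ / _; have hu : 0 <= u <= 1.
  rewrite divr_ge0 ?exprn_ge0//= ler_pdivrMr ?exprn_gt0// mul1r.
  by rewrite -natrX ler_nat ltnW.
have dl : dom l u by []. have dm : dom m u by [].
rewrite -(linear_funB G_linear) (parametric_resolventB _ dl dm) subrr scale0r subr0.
by rewrite (linear_funZ (D_linear dm)) (linear_funZ (D_linear dl)) (linear_funZ G_linear).
Qed.

(** The constant does not degenerate as l tends to 1; this is why [log_part] will have no increment
    over the whole contour. *)
Lemma log_part_lip l m x : L l -> L m ->
  rnorm (log_part l x - log_part m x) <= cT * (B ^+ 2 * cE) * rnorm (m - l) * rnorm x.
Proof.
move=> hl hm; apply: has_integral_le (integral_resolventB x hl hm) _ => u hu.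
rewrite rnormZ mulrAC [leRHS]mulrC ler_wpM2l ?rnorm_ge0//.
by apply: GD2.
Qed.

Let E3 x := E (E (E x)).

(** Here l and m are the ends of a cell of a partition and n is its tag. The increment of [log_part]
    is the integral over u of (l - m) G D(m, u) D(l, u), and the bracket is that of G D(n, u)^2, by
    differentiating E^3 D(n, u) in u. Replacing l and m by n costs two more resolvent differences,
    so the remainder is quadratic. *)
Lemma log_part_derive l m n x : L l -> L m -> L n ->
  rnorm (log_part m x - log_part l x + (m - l) *: (E3 (D n 1 x) - E3 (D n 0 x)))
    <= cT * B ^+ 3 * rnorm (m - l) * (rnorm (m - n) + rnorm (l - n)) * rnorm x.
Proof.
move=> hl hm hn.
have i01 (u : R) : 0 <= u <= 1 -> dom n u by [].
have h01 : 0 <= (0 : R) <= 1 by rewrite lexx ler01.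
have h11 : 0 <= (1 : R) <= 1 by rewrite lexx ler01.
have hI : has_integral (fun u => G (D n u (D n u x))) (E3 (D n 1 x) - E3 (D n 0 x)).
  apply: (@has_integral_ftc _ _ _ (fun u => E3 (D n u x)) (cT * B ^+ 3 * (cT * rnorm x))).
  move=> u v hu hv; have du := i01 u hu; have dv := i01 v hv.
  have E3_linear : linear E3 by move=> a y z; rewrite /E3 !E_linear.
  set a := (v - u)%:C.
  have e1 y : D n v y - D n u y = a *: D n v (D n u (T y)).
    rewrite (parametric_resolventB _ dv du) subrr scale0r sub0r -scaleNr -rmorphN opprB.
    by rewrite (linear_funZ (D_linear du)) (linear_funZ (D_linear dv)).
  have -> : E3 (D n v x) - E3 (D n u x) - a *: G (D n u (D n u x)) =
      ((v - u) ^+ 2)%:C *: G (D n v (D n u (D n u (T x)))).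
    rewrite -(linear_funB E3_linear) e1 (linear_funZ E3_linear) -scalerBr.
    have -> : G (D n u (D n u x)) = E3 (D n u (D n u (T x))).
      by rewrite /G -!parametric_resolventC.
    rewrite -(linear_funB E3_linear) e1 (linear_funZ E3_linear) scalerA -rmorphM -expr2.
    by rewrite /G -!parametric_resolventC.
  rewrite rnormRZ ger0_norm ?sqr_ge0// mulrC ler_wpM2r ?sqr_ge0//.
  rewrite (le_trans (GD3 _ dv du du))// ler_wpM2l//.
  by rewrite mulr_ge0// exprn_ge0.
have := has_integral_linear (m - l) hI (integral_resolventB x hm hl).
rewrite [X in rnorm X <= _]addrC => /has_integral_le; apply=> u hu.
have dl : dom l u by []. have dm : dom m u by []. have dn : dom n u by [].
rewrite -[l - m]opprB scaleNr -scalerBr rnormZ.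
rewrite -[leRHS]mulrA -mulrA [leRHS]mulrCA ler_wpM2l ?rnorm_ge0//.
have -> : G (D n u (D n u x)) - G (D m u (D l u x)) =
    (m - n) *: G (D n u (D m u (D n u x))) + (l - n) *: G (D m u (D n u (D l u x))).
  have e k k' y : dom k u -> dom k' u -> D k u y - D k' u y = (k' - k) *: D k u (D k' u y).
    move=> hk hk'; rewrite (parametric_resolventB _ hk hk') subrr scale0r subr0.
    by rewrite (linear_funZ (D_linear hk')) (linear_funZ (D_linear hk)).
  rewrite -2!(linear_funZ G_linear) -(linear_funB G_linear) -(linear_funD G_linear).
  rewrite -e// -(linear_funZ (D_linear dm)) -e// (linear_funB (D_linear dm)).
  by rewrite addrA subrK.
rewrite (le_trans (ler_rnormD _ _))// mulrDl mulrDr lerD// rnormZ.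
  by rewrite mulrCA ler_wpM2l ?rnorm_ge0// GD3.
by rewrite mulrCA ler_wpM2l ?rnorm_ge0// GD3.
Qed.

End ResolventPrimitive.

(** * Operator norms and path integrals *)

Section OperatorNorm.
Context (R : realType) (X : completeNormedModType R[i]).
Implicit Types S : X -> X.

Lemma opnorm_le S (c : R) : 0 <= c ->
  (forall x, rnorm (S x) <= c * rnorm x) -> (opnorm S <= c%:E)%E.
Proof.
move=> c0 h; apply: ge_ereal_sup => _ [x /= x1 <-].
by rewrite lee_fin (le_trans (h x))// ler_piMr.
Qed.

Lemma opnorm_le_unit S (c : R) x : (opnorm S <= c%:E)%E -> rnorm x <= 1 -> rnorm (S x) <= c.
Proof.
move=> h x1; rewrite -lee_fin (le_trans _ h)//.
by apply: ereal_sup_ubound; exists x.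
Qed.

Lemma opnorm_le_apply S (c : R) x : linear S -> (opnorm S <= c%:E)%E ->
  rnorm (S x) <= c * rnorm x.
Proof.
move=> lS h; have [/rnorm_eq0 ->|x0] := eqVneq (rnorm x) 0.
  by rewrite (linear_fun0 lS) rnorm0 mulr0.
have xp : 0 < rnorm x by rewrite lt_neqAle eq_sym x0 rnorm_ge0.
have := @opnorm_le_unit S c ((rnorm x)^-1%:C *: x) h.
rewrite (linear_funZ lS) !rnormRZ ger0_norm ?invr_ge0 ?rnorm_ge0// mulVf//.
by move=> /(_ (lexx _)); rewrite mulrC ler_pdivrMr.
Qed.

Lemma bounded_operator_le S : bounded_operator S ->
  exists2 c : R, 0 <= c & forall x, rnorm (S x) <= c * rnorm x.
Proof.
move=> [lS cS]; have /cvgrPdist_lt/(_ 1 ltr01) := cS 0.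
rewrite nearE => /nbhs_ballP[e]; case: e => a b; rewrite /= ltcE /= => /andP[/eqP -> a0] h.
have key y : rnorm y < a -> rnorm (S y) < 1.
  have := h y; rewrite -ball_normE /= sub0r normrN (linear_fun0 lS) sub0r normrN.
  rewrite !normE -[1]/((1 : R)%:C) -/(a%:C) => h1 ya.
  by rewrite -ltcR h1// ltcR.
exists (2 / a); first by rewrite divr_ge0 ?ltW.
move=> x; have [/rnorm_eq0 ->|x0] := eqVneq (rnorm x) 0.
  by rewrite (linear_fun0 lS) rnorm0 mulr0.
have xp : 0 < rnorm x by rewrite lt_neqAle eq_sym x0 rnorm_ge0.
have := key ((a / 2 / rnorm x)%:C *: x).
have p : 0 < a / 2 / rnorm x by rewrite !divr_gt0.
rewrite (linear_funZ lS) !rnormRZ (ger0_norm (ltW p)) (divfK x0).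
have a2 : a / 2 < a by rewrite ltr_pdivrMr// ltr_pMr// ltr1n.
move=> /(_ a2); rewrite -ltr_pdivlMl// mulr1 => /ltW h2.
rewrite (le_trans h2)// le_eqVlt; apply/orP; left; apply/eqP.
by field; rewrite x0 gt_eqF.
Qed.

Lemma bounded_operatorI S (c : R) : linear S -> 
  (forall x, rnorm (S x) <= c * rnorm x) -> bounded_operator S.
Proof.
move=> lS h; split=> // x; apply/cvgrPdist_lt => e; case: e => a b.
rewrite ltcE /= => /andP[/eqP -> a0].
have c0 : 0 < `|c| + 1 by rewrite ltr_wpDl.
apply/nbhs_ballP; exists (a / (`|c| + 1))%:C => /=; first by rewrite ltcR divr_gt0.
move=> y; rewrite -ball_normE /= !normE -/(a%:C) !ltcR => xy.
rewrite -(linear_funB lS) (le_lt_trans (h _))//.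
move: xy; rewrite ltr_pdivlMr// mulrC; apply: le_lt_trans.
by rewrite ler_wpM2r ?rnorm_ge0// (le_trans (ler_norm _))// lerDl.
Qed.

End OperatorNorm.

Section PathIntegrals.
Context (R : realType) (X : completeNormedModType R[i]).
Implicit Types (S : X -> X) (F : R[i] -> X -> X) (g : R -> R[i]).

(** The remainder is uniform in the tag xi, so every Riemann sum telescopes to A b - A a with an
    error of at most c (b - a) times the mesh. *)
Lemma path_integral_of_primitive F g (A : R -> X -> X) (a b c : R) : a < b -> 0 <= c ->
  (forall t xi t' x, a <= t -> t <= xi <= t' -> t' <= b ->
    rnorm (A t' x - A t x - (g t' - g t) *: F (g xi) x) <= c * (t' - t) ^+ 2 * rnorm x) ->
  is_path_integral F g a b (A b - A a).
Proof.
move=> ab c0 hA e e0; have K0 : 0 < c * (b - a) + 1 by rewrite ltr_wpDl// mulr_ge0// subr_ge0 ltW.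
exists (e / 2 / (c * (b - a) + 1)); first by rewrite !divr_gt0.
move=> n t xi t0 tn ht.
apply: (@le_lt_trans _ _ (e / 2)%:E); last first.
  by rewrite lte_fin ltr_pdivrMr// ltr_pMr// ltr1n.
apply: opnorm_le => [|x]; first by rewrite divr_ge0 ?ltW.
have tle i j : (i <= j <= n)%N -> t i <= t j.
  move=> /andP[]; elim: j => [|j IH]; first by rewrite leqn0 => /eqP ->.
  rewrite leq_eqVlt => /predU1P[->//|ij jn]; rewrite (le_trans (IH ij (ltnW jn)))//.
  by have [/andP[h1 h2] _] := ht j jn; apply: le_trans h2.
have -> : (\sum_(i < n) (g (t i.+1) - g (t i)) *: F (g (xi i)) - (A b - A a)) x =
    - \sum_(i < n) (A (t i.+1) x - A (t i) x - (g (t i.+1) - g (t i)) *: F (g (xi i)) x).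
  rewrite sumrB -(big_mkord xpredT (fun i => A (t i.+1) x - A (t i) x)).
  rewrite (telescope_sumr (fun i => A (t i) x))// t0 tn.
  by rewrite !fctE fct_sumE !opprB.
rewrite rnormN (le_trans (ler_rnorm_sum _ _ _))//.
apply: (@le_trans _ _ (\sum_(i < n) c * (e / 2 / (c * (b - a) + 1)) * rnorm x * (t i.+1 - t i))).
  apply: ler_sum => i _; have [/andP[h1 h2] h3] := ht i (ltn_ord i).
  have h4 : a <= t i by rewrite -t0 tle//= ltnW.
  have h5 : t i.+1 <= b by rewrite -tn tle//= leqnn andbT.
  apply: le_trans (hA _ _ _ x h4 _ h5) _; first by rewrite h1.
  rewrite [leRHS]mulrAC ler_wpM2r ?rnorm_ge0// -[leRHS]mulrA ler_wpM2l// expr2.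
  by rewrite ler_wpM2r ?subr_ge0 ?(le_trans h1)// ltW.
rewrite -mulr_sumr -(big_mkord xpredT (fun i => t i.+1 - t i)) telescope_sumr// t0 tn.
rewrite mulrAC ler_wpM2r ?rnorm_ge0//.
have -> : c * (e / 2 / (c * (b - a) + 1)) * (b - a) = e / 2 * (c * (b - a) / (c * (b - a) + 1)).
  by ring.
by rewrite ler_piMr ?divr_ge0 ?(ltW e0)// ler_pdivrMr// mul1r lerDl.
Qed.

(** Both operators are compared with one uniform partition that is fine enough for both. The
    estimate is made on the unit ball, where [opnorm] acts directly, because the proper integrals
    inside an improper one are not assumed linear. *)
Lemma path_integral_unit F g a b S S' x (e : R) : a < b -> 0 < e ->
  is_path_integral F g a b S -> is_path_integral F g a b S' ->
  rnorm x <= 1 -> rnorm (S x - S' x) <= e.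
Proof.
move=> ab e0 hS hS' x1.
have e20 : 0 < e / 2 by rewrite divr_gt0.
have [d d0 hd] := hS _ e20; have [d' d'0 hd'] := hS' _ e20.
pose N := (Num.Def.archi_bound ((b - a) / Num.min d d')).+1.
have m0 : 0 < Num.min d d' by rewrite lt_min d0.
have N0 : 0 < N%:R :> R by rewrite ltr0n.
have mesh : (b - a) / N%:R < Num.min d d'.
  rewrite ltr_pdivrMr// mulrC -ltr_pdivrMr//.
  apply: lt_trans (archi_boundP _) _; first by rewrite divr_ge0 ?subr_ge0 ?ltW.
  by rewrite ltr_nat.
pose t i : R := a + i%:R * ((b - a) / N%:R).
have ht i : t i <= t i <= t i.+1 /\ t i.+1 - t i < Num.min d d'.
  have -> : t i.+1 = t i + (b - a) / N%:R by rewrite /t -natr1 mulrDl mul1r addrA.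
  by rewrite lexx lerDl divr_ge0 ?subr_ge0 ?ltW// addrC addKr.
have t0 : t 0%N = a by rewrite /t mul0r addr0.
have tN : t N = b by rewrite /t mulrCA mulfV ?gt_eqF// mulr1 addrC subrK.
have h1 : forall i, (i < N)%N -> t i <= t i <= t i.+1 /\ t i.+1 - t i < d.
  by move=> i _; have [? h] := ht i; split=> //; rewrite (lt_le_trans h)// ge_min lexx.
have h2 : forall i, (i < N)%N -> t i <= t i <= t i.+1 /\ t i.+1 - t i < d'.
  by move=> i _; have [? h] := ht i; split=> //; rewrite (lt_le_trans h)// ge_min lexx orbT.
have /ltW/(opnorm_le_unit)/(_ x1) := hd N t t t0 tN h1.
have /ltW/(opnorm_le_unit)/(_ x1) := hd' N t t t0 tN h2.
rewrite !fctE; set s := (\sum_(_ < _) _) x => k' k.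
rewrite (le_trans (ler_rdist s _ _))// (splitr e) lerD//.
by rewrite rnormB.
Qed.

Lemma improper_path_integral_unique F g a b S S' : a < b ->
  linear S -> linear S' ->
  is_improper_path_integral F g a b S -> is_improper_path_integral F g a b S' -> S = S'.
Proof.
move=> ab lS lS' [I [I1 I2]] [I' [I'1 I'2]].
have unit x (e : R) : 0 < e -> rnorm x <= 1 -> rnorm (S x - S' x) <= e *+ 3.
  move=> e0 x1; have [d d0 hd] := I2 e e0; have [d' d'0 hd'] := I'2 e e0.
  (* A third of the smallest length: the cut-offs a + m and b - m suit both integrals and do not
     cross. *)
  pose m := Num.min (Num.min d d') (b - a) / 3.
  have m0 : 0 < m by rewrite divr_gt0// !lt_min d0 d'0 subr_gt0.
  have mm : m *+ 3 = Num.min (Num.min d d') (b - a) by rewrite /m -mulr_natr divfK.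
  have md : m < d.
    have : m *+ 3 <= d by rewrite mm !ge_min lexx.
    by move: m0; clear; lra.
  have md' : m < d'.
    have : m *+ 3 <= d' by rewrite mm !ge_min lexx orbT.
    by move: m0; clear; lra.
  have mb : m *+ 3 <= b - a by rewrite mm ge_min lexx orbT.
  have u1 : a < a + m by rewrite ltrDl.
  have u2 : a + m < b - m by move: m0 mb; clear; lra.
  have u3 : b - m < b by move: m0; clear; lra.
  have := path_integral_unit u2 e0 (I1 _ _ u1 u2 u3) (I'1 _ _ u1 u2 u3) x1.
  have k1 : a < a + m < a + d by rewrite u1/= ltrD2l.
  have k2 : b - d < b - m < b by rewrite u3 andbT ltrD2l ltrN2.
  have k1' : a < a + m < a + d' by rewrite u1/= ltrD2l.
  have k2' : b - d' < b - m < b by rewrite u3 andbT ltrD2l ltrN2.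
  have /ltW/opnorm_le_unit/(_ x1) := hd _ _ k1 k2 u2.
  have /ltW/opnorm_le_unit/(_ x1) := hd' _ _ k1' k2' u2.
  rewrite !fctE => j' j ji.
  rewrite (le_trans (ler_rdist (I (a + m) (b - m) x) _ _))// mulrS lerD//.
    by rewrite rnormB.
  by rewrite (le_trans (ler_rdist (I' (a + m) (b - m) x) _ _))// mulr2n lerD.
have unit0 x : rnorm x <= 1 -> S x = S' x.
  move=> x1; apply/eqP; rewrite -subr_eq0; apply/eqP/rnorm_eq0/le_anti.
  rewrite rnorm_ge0 andbT; apply/ler_addgt0Pr => e e0; rewrite add0r.
  have e3 : 0 < e / 3 by rewrite divr_gt0.
  by apply: le_trans (unit x _ e3 x1) _; clear; lra.
apply/funext => x.
have h0 : 0 < rnorm x + 1 by rewrite ltr_wpDl// rnorm_ge0.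
have h : rnorm ((rnorm x + 1)^-1%:C *: x) <= 1.
  by rewrite rnormRZ ger0_norm ?invr_ge0 ?(ltW h0)// mulrC ler_pdivrMr// mul1r lerDl.
have := unit0 _ h; rewrite (linear_funZ lS) (linear_funZ lS').
apply: scalerI; apply/negP => /eqP []/eqP; rewrite invr_eq0.
by rewrite gt_eqF.
Qed.

(** [xget] returns some witness; uniqueness identifies it with S. *)
Lemma improper_path_integralE F g a b S : a < b -> bounded_operator S ->
  is_improper_path_integral F g a b S -> improper_path_integral F g a b = S.
Proof.
move=> ab bS hS; have [[l1 _] h1] : [set S | bounded_operator S /\
    is_improper_path_integral F g a b S] (improper_path_integral F g a b).
  by apply: (xgetPex (0 : X -> X)); exists S.
exact: improper_path_integral_unique l1 bS.1 h1 hS.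
Qed.

End PathIntegrals.

(** * The boundary of the Stolz domain *)

Section RealMeanValue.
Context (R : realType).

Lemma mean_value (f df : R -> R) (a b : R) : a <= b ->
  (forall x : R, a <= x <= b -> is_derive x 1 f (df x)) ->
  exists2 c : R, a <= c <= b & f b - f a = df c * (b - a).
Proof.
move=> ab h; have [||c] := @MVT_segment R f df a b ab.
- by move=> x; rewrite in_itv/= => /andP[h1 h2]; apply: h; rewrite !ltW.
- by apply: derivable_within_continuous => x; rewrite in_itv/= => /h[].
by rewrite in_itv/= => hc e; exists c.
Qed.

Lemma mean_value_lip (f df : R -> R) (M x y : R) :
  (forall x : R, is_derive x 1 f (df x)) -> (forall x, `|df x| <= M) ->
  `|f x - f y| <= M * `|x - y|.
Proof.
move=> hd hM; wlog xy : x y / y <= x.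
  by move=> H; case: (leP y x) => [/H//|/ltW/H]; rewrite distrC [X in _ <= _ * X]distrC.
have [c _ ->] := mean_value xy (fun x _ => hd x).
by rewrite normrM ler_wpM2r.
Qed.

Lemma cos_lip (x y : R) : `|cos x - cos y| <= `|x - y|.
Proof.
rewrite -[leRHS]mul1r; apply: (@mean_value_lip cos (fun x => - sin x)) => z.
by rewrite normrN sin_max.
Qed.

Lemma sin_lip (x y : R) : `|sin x - sin y| <= `|x - y|.
Proof.
by rewrite -[leRHS]mul1r; apply: (@mean_value_lip sin cos) => z; exact: cos_max.
Qed.

(** Together with [sin_minus_id_le], this bounds the remainder of exp(i x) - 1 - i x on the arc of
    the contour. Only the order of the bound matters. *)
Lemma one_minus_cos_le (x : R) : `|1 - cos x| <= x ^+ 2.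
Proof.
have [c hc e] : exists2 c : R, `|c| <= `|x| & cos x - 1 = - sin c * x.
  have [x0|x0] := leP 0 x.
    have [c /andP[c0 cx]] := mean_value x0 (fun z _ => is_derive_cos z).
    by rewrite cos0 subr0 => e; exists c => //; rewrite !ger0_norm// (le_trans c0).
  have [c /andP[c0 cx]] := mean_value (ltW x0) (fun z _ => is_derive_cos z).
  rewrite cos0 sub0r => e; exists c; first by rewrite !ler0_norm ?lerN2 ?(ltW x0).
  by lra.
rewrite distrC e mulNr normrN normrM -real_normK ?num_real// expr2 ler_wpM2r//.
by rewrite (le_trans _ hc)// -[sin c]subr0 -sin0 (le_trans (sin_lip _ _))// subr0.
Qed.

Lemma sin_minus_id_le (x : R) : `|x - sin x| <= x ^+ 2.
Proof.
have hd (z : R) : is_derive z 1 (fun y : R => y - sin y) (1 - cos z) by exact: is_deriveB.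
have [c hc e] : exists2 c : R, `|c| <= `|x| & x - sin x = (1 - cos c) * x.
  have [x0|x0] := leP 0 x.
    have [c /andP[c0 cx]] := mean_value x0 (fun z _ => hd z).
    by rewrite sin0 !subr0 => e; exists c => //; rewrite !ger0_norm// (le_trans c0).
  have [c /andP[c0 cx]] := mean_value (ltW x0) (fun z _ => hd z).
  rewrite sin0 !subr0 !sub0r => e; exists c; first by rewrite !ler0_norm ?lerN2 ?(ltW x0).
  by lra.
rewrite e normrM -real_normK ?num_real// expr2 ler_wpM2r//.
by rewrite (le_trans _ hc)// -cos0 (le_trans (cos_lip _ _))// sub0r normrN.
Qed.

End RealMeanValue.

(** * Half-planes that contain the Stolz domain *)

Section HalfPlanes.
Context (R : realType).
Implicit Types (z : R[i]) (c s h : R).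

Lemma halfplane_le c s z : c ^+ 2 + s ^+ 2 = 1 -> c * Re z + s * Im z <= rnorm z.
Proof.
move=> cs; apply: (le_trans (ler_norm _)).
rewrite rnormE -sqrtr_sqr ler_wsqrtr//.
rewrite -[leRHS]mul1r -cs; set x := Re z; set y := Im z.
have : 0 <= (c * y - s * x) ^+ 2 by rewrite sqr_ge0.
lra.
Qed.

Lemma convex_sub_stolz (b : R) (A : set R[i]^o) : @convex_set R[i] R[i]^o A ->
  A 1 -> (forall z, rnorm z < sin b -> A z) -> stolz b `<=` A.
Proof.
move=> cA A1 Ad; apply: subset_trans (@interior_subset _ _) _.
by apply: smallest_sub => // z [->//|/Ad].
Qed.

Lemma sublevel_convex (f : R[i] -> R) (h : R) :
  (forall z w (t : R), 0 <= t <= 1 -> f (t%:C * z + (1 - t)%:C * w) <= t * f z + (1 - t) * f w) ->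
  @convex_set R[i] R[i]^o [set z | f z <= h].
Proof.
move=> cf x y l; rewrite !inE /= => hx hy.
(* The weight l lies between 0 and 1 for the order of R[i], so it is real. *)
have l0 : (0 : R[i]) <= l%:num by [].
have l1 : l%:num <= (1 : R[i]) by [].
have -> : (conv l x y : R[i]) = (Re l%:num)%:C * x + (1 - Re l%:num)%:C * y.
  move: l0; rewrite lecE /= => /andP[/eqP i0 _].
  have -> : (Re l%:num)%:C = l%:num by case: (l%:num) i0 => a ? /= ->.
  have -> : (1 - Re l%:num)%:C = 1 - l%:num.
    by rewrite rmorphB/=; congr (_ - _); case: (l%:num) i0 => a ? /= ->.
  by [].
have t01 : 0 <= Re l%:num <= 1.
  by move: l0 l1; rewrite !lecE /= => /andP[_ ->] /andP[_ ->].
have /andP[t0 t1] := t01.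
apply: le_trans (cf _ _ _ t01) _.
have t1' : 0 <= 1 - Re l%:num by rewrite subr_ge0.
have := ler_wpM2l t0 hx; have := ler_wpM2l t1' hy; lra.
Qed.

(** In the direction (c, s) the support function of the domain is the larger of c, the contribution
    of the vertex 1, and sin b, that of the disc. *)
Lemma closure_stolz_halfplane (b : R) c s h z : c ^+ 2 + s ^+ 2 = 1 ->
  c <= h -> sin b <= h -> closure (stolz b) z -> c * Re z + s * Im z <= h.
Proof.
move=> cs ch bh clz; apply/ler_addgt0Pr => e e0.
have [w [sw zw]] : stolz b `&` ball (z : R[i]^o) e%:C !=set0.
  by apply: clz; apply: nbhsx_ballx; rewrite ltcR.
have hw : c * Re w + s * Im w <= h.
  apply: (@convex_sub_stolz b [set z | c * Re z + s * Im z <= h]) sw => /=.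
  - apply: sublevel_convex => -[a1 a2] [b1 b2] t _ /=; lra.
  - by rewrite mulr1 mulr0 addr0.
  - by move=> y /ltW yb; rewrite (le_trans (halfplane_le y cs))// (le_trans yb).
move: zw; rewrite -ball_normE /= normE ltcR => /ltW zw.
have := le_trans (halfplane_le (z - w) cs) zw.
case: z w {clz sw zw} hw => z1 z2 [w1 w2] /=; lra.
Qed.

End HalfPlanes.

(** * Logarithms along a curve *)

Section LogPrimitive.
Context (R : realType).
Implicit Types (g lg : R -> R[i]) (a b c t : R).

(* [lg] is a primitive of [dg / g] on [[a, b]], with a quadratic remainder. *)
Definition log_primitive g lg a b : Prop :=
  exists2 c, 0 <= c & forall t t', a <= t -> t <= t' -> t' <= b ->
    rnorm (lg t' - lg t - (g t' - g t) / g t) <= c * (t' - t) ^+ 2.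

Lemma log_primitive_ext g lg g' lg' a b :
  (forall t, a <= t <= b -> g t = g' t) -> (forall t, a <= t <= b -> lg t = lg' t) ->
  log_primitive g lg a b -> log_primitive g' lg' a b.
Proof.
move=> eg el [c c0 h]; exists c => // t t' at_ tt' tb.
have h1 : a <= t <= b by rewrite at_ (le_trans tt').
have h2 : a <= t' <= b by rewrite tb (le_trans at_).
by rewrite -!eg -?el//; exact: h.
Qed.

Lemma divr_dist_le (z w w' : R[i]) (r : R) : 0 < r -> r <= rnorm w -> r <= rnorm w' ->
  rnorm (z / w - z / w') <= rnorm z * rnorm (w' - w) / r ^+ 2.
Proof.
move=> r0 rw rw'.
have w0 : w != 0 by apply/eqP => w0; move: rw; rewrite w0 rnorm0 leNgt r0.
have w'0 : w' != 0 by apply/eqP => w0'; move: rw'; rewrite w0' rnorm0 leNgt r0.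
have -> : z / w - z / w' = z * (w' - w) * (w * w')^-1 by field; rewrite w0 w'0.
rewrite !rnormM rnormV rnormM ler_wpM2l ?mulr_ge0 ?rnorm_ge0//.
rewrite lef_pV2 ?posrE ?exprn_gt0//; last by rewrite mulr_gt0// (lt_le_trans r0).
by rewrite expr2 ler_pM// ltW.
Qed.

(** If m lies inside [t, t'], changing the denominator g m into g t costs a product of two
    increments of g, which r and K make quadratic. *)
Lemma log_primitive_glue g lg a m b (r K : R) : a <= m -> m <= b -> 0 < r -> 0 <= K ->
  (forall t, a <= t <= b -> r <= rnorm (g t)) ->
  (forall t t', a <= t -> t <= t' -> t' <= b -> rnorm (g t' - g t) <= K * (t' - t)) ->
  log_primitive g lg a m -> log_primitive g lg m b -> log_primitive g lg a b.
Proof.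
move=> am mb r0 K0 gr gK [c c0 hc] [d d0 hd].
have rr : 0 <= K * K / r ^+ 2 by apply: divr_ge0; [exact: mulr_ge0|exact: sqr_ge0].
exists (c + d + K * K / r ^+ 2) => [|t t' at_ tt' tb]; first by rewrite !addr_ge0.
have s0 := sqr_ge0 (t' - t).
have [t'm|mt'] := leP t' m.
  rewrite (le_trans (hc _ _ at_ tt' t'm))// ler_wpM2r//.
  by rewrite -addrA lerDl addr_ge0.
have [mt|tm] := leP m t.
  rewrite (le_trans (hd _ _ mt tt' tb))// ler_wpM2r//.
  by rewrite addrAC lerDr addr_ge0.
have -> : lg t' - lg t - (g t' - g t) / g t =
   (lg m - lg t - (g m - g t) / g t) + (lg t' - lg m - (g t' - g m) / g m) +
   ((g t' - g m) / g m - (g t' - g m) / g t) by ring.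
rewrite (le_trans (ler_rnormD _ _))// [leRHS]mulrDl lerD//.
  rewrite (le_trans (ler_rnormD _ _))// [leRHS]mulrDl lerD//.
    rewrite (le_trans (hc _ _ at_ (ltW tm) (lexx _)))// ler_wpM2l//.
    by rewrite ler_pXn2r ?nnegrE ?subr_ge0 ?(ltW tm)// ?lerD2r ltW.
  rewrite (le_trans (hd _ _ (lexx _) (ltW mt') tb))// ler_wpM2l//.
  by rewrite ler_pXn2r ?nnegrE ?subr_ge0 ?(ltW mt')// lerD2l lerN2 ltW.
have h1 : r <= rnorm (g m) by apply: gr; rewrite am.
have h2 : r <= rnorm (g t) by apply: gr; rewrite at_ (le_trans tt').
apply: le_trans (divr_dist_le _ r0 h1 h2) _.
rewrite [leRHS]mulrAC ler_wpM2r ?invr_ge0 ?sqr_ge0//.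
have h3 := gK _ _ am (ltW mt') tb; have h4 := gK _ _ at_ (ltW tm) mb.
rewrite rnormB in h4.
apply: le_trans (ler_pM (rnorm_ge0 _) (rnorm_ge0 _) h3 h4) _.
rewrite mulrACA expr2; apply: ler_wpM2l; first exact: mulr_ge0.
rewrite ler_pM ?subr_ge0 ?(ltW tm) ?(ltW mt')//.
  by rewrite lerD2l lerN2 ltW.
by rewrite lerD2r ltW.
Qed.

Lemma normIm_le (z : R[i]) : `|Im z| <= rnorm z.
Proof. by rewrite rnormE -sqrtr_sqr ler_wsqrtr// lerDr sqr_ge0. Qed.

(** The principal logarithm, meant for Re z > 0. *)
Definition plog (z : R[i]) : R[i] :=
  (ln (Re z ^+ 2 + Im z ^+ 2) / 2) +i* atan (Im z / Re z).

Lemma is_derive_ln_affine (x0 y0 wx wy t : R) : 0 < x0 + t * wx ->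
  is_derive t 1 (fun t : R => ln ((x0 + t * wx) ^+ 2 + (y0 + t * wy) ^+ 2) / 2)
    (Re ((wx +i* wy) / ((x0 + t * wx) +i* (y0 + t * wy)))).
Proof.
move=> h; have n0 : 0 < (x0 + t * wx) ^+ 2 + (y0 + t * wy) ^+ 2.
  by rewrite ltr_pwDl// ?exprn_gt0// sqr_ge0.
have h1 := is_derive1_ln n0.
have h2 : is_derive t 1 (fun t : R => (x0 + t * wx) ^+ 2 + (y0 + t * wy) ^+ 2)
    (((x0 + t * wx) * wx + (y0 + t * wy) * wy) * 2).
  by apply: is_derive_eq; rewrite /GRing.scale /=; ring.
have h3 := @is_derive1_comp R (@ln R) (fun t : R => (x0 + t * wx) ^+ 2 + (y0 + t * wy) ^+ 2) t _ _ h1 h2.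
have h4 := is_deriveM h3 (@is_derive_cst R R^o R^o (2^-1 : R) t 1).
apply: (@is_derive_eq R R^o R^o (fun t : R => ln ((x0 + t * wx) ^+ 2 + (y0 + t * wy) ^+ 2) / 2) t 1 _ _ h4).
by rewrite /GRing.scale /=; field; rewrite gt_eqF.
Qed.

Lemma is_derive_atan_affine (x0 y0 wx wy t : R) : 0 < x0 + t * wx ->
  is_derive t 1 (fun t : R => atan ((y0 + t * wy) / (x0 + t * wx)))
    (Im ((wx +i* wy) / ((x0 + t * wx) +i* (y0 + t * wy)))).
Proof.
move=> h; have h0 : x0 + t * wx != 0 by rewrite gt_eqF.
have n0 : 0 < (x0 + t * wx) ^+ 2 + (y0 + t * wy) ^+ 2.
  by rewrite ltr_pwDl// ?exprn_gt0// sqr_ge0.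
have h2 : is_derive t 1 (fun t : R => (y0 + t * wy) / (x0 + t * wx))
    ((wy * (x0 + t * wx) - wx * (y0 + t * wy)) / (x0 + t * wx) ^+ 2).
  have hv : is_derive t 1 (fun t : R => (x0 + t * wx)^-1) (- (x0 + t * wx) ^- 2 *: wx).
    apply: is_deriveV => //.
    by apply: is_derive_eq; rewrite /GRing.scale /=; ring.
  have hu : is_derive t 1 (fun t : R => y0 + t * wy) wy.
    by apply: is_derive_eq; rewrite /GRing.scale /=; ring.
  apply: (@is_derive_eq R R^o R^o (fun t : R => (y0 + t * wy) / (x0 + t * wx)) t 1 _ _ (is_deriveM hu hv)).
  by rewrite /GRing.scale /=; field.
have h3 := @is_derive1_comp R (@atan R) (fun t : R => (y0 + t * wy) / (x0 + t * wx)) t _ _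
  (is_derive1_atan ((y0 + t * wy) / (x0 + t * wx))) h2.
apply: (@is_derive_eq R R^o R^o (fun t : R => atan ((y0 + t * wy) / (x0 + t * wx))) t 1 _ _ h3).
rewrite /=; field; rewrite !gt_eqF//.
Qed.

Lemma plog_affine (z0 w : R[i]) a b (r : R) : 0 < r ->
  (forall t, a <= t <= b -> 0 < Re (z0 + t%:C * w)) ->
  (forall t, a <= t <= b -> r <= rnorm (z0 + t%:C * w)) ->
  log_primitive (fun t => z0 + t%:C * w) (fun t => plog (z0 + t%:C * w)) a b.
Proof.
case: z0 w => x0 y0 [wx wy] r0 hpos hr.
have gE t : (x0 +i* y0) + t%:C * (wx +i* wy) = (x0 + t * wx) +i* (y0 + t * wy).
  by apply/eqP; rewrite eq_complex /= !mul0r addr0 subr0 !eqxx.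
set g := fun t : R => _ + _.
have hpos' t : a <= t <= b -> 0 < x0 + t * wx by move=> /hpos; rewrite gE.
pose w := wx +i* wy.
exists (rnorm w * rnorm w / r ^+ 2 *+ 2) => [|t t' at_ tt' tb].
  by apply/mulrn_wge0/divr_ge0; [apply: mulr_ge0; exact: rnorm_ge0|exact: sqr_ge0].
have tab : a <= t <= b by rewrite at_ (le_trans tt').
have sub x : t <= x <= t' -> a <= x <= b.
  by move=> /andP[h1 h2]; rewrite (le_trans at_ h1) (le_trans h2 tb).
(* The mean value theorem is real: the real and imaginary parts get different intermediate points c1
   and c2. *)
have [c1 hc1 e1] := mean_value tt' (fun x h => @is_derive_ln_affine x0 y0 wx wy x (hpos' _ (sub _ h))).
have [c2 hc2 e2] := mean_value tt' (fun x h => @is_derive_atan_affine x0 y0 wx wy x (hpos' _ (sub _ h))).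
have gd : g t' - g t = (t' - t)%:C * w.
  by rewrite /g opprD addrACA subrr add0r -mulrBl rmorphB.
have key c : t <= c <= t' -> rnorm (w / g c - w / g t) <= rnorm w * rnorm w / r ^+ 2 * (t' - t).
  move=> hc; apply: le_trans (divr_dist_le _ r0 (hr _ (sub _ hc)) (hr _ tab)) _.
  rewrite [leRHS]mulrAC ler_wpM2r ?invr_ge0 ?exprn_ge0 ?(ltW r0)//.
  rewrite -mulrA ler_wpM2l ?rnorm_ge0//.
  have -> : g t - g c = (t - c)%:C * w.
    by rewrite /g opprD addrACA subrr add0r -mulrBl rmorphB.
  rewrite rnormRM mulrC ler_wpM2l ?rnorm_ge0//.
  by move/andP: hc => [h1 h2]; rewrite ler0_norm ?subr_le0// opprB lerD2r.
rewrite gd -mulrA.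
have -> : plog (g t') - plog (g t) - (t' - t)%:C * (w / g t) =
  ((t' - t) * Re (w / g c1 - w / g t)) +i* ((t' - t) * Im (w / g c2 - w / g t)).
  have -> : (t' - t)%:C * (w / g t) = ((t' - t) * Re (w / g t)) +i* ((t' - t) * Im (w / g t)).
    by case: (w / g t) => a1 a2; apply/eqP; rewrite eq_complex /= !mul0r subr0 addr0 !eqxx.
  rewrite /plog; move: e1 e2; rewrite -!gE -!/(g _) -!/w.
  have eRe x : Re (g x) = x0 + x * wx by rewrite /g gE.
  have eIm x : Im (g x) = y0 + x * wy by rewrite /g gE.
  rewrite !eRe !eIm; move: (w / g c1) (w / g c2) (w / g t) => [a1 a2] [b1 b2] [d1 d2] e1 e2.
  apply/eqP; rewrite eq_complex /=; move: e1 e2 => /= -> ->.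
  by apply/andP; split; apply/eqP; ring.
have := le_trans (normIm_le _) (key _ hc2); have := le_trans (normRe_le _) (key _ hc1).
move: (w / g c1 - w / g t) (w / g c2 - w / g t) => z1 z2 k1 k2.
have tt0 : 0 <= t' - t by rewrite subr_ge0.
apply: le_trans (rnorm_le_ReIm _) _; rewrite /= !normrM !(ger0_norm tt0).
have -> : rnorm w * rnorm w / r ^+ 2 *+ 2 * (t' - t) ^+ 2 =
  (t' - t) * (rnorm w * rnorm w / r ^+ 2 * (t' - t)) +
  (t' - t) * (rnorm w * rnorm w / r ^+ 2 * (t' - t)) by ring.
by apply: lerD; apply: ler_wpM2l.
Qed.

End LogPrimitive.

(** * The contour: two tangent segments and an arc *)

Section StolzPath.
Context (R : realType) (b : R) (hb : 0 < b < pi / 2).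
Let r := sin b.
Let q := cos b.
Let th := pi / 2 - b.
Let psi (t : R) := th + (t - 1) * (pi *+ 2 - th *+ 2).
Let g := stolz_path b.

Let r_gt0 : 0 < r. Proof. exact: sin_gt0_pihalf. Qed.

Let q_gt0 : 0 < q.
Proof.
apply: cos_gt0_pihalf; move/andP: hb => [b0 ->]; rewrite andbT.
by rewrite (lt_trans _ b0)// oppr_lt0 (lt_trans b0)//; case/andP: hb.
Qed.

Let q2 : q ^+ 2 = 1 - r ^+ 2. Proof. exact: cos2sin2. Qed.
Let cos_th : cos th = r. Proof. by rewrite /th -cosN opprB cosBpihalf. Qed.
Let sin_th : sin th = q.
Proof. by rewrite /th -[_ - _]opprB sinN sinBpihalf opprK. Qed.

Let r_le1 : r <= 1. Proof. exact: sin_le1. Qed.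
Let q_le1 : q <= 1. Proof. exact: cos_le1. Qed.

(** The tangent point is r (r + i q) = (1 - q^2) + i q r. *)
Let g1E (t : R) : t <= 1 -> g t = (1 - t * q ^+ 2) +i* (t * (q * r)).
Proof.
move=> t1; rewrite /g /stolz_path t1 -/r -/th cos_th sin_th q2.
by apply/eqP; rewrite eq_complex /=; apply/andP; split; apply/eqP; ring.
Qed.

Let psi1 : psi 1 = th. Proof. by rewrite /psi subrr mul0r addr0. Qed.
Let psi2 : psi 2 = pi *+ 2 - th.
Proof. rewrite /psi; ring. Qed.

Let g2E (t : R) : 1 <= t <= 2 -> g t = (r * cos (psi t)) +i* (r * sin (psi t)).
Proof.
move=> /andP[]; rewrite le_eqVlt => /predU1P[<- _|t1 t2].
  rewrite g1E// psi1 cos_th sin_th q2.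
  by apply/eqP; rewrite eq_complex /=; apply/andP; split; apply/eqP; ring.
rewrite /g /stolz_path leNgt t1/= t2 -/r -/th -/(psi t).
by apply/eqP; rewrite eq_complex /= !mul0r subr0 addr0 !eqxx.
Qed.

Let g3E (t : R) : 2 <= t -> g t = (1 - (3 - t) * q ^+ 2) +i* (- ((3 - t) * (q * r))).
Proof.
rewrite le_eqVlt => /predU1P[<-|t2].
  rewrite g2E ?lexx ?ler1n// psi2 (cosB (pi *+ 2) th) (sinB (pi *+ 2) th) cos2pi sin2pi cos_th sin_th q2.
  by apply/eqP; rewrite eq_complex /=; apply/andP; split; apply/eqP; ring.
have t1 : 1 < t by rewrite (lt_trans _ t2)// ltr1n.
rewrite /g /stolz_path leNgt t1 /= leNgt t2 /= -/r -/th cosN sinN cos_th sin_th q2.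
by apply/eqP; rewrite eq_complex /=; apply/andP; split; apply/eqP; ring.
Qed.

Let cases (t : R) : 0 <= t <= 3 -> [\/ 0 <= t <= 1, 1 <= t <= 2 | 2 <= t <= 3].
Proof.
move=> /andP[t0 t3]; have [t1|t1] := leP t 1; first by constructor 1; rewrite t0.
have [t2|t2] := leP t 2; first by constructor 2; rewrite ltW.
by constructor 3; rewrite ltW.
Qed.

Lemma stolz_path0 : stolz_path b 0 = 1.
Proof. by rewrite -/g g1E// !mul0r subr0. Qed.

Lemma stolz_path3 : stolz_path b 3 = 1.
Proof. by rewrite -/g g3E ?ler_nat// subrr !mul0r subr0 oppr0. Qed.

(** The segments lie on the lines r x + q y = r and r x - q y = r, at distance r from 0, and the arc
    on the circle of radius r. *)
Lemma stolz_path_ge (t : R) : 0 <= t <= 3 -> sin b <= rnorm (stolz_path b t).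
Proof.
rewrite -/g -/r => ht.
have cs : r ^+ 2 + q ^+ 2 = 1 by rewrite q2 addrC subrK.
case: (cases ht) => /andP[h0 h1].
- have := halfplane_le (g t) cs; rewrite g1E//=; apply: le_trans.
  by rewrite le_eqVlt; apply/orP; left; apply/eqP; ring.
- rewrite g2E ?h0//.
  have := @halfplane_le R (cos (psi t)) (sin (psi t)) ((r * cos (psi t)) +i* (r * sin (psi t))).
  rewrite cos2Dsin2 => /(_ erefl); apply: le_trans => /=.
  rewrite -[leLHS]mulr1 -(cos2Dsin2 (psi t)).
  by rewrite le_eqVlt; apply/orP; left; apply/eqP; ring.
- have cs' : r ^+ 2 + (- q) ^+ 2 = 1 by rewrite sqrrN.
  have := halfplane_le (g t) cs'; rewrite g3E//=; apply: le_trans.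
  by rewrite le_eqVlt; apply/orP; left; apply/eqP; ring.
Qed.

Lemma stolz_path_le2 (t : R) : 0 <= t <= 3 -> rnorm (stolz_path b t) <= 2.
Proof.
rewrite -/g => ht; apply: le_trans (rnorm_le_ReIm _) _.
have H (s : R) : 0 <= s <= 1 -> `|1 - s * q ^+ 2| + `|s * (q * r)| <= 2.
  move=> /andP[s0 s1]; have q21 : q ^+ 2 <= 1 by rewrite expr_le1// ltW.
  have a : 0 <= s * q ^+ 2 <= 1 by rewrite mulr_ge0 ?sqr_ge0//= mulr_ile1 ?sqr_ge0.
  have qr : q * r <= 1 by rewrite mulr_ile1 ?(ltW q_gt0) ?(ltW r_gt0).
  have c : 0 <= s * (q * r) <= 1.
    by rewrite !mulr_ge0 ?(ltW q_gt0) ?(ltW r_gt0)//= mulr_ile1 ?mulr_ge0 ?(ltW q_gt0) ?(ltW r_gt0).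
  move: a c => /andP[a1 a2] /andP[c1 c2].
  rewrite !ger0_norm ?subr_ge0//; lra.
case: (cases ht) => /andP[h0 h1].
- by rewrite g1E//= H// h0.
- rewrite g2E ?h0//= !normrM.
  have hr : `|r| <= 1 by rewrite ger0_norm ?(ltW r_gt0).
  rewrite [leRHS](_ : 2 = 1 + 1 :> R)// lerD// mulr_ile1//.
    exact: cos_max.
  exact: sin_max.
- by rewrite g3E//= normrN H//; apply/andP; split; lra.
Qed.

Lemma stolz_path_lip : exists2 K : R, 0 <= K & forall t t' : R, 0 <= t -> t <= t' -> t' <= 3 ->
  rnorm (stolz_path b t' - stolz_path b t) <= K * (t' - t).
Proof.
rewrite -/g; pose w := `|pi *+ 2 - th *+ 2| : R.
have w0 : 0 <= w by rewrite /w normr_ge0.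
exists (2 + 2 * w) => [|t t' t0 tt' t3]; first by rewrite addr_ge0 ?mulr_ge0.
have qr : q * r <= 1 by rewrite mulr_ile1 ?(ltW q_gt0) ?(ltW r_gt0).
have qr0 : 0 <= q * r by rewrite mulr_ge0 ?(ltW q_gt0) ?(ltW r_gt0).
have q21 : q ^+ 2 <= 1 by rewrite expr_le1// ltW.
have q20 := sqr_ge0 q.
have P1 (s s' : R) : 0 <= s -> s <= s' -> s' <= 1 -> rnorm (g s' - g s) <= (2 + 2 * w) * (s' - s).
  move=> s0 ss' s1; rewrite !g1E// ?(le_trans ss')//.
  apply: le_trans (rnorm_le_ReIm _) _ => /=.
  have -> : 1 - s' * q ^+ 2 - (1 - s * q ^+ 2) = - ((s' - s) * q ^+ 2) by ring.
  rewrite -mulrBl normrN !(normrM (s' - s)) (ger0_norm q20) (ger0_norm qr0) ger0_norm ?subr_ge0//.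
  rewrite -mulrDr mulrC ler_wpM2r ?subr_ge0//; lra.
have P2 (s s' : R) : 1 <= s -> s <= s' -> s' <= 2 -> rnorm (g s' - g s) <= (2 + 2 * w) * (s' - s).
  move=> s0 ss' s1; rewrite !g2E ?s0 ?(le_trans s0)// ?(le_trans ss')//.
  apply: le_trans (rnorm_le_ReIm _) _ => /=.
  rewrite -!mulrBr !normrM (ger0_norm (ltW r_gt0)).
  have hp : `|psi s' - psi s| = w * (s' - s).
    have -> : psi s' - psi s = (pi *+ 2 - th *+ 2) * (s' - s) by rewrite /psi; ring.
    by rewrite normrM [X in _ * X]ger0_norm ?subr_ge0.
  have hc := cos_lip (psi s') (psi s); have hs := sin_lip (psi s') (psi s).
  rewrite hp in hc hs.
  have e0 : 0 <= s' - s by rewrite subr_ge0.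
  have k1 : r * `|cos (psi s') - cos (psi s)| <= w * (s' - s).
    by rewrite (le_trans _ hc)// ler_piMl.
  have k2 : r * `|sin (psi s') - sin (psi s)| <= w * (s' - s).
    by rewrite (le_trans _ hs)// ler_piMl.
  by apply: le_trans (lerD k1 k2) _; rewrite mulrDl; lra.
have P3 (s s' : R) : 2 <= s -> s <= s' -> s' <= 3 -> rnorm (g s' - g s) <= (2 + 2 * w) * (s' - s).
  move=> s0 ss' s1; rewrite !g3E// ?(le_trans s0)//.
  apply: le_trans (rnorm_le_ReIm _) _ => /=.
  have -> : 1 - (3 - s') * q ^+ 2 - (1 - (3 - s) * q ^+ 2) = (s' - s) * q ^+ 2 by ring.
  have -> : - ((3 - s') * (q * r)) - - ((3 - s) * (q * r)) = (s' - s) * (q * r) by ring.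
  rewrite !(normrM (s' - s)) (ger0_norm q20) (ger0_norm qr0) ger0_norm ?subr_ge0//.
  rewrite -mulrDr mulrC ler_wpM2r ?subr_ge0//; lra.
have glue (m a c : R) : (forall s s', a <= s -> s <= s' -> s' <= m -> rnorm (g s' - g s) <= (2 + 2 * w) * (s' - s)) ->
  (forall s s', m <= s -> s <= s' -> s' <= c -> rnorm (g s' - g s) <= (2 + 2 * w) * (s' - s)) ->
  (forall s s', a <= s -> s <= s' -> s' <= c -> rnorm (g s' - g s) <= (2 + 2 * w) * (s' - s)).
  move=> h1 h2 s s' as_ ss' sc; have [s'm|ms'] := leP s' m; first exact: h1.
  have [ms|sm] := leP m s; first exact: h2.
  apply: le_trans (ler_rdist (g m) _ _) _.
  apply: le_trans (lerD (h2 _ _ (lexx _) (ltW ms') sc) (h1 _ _ as_ (ltW sm) (lexx _))) _.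
  by rewrite -mulrDr addrA subrK.
exact: (glue 2 0 3 (glue 1 0 2 P1 P2) P3).
Qed.

(** The points g u and g v are joined through the base point 1, which is both g 0 and g 3. *)
Lemma stolz_path_closed (K : R) : (forall t t' : R, 0 <= t -> t <= t' -> t' <= 3 ->
  rnorm (stolz_path b t' - stolz_path b t) <= K * (t' - t)) ->
  forall u v : R, 0 <= u <= 3 -> 0 <= v <= 3 ->
  rnorm (stolz_path b v - stolz_path b u) <= K * (u + (3 - v)).
Proof.
move=> hK u v /andP[u0 u3] /andP[v0 v3].
have h1 := hK _ _ (lexx _) u0 u3; have h2 := hK _ _ v0 v3 (lexx _).
rewrite stolz_path0 subr0 rnormB in h1; rewrite stolz_path3 rnormB in h2.
by rewrite (le_trans (ler_rdist 1 _ _))// mulrDr addrC lerD.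
Qed.

(** A half-plane at a level h >= sin b' > 0 separates g t from the smaller domain, and division by u
    <= 1 moves the point further away. On the segments the half-plane is bounded by a tangent of the
    smaller domain; on the arc its direction is radial. *)
Lemma stolz_path_notin (b' t u : R) : 0 < b' < b -> 0 < t < 3 -> 0 < u <= 1 ->
  ~ closure (stolz b') (stolz_path b t / u%:C).
Proof.
move=> /andP[b'0 b'b] /andP[t0 t3] /andP[u0 u1] cl; rewrite -/g in cl.
have b'p : 0 < b' < pi / 2 by rewrite b'0 (lt_trans b'b)//; case/andP: hb.
have r'0 : 0 < sin b' by exact: sin_gt0_pihalf.
have sep (c s h : R) : c ^+ 2 + s ^+ 2 = 1 -> c <= h -> sin b' <= h ->
   c * Re (g t) + s * Im (g t) <= h.
  move=> cs ch bh; have := closure_stolz_halfplane cs ch bh cl.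
  have -> : Re (g t / u%:C) = Re (g t) / u.
    rewrite -fmorphV; case: (g t) => x y /=; ring.
  have -> : Im (g t / u%:C) = Im (g t) / u.
    rewrite -fmorphV; case: (g t) => x y /=; ring.
  rewrite !mulrA -mulrDl ler_pdivrMr// => /le_trans; apply.
  by rewrite ler_piMr// (le_trans _ bh)// ltW.
have sbb : 0 < r * cos b' - q * sin b'.
  rewrite -sinB; apply: sin_gt0_pihalf; rewrite subr_gt0 b'b/=.
  by rewrite ltrBlDr ltr_wpDr ?(ltW b'0)//; case/andP: hb.
have cs' : sin b' ^+ 2 + cos b' ^+ 2 = 1 by rewrite addrC cos2Dsin2.
have cs'' : sin b' ^+ 2 + (- cos b') ^+ 2 = 1 by rewrite sqrrN.
have [t1|t1] := leP t 1.
  have := sep _ _ _ cs' (lexx _) (lexx _); rewrite g1E//= leNgt => /negP; apply.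
  have : 0 < t * (q * (r * cos b' - q * sin b')) by rewrite !mulr_gt0.
  lra.
have [t2|t2] := leP 2 t.
  have := sep _ _ _ cs'' (lexx _) (lexx _); rewrite g3E//= leNgt => /negP; apply.
  have : 0 < (3 - t) * (q * (r * cos b' - q * sin b')) by rewrite !mulr_gt0// subr_gt0.
  lra.
(* On the arc it remains to see that r exceeds sin b' and cos (psi t); the latter holds since psi t
   lies strictly between th and 2 pi - th, and cos th = r. *)
have := sep (cos (psi t)) (sin (psi t)) (Num.max (cos (psi t)) (sin b')) (cos2Dsin2 _).
have m1 : cos (psi t) <= Num.max (cos (psi t)) (sin b') by rewrite le_max lexx.
have m2 : sin b' <= Num.max (cos (psi t)) (sin b') by rewrite le_max lexx orbT.
move=> /(_ m1 m2).
rewrite g2E ?(ltW t1) ?(ltW t2)//=.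
have -> : cos (psi t) * (r * cos (psi t)) + sin (psi t) * (r * sin (psi t)) = r.
  rewrite -[RHS]mulr1 -(cos2Dsin2 (psi t)); ring.
apply/negP; rewrite -ltNge gt_max; apply/andP; split; last first.
  rewrite /r ltr_sin// in_itv/=; apply/andP; split;
  by move: hb b'0 b'b => /andP[]; lra.
have th0 : 0 < th < pi / 2 by move: hb => /andP[]; rewrite /th; lra.
have thp : 0 < pi *+ 2 - th *+ 2 by move: th0 (pi_gt0 R) => /andP[]; lra.
have p1 : th < psi t by rewrite /psi ltrDl mulr_gt0// subr_gt0.
have p2 : psi t < pi *+ 2 - th.
  have -> : pi *+ 2 - th = th + 1 * (pi *+ 2 - th *+ 2) by ring.
  rewrite /psi ltrD2l ltr_pM2r//; lra.
have thpi : th \in `[0, pi] by rewrite in_itv/=; move: th0 (pi_gt0 R) => /andP[]; lra.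
rewrite -cos_th; have [pp|pp] := leP (psi t) pi.
  by rewrite ltr_cos// in_itv/= pp andbT (le_trans _ (ltW p1))//; case/andP: th0 => /ltW.
have -> : cos (psi t) = cos (pi *+ 2 - psi t).
  by rewrite cosB cos2pi sin2pi mul1r mul0r addr0.
rewrite ltr_cos//; first by move: p2; lra.
by rewrite in_itv/=; move: p2 th0 => + /andP[]; lra.
Qed.

(* A continuous logarithm along the contour: its increment from 0 to 3 is 2 pi i. *)
Definition path_log (t : R) : R[i] :=
  if t <= 1 then plog (g t) else
  if t <= 2 then ln r +i* psi t else plog (g t) + (0 +i* (pi *+ 2)).

Let plog1 : plog (1 : R[i]) = 0.
Proof. by rewrite /plog /= expr1n expr0n addr0 ln1 mul0r mul0r atan0. Qed.

(** For s = 1 and s = -1 these are the two tangent points; the three pieces of [path_log] agree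
    there. *)
Let plog_tangent (s : R) : `|s| = 1 -> plog ((1 - q ^+ 2) +i* (s * (q * r))) = ln r +i* (s * th).
Proof.
move=> s1; have r0 : r != 0 by rewrite gt_eqF.
have s2 : s ^+ 2 = 1 by rewrite -real_normK ?num_real// s1 expr1n.
have -> : 1 - q ^+ 2 = r ^+ 2 by rewrite q2; ring.
rewrite /plog /=; congr (_ +i* _).
  have -> : (r ^+ 2) ^+ 2 + (s * (q * r)) ^+ 2 = r ^+ 2.
    rewrite !exprMn s2 q2; ring.
  by rewrite lnXn//; field.
have -> : s * (q * r) / r ^+ 2 = s * tan th.
  by rewrite /tan cos_th sin_th; field.
have h : atan (tan th) = th.
  apply: tanK; rewrite in_itv/= /th; move: hb => /andP[]; lra.
have [s0|s0] := leP 0 s.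
  by rewrite -[s]ger0_norm// s1 !mul1r.
have -> : s = -1 by rewrite -s1 ltr0_norm// opprK.
by rewrite !mulN1r atanN h.
Qed.

Let hRe (t : R) : t <= 1 -> 0 < 1 - t * q ^+ 2.
Proof.
move=> t1; have q21 : q ^+ 2 < 1 by rewrite q2 ltrBlDr ltrDl exprn_gt0.
have q20 := sqr_ge0 q.
have : t * q ^+ 2 <= 1 * q ^+ 2 by rewrite ler_wpM2r.
lra.
Qed.

Let gEc : g = stolz_path b. Proof. by []. Qed.

Let logP1 : log_primitive g path_log 0 1.
Proof.
pose w : R[i] := (- q ^+ 2) +i* (q * r).
have e t : 0 <= t <= 1 -> 1 + t%:C * w = g t.
  move=> /andP[t0 t1]; rewrite g1E//.
  by apply/eqP; rewrite eq_complex /=; apply/andP; split; apply/eqP; ring.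
apply: log_primitive_ext (@plog_affine R 1 w 0 1 r r_gt0 _ _) => // t t01.
- by rewrite e// /path_log; case/andP: t01 => _ ->.
- by rewrite e// g1E/= ?hRe//; case/andP: t01.
- rewrite e//; apply: stolz_path_ge; move: t01 => /andP[]; lra.
Qed.

Let logP2 : log_primitive g path_log 1 2.
Proof.
pose w := (pi *+ 2 - th *+ 2) : R.
have el t : 1 <= t <= 2 -> ln r +i* psi t = path_log t.
  move=> /andP[]; rewrite le_eqVlt => /predU1P[<- _|t1 t2].
    rewrite /path_log lexx g1E// !mul1r -[q * r]mul1r plog_tangent ?normr1//.
    by rewrite psi1 mul1r.
  by rewrite /path_log leNgt t1 /= t2.
suff P : log_primitive g (fun t => ln r +i* psi t) 1 2 by exact: log_primitive_ext P.
exists (2 * w ^+ 2) => [|t t' t1 tt' t2]; first by rewrite mulr_ge0 ?sqr_ge0.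
have ht : 1 <= t <= 2 by rewrite t1 (le_trans tt').
have ht' : 1 <= t' <= 2 by rewrite t2 (le_trans t1).
pose d := psi t' - psi t.
have dE : d = w * (t' - t) by rewrite /d /psi /w; ring.
have gt0 : g t != 0.
  apply/eqP => g0; suff : r <= 0 by rewrite leNgt r_gt0.
  rewrite -[leRHS](@rnorm0 R R[i]) -g0; apply: stolz_path_ge; move: ht => /andP[]; lra.
(* On the arc, (g t' - g t) / g t is exp(i d) - 1, so the remainder has the parts 1 - cos d and d -
   sin d. *)
have -> : g t' = g t * (cos d +i* sin d).
  rewrite !g2E// -[psi t'](subrK (psi t)) -/d [d + _]addrC (cosD (psi t) d) (sinD (psi t) d).
  by apply/eqP; rewrite eq_complex /=; apply/andP; split; apply/eqP; ring.
rewrite -[X in _ * _ - X]mulr1 -mulrBr [_ / _]mulrAC mulfV// mul1r.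
apply: le_trans (rnorm_le_ReIm _) _ => /=.
have -> : ln r - ln r - (cos d - 1) = 1 - cos d by ring.
rewrite oppr0 addr0 -/d.
apply: le_trans (lerD (one_minus_cos_le d) (sin_minus_id_le d)) _.
rewrite dE exprMn; lra.
Qed.

Let logP3 : log_primitive g path_log 2 3.
Proof.
pose w : R[i] := (q ^+ 2) +i* (q * r).
pose z0 : R[i] := (1 - 3 * q ^+ 2) +i* (- (3 * (q * r))).
have e t : 2 <= t <= 3 -> z0 + t%:C * w = g t.
  move=> /andP[t0 t1]; rewrite g3E//.
  by apply/eqP; rewrite eq_complex /=; apply/andP; split; apply/eqP; ring.
have [|t t23|c c0 hc] := @plog_affine R z0 w 2 3 r r_gt0 _ _.
- move=> t t23; rewrite e// g3E/= ?hRe//; move: t23 => /andP[]; lra.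
- rewrite e//; apply: stolz_path_ge; move: t23 => /andP[]; lra.
exists c => // t t' t2 tt' t3.
have h1 : 2 <= t <= 3 by rewrite t2 (le_trans tt').
have h2 : 2 <= t' <= 3 by rewrite t3 (le_trans t2).
have E s : 2 <= s <= 3 -> path_log s = plog (g s) + (0 +i* (pi *+ 2)).
  move=> /andP[]; rewrite le_eqVlt => /predU1P[<- _|s2 _]; last first.
    by rewrite /path_log !leNgt s2 (lt_trans _ s2)// ltr1n.
  have -> : g 2 = (1 - q ^+ 2) +i* (-1 * (q * r)).
    by rewrite g3E//; apply/eqP; rewrite eq_complex /=; apply/andP; split; apply/eqP; ring.
  rewrite /path_log lexx [2 <= 1]leNgt ltr1n /= psi2 plog_tangent ?normrN1//.
  by apply/eqP; rewrite eq_complex /=; apply/andP; split; apply/eqP; ring.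
rewrite !E// opprD addrACA subrr addr0 -!e//.
exact: hc.
Qed.

(** Replacing the left end t by an arbitrary tag xi in the denominator costs another product of two
    increments of g. *)
Lemma path_log_primitive : exists2 c : R, 0 <= c & forall t xi t' : R,
  0 <= t -> t <= xi <= t' -> t' <= 3 ->
  rnorm (path_log t' - path_log t - (stolz_path b t' - stolz_path b t) / stolz_path b xi)
    <= c * (t' - t) ^+ 2.
Proof.
have [K K0 hK] := stolz_path_lip.
have P : log_primitive g path_log 0 3.
  apply: (@log_primitive_glue _ g path_log 0 2 3 r K) => //; [by move: K0; lra|exact: stolz_path_ge|].
  apply: (@log_primitive_glue _ g path_log 0 1 2 r K) => //.
  - by rewrite ler1n.
  - by move=> t /andP[t0 t2]; apply: stolz_path_ge; rewrite t0 (le_trans t2)// ler_nat.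
  - by move=> t t' t0 tt' t2; apply: hK => //; rewrite (le_trans t2)// ler_nat.
have [c c0 hc] := P; have rr : 0 <= K * K / r ^+ 2.
  by apply: divr_ge0; [exact: mulr_ge0|exact: sqr_ge0].
exists (c + K * K / r ^+ 2) => [|t xi t' t0 /andP[tx xt'] t3]; first exact: addr_ge0.
have tt' := le_trans tx xt'.
have -> : path_log t' - path_log t - (stolz_path b t' - stolz_path b t) / stolz_path b xi
  = (path_log t' - path_log t - (g t' - g t) / g t) + ((g t' - g t) / g t - (g t' - g t) / g xi).
  by rewrite addrA subrK.
apply: le_trans (ler_rnormD _ _) _; rewrite [leRHS]mulrDl lerD ?hc//.
have h1 : r <= rnorm (g t) by apply: stolz_path_ge; rewrite t0 (le_trans tt').
have h2 : r <= rnorm (g xi) by apply: stolz_path_ge; rewrite (le_trans t0 tx) (le_trans xt').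
apply: le_trans (divr_dist_le _ r_gt0 h1 h2) _.
rewrite [leRHS]mulrAC ler_wpM2r ?invr_ge0 ?sqr_ge0//.
have h3 := hK _ _ t0 tt' t3; have h4 := hK _ _ t0 tx (le_trans xt' t3).
apply: le_trans (ler_pM (rnorm_ge0 _) (rnorm_ge0 _) h3 h4) _.
rewrite mulrACA expr2; apply: ler_wpM2l; first exact: mulr_ge0.
by rewrite ler_wpM2l ?subr_ge0// lerD2r.
Qed.

(** The winding number of the contour around 0 is 1; the factor in [calculus] cancels this
    increment. *)
Lemma path_log_closed : exists2 K : R, 0 <= K & forall u v : R, 0 <= u <= 3 -> 0 <= v <= 3 ->
  rnorm (path_log v - path_log u - (0 +i* (pi *+ 2))) <= K * (u + (3 - v)).
Proof.
have [K K0 hK] := stolz_path_lip; have [c c0 hc] := path_log_primitive.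
have L0 : path_log 0 = 0 by rewrite /path_log ler01 gEc stolz_path0 plog1.
have L3 : path_log 3 = 0 +i* (pi *+ 2).
  by rewrite /path_log !leNgt ltr1n ltr_nat /= gEc stolz_path3 plog1 add0r.
have lip t t' : 0 <= t -> t <= t' -> t' <= 3 ->
    rnorm (path_log t' - path_log t) <= (3 * c + K / r) * (t' - t).
  move=> t0 tt' t3; rewrite -[X in rnorm X](subrK ((g t' - g t) / g t)).
  have tt : t <= t <= t' by rewrite lexx.
  have tp : 0 <= t' - t by rewrite subr_ge0.
  apply: le_trans (ler_rnormD _ _) _; rewrite [leRHS]mulrDl lerD//.
    apply: le_trans (hc _ _ _ t0 tt t3) _; rewrite expr2 mulrA ler_wpM2r// mulrC ler_wpM2r//.
    by rewrite lerBlDr (le_trans t3)// lerDl.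
  have h1 : r <= rnorm (g t) by apply: stolz_path_ge; rewrite t0 (le_trans tt').
  rewrite rnormM rnormV mulrAC ler_pM ?rnorm_ge0 ?invr_ge0 ?rnorm_ge0//; first exact: hK.
  by rewrite lef_pV2 ?posrE// (lt_le_trans r_gt0).
exists (3 * c + K / r) => [|u v /andP[u0 u3] /andP[v0 v3]].
  by apply: addr_ge0; [exact: mulr_ge0|apply: divr_ge0 => //; exact: ltW].
have := lip _ _ (lexx _) u0 u3; have := lip _ _ v0 v3 (lexx _).
rewrite L0 L3 !subr0 rnormB => h2 h1.
by rewrite addrAC (le_trans (ler_rnormB _ _))// [leRHS]mulrDr [leRHS]addrC lerD.
Qed.

End StolzPath.

(** * The calculus on polynomials *)

Section OperatorPolynomials.
Context (K : comNzRingType) (X : lmodType K) (T : X -> X) (T_linear : linear T).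
Implicit Types (p q : {poly K}) (x : X).

Definition opoly p x : X := \sum_(i < size p) p`_i *: iter i T x.

Lemma opoly_wide p n x : (size p <= n)%N -> opoly p x = \sum_(i < n) p`_i *: iter i T x.
Proof.
move=> pn; rewrite /opoly (big_ord_widen n (fun i => p`_i *: iter i T x))//.
rewrite big_mkcond; apply: eq_bigr => i _; case: ltnP => // h.
by rewrite nth_default// scale0r.
Qed.

Lemma opolyD p q x : opoly (p + q) x = opoly p x + opoly q x.
Proof.
pose n := maxn (size p) (size q).
rewrite (@opoly_wide p n) ?leq_maxl// (@opoly_wide q n) ?leq_maxr//.
rewrite (@opoly_wide (p + q) n) ?(leq_trans (size_polyD _ _))// -big_split/=.
by apply: eq_bigr => i _; rewrite coefD scalerDl.
Qed.

Lemma opolyZ a p x : opoly (a *: p) x = a *: opoly p x.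
Proof.
rewrite (@opoly_wide _ (size p)) ?size_scale_leq// /opoly scaler_sumr.
by apply: eq_bigr => i _; rewrite coefZ scalerA.
Qed.

Lemma opolyN p x : opoly (- p) x = - opoly p x.
Proof. by rewrite -[- p]scaleN1r opolyZ scaleN1r. Qed.

Lemma opolyB p q x : opoly (p - q) x = opoly p x - opoly q x.
Proof. by rewrite opolyD opolyN. Qed.

Lemma opoly0 x : opoly 0 x = 0.
Proof. by rewrite /opoly size_poly0 big_ord0. Qed.

Lemma opolyC a x : opoly a%:P x = a *: x.
Proof. by rewrite (@opoly_wide _ 1) ?size_polyC ?leq_b1// big_ord1 coefC. Qed.

Lemma opoly1 x : opoly 1 x = x.
Proof. by rewrite opolyC scale1r. Qed.

Lemma opolyMX p x : opoly (p * 'X) x = T (opoly p x).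
Proof.
rewrite (@opoly_wide _ (size p).+1) ?(leq_trans (size_polyMleq _ _))//; last first.
  by rewrite size_polyX addn2.
rewrite big_ord_recl coefMX eqxx scale0r add0r /opoly (linear_fun_sum T_linear).
by apply: eq_bigr => i _; rewrite coefMX /= (linear_funZ T_linear).
Qed.

Lemma opolyX x : opoly 'X x = T x.
Proof. by rewrite -['X]mul1r opolyMX opoly1. Qed.

Lemma opolyXn n x : opoly ('X^n) x = iter n T x.
Proof. by elim: n => [|n IH]; rewrite ?expr0 ?opoly1// exprSr opolyMX IH. Qed.

Lemma opoly_linear p : linear (opoly p).
Proof.
move=> a x y.
have il n : linear (iter n T).
  by elim: n => [//|n IH] b u v /=; rewrite IH T_linear.
rewrite /opoly scaler_sumr -big_split/=; apply: eq_bigr => i _.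
by rewrite il scalerDr !scalerA mulrC.
Qed.

Lemma opolyM p q x : opoly (p * q) x = opoly p (opoly q x).
Proof.
elim/poly_ind: p => [|p c IH]; first by rewrite mul0r !opoly0.
rewrite mulrDl !opolyD -mulrA.
by rewrite ['X * q]mulrC mulrA !opolyMX IH mul_polyC opolyZ opolyC.
Qed.

End OperatorPolynomials.

Section StolzCalculus.
Context (R : realType) (X : completeNormedModType R[i]) (T : X -> X).
Context (alpha beta : R) (hT : ritt_type T alpha) (hb : alpha < beta < pi / 2).
Let g := stolz_path beta.
Let E x := x - T x.

Let T_linear : linear T. Proof. by case: hT => -[[]]. Qed.

Let hbeta : 0 < beta < pi / 2.
Proof. by case: hT => _ /andP[a0 _] _ _; move/andP: hb => [ab ->]; rewrite (lt_trans a0). Qed.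

Let E_linear : linear E.
Proof. by move=> a x y; rewrite /E T_linear scalerBr addrACA opprD. Qed.

Let L : set R[i] := [set z | exists2 t : R, 0 < t < 3 & z = g t].

(** The inverse of l - u T, as u^-1 R(l / u, T): by [stolz_path_notin], l / u is outside the
    spectrum for u in ]0, 1]. *)
Let D (l : R[i]) (u : R) (x : X) : X :=
  if u == 0 then l^-1 *: x else u^-1%:C *: resolvent (l / u%:C) T x.

Let res_ok (l : R[i]) (u : R) : L l -> 0 < u <= 1 ->
  is_resolvent T (l / u%:C) (resolvent (l / u%:C) T).
Proof.
move=> [t ht ->] hu; case: hT => _ /andP[a0 _] sp _.
have : ~ spectrum T (g t / u%:C).
  by move/sp; apply: stolz_path_notin => //; rewrite a0; case/andP: hb.
by move=> /contrapT => hS; apply: (xgetPex (0 : X -> X)) hS.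
Qed.

Let res_bound : exists2 B : R, 0 <= B &
  forall l (u : R) x, L l -> 0 < u <= 1 ->
    rnorm ((l / u%:C - 1) *: resolvent (l / u%:C) T x) <= B * rnorm x.
Proof.
(* The contour of angle beta is the boundary of [stolz beta], so the resolvent bound is taken
   outside a domain of smaller angle. *)
case: hT => _ /andP[a0 _] _ /(_ ((alpha + beta) / 2)) h.
have [|B hB] := h.
- by move: hb => /andP[]; lra.
exists `|B| => // l u x Ll hu.
have := res_ok Ll hu; case: Ll => t ht -> [[lS _] _ _].
apply: (@opnorm_le_apply _ _ ((g t / u%:C - 1) *: resolvent (g t / u%:C) T : X -> X)).
  by move=> a y z; rewrite !fctE lS scalerDr !scalerA mulrC.
apply: (@le_trans _ _ B%:E); last by rewrite lee_fin ler_norm.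
apply: hB; exists (g t / u%:C) => //.
by apply: stolz_path_notin => //; move: hb a0 => /andP[]; lra.
Qed.

Let T_bound : exists2 c : R, 0 <= c & forall x, rnorm (T x) <= c * rnorm x.
Proof. by case: hT => -[bT _ _] _ _ _; exact: bounded_operator_le. Qed.

Let L_ge l : L l -> sin beta <= rnorm l.
Proof. by move=> [t /andP[t0 t3] ->]; apply: stolz_path_ge => //; rewrite !ltW. Qed.

Let r_gt0 : 0 < sin beta. Proof. exact: sin_gt0_pihalf. Qed.

Let L_neq0 l : L l -> l != 0.
Proof.
move=> /L_ge h; apply/eqP => l0; move: h; rewrite l0 rnorm0 leNgt r_gt0//.
Qed.

Let dom l (u : R) := L l /\ 0 <= u <= 1.

Let pos (u : R) : u != 0 -> 0 <= u <= 1 -> 0 < u <= 1.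
Proof. by move=> u0 /andP[u1 ->]; rewrite lt_neqAle eq_sym u0 u1. Qed.

Let D_linear l u : dom l u -> linear (D l u).
Proof.
move=> [Ll hu] a x y; rewrite /D; case: eqVneq => u0.
  by rewrite scalerDr !scalerA mulrC.
have [[lS _] _ _] := res_ok Ll (pos u0 hu).
by rewrite lS scalerDr !scalerA mulrC.
Qed.

Let uC (u : R) : u != 0 -> u%:C != 0 :> R[i].
Proof. by move=> u0; rewrite (inj_eq (@complexI R)). Qed.

Let D_l l u x : dom l u -> D l u (l *: x - u%:C *: T x) = x.
Proof.
move=> [Ll hu]; rewrite /D; case: eqVneq => u0.
  by rewrite u0 scale0r subr0 scalerA mulVf ?scale1r// L_neq0.
have [[lS _] h _] := res_ok Ll (pos u0 hu).
have -> : l *: x - u%:C *: T x = u%:C *: ((l / u%:C) *: x - T x).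
  by rewrite scalerBr scalerA mulrCA mulfV ?mulr1// uC.
by rewrite (linear_funZ lS) h scalerA -rmorphM mulVf// scale1r.
Qed.

Let D_r l u x : dom l u -> l *: D l u x - u%:C *: T (D l u x) = x.
Proof.
move=> [Ll hu]; rewrite /D; case: eqVneq => u0.
  by rewrite u0 scale0r subr0 scalerA mulfV ?scale1r// L_neq0.
have [[lS _] _ h] := res_ok Ll (pos u0 hu).
rewrite (linear_funZ T_linear) !scalerA -rmorphM mulfV// scale1r.
by rewrite fmorphV h.
Qed.

(** Put z = l / u. For u > sin beta / 2, use E R(z, T) = I - (z - 1) R(z, T) and the bound on u^-1.
    For smaller u, D(l, u) itself is bounded: it is (l - u)^-1 (z - 1) R(z, T), and |l - u| >= sin
    beta / 2. *)
Let ED_bound : exists2 B : R, 0 <= B &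
  forall l u x, dom l u -> rnorm (E (D l u x)) <= B * rnorm x.
Proof.
have [M M0 hM] := res_bound; have [cT c0 hcT] := T_bound.
have E_le x : rnorm (E x) <= (1 + cT) * rnorm x.
  by rewrite mulrDl mul1r (le_trans (ler_rnormB _ _))// lerD2l.
have ir : 0 <= 2 / sin beta by rewrite divr_ge0// ltW.
have c1 : 0 <= 1 + cT by rewrite addr_ge0.
have M1 : 0 <= M + 1 by rewrite addr_ge0.
exists (2 / sin beta * (M + 1) * (1 + cT)); first by do 2 apply: mulr_ge0 => //.
move=> l u x [Ll hu]; have lr := L_ge Ll.
have lp : 0 < rnorm l by rewrite (lt_le_trans r_gt0).
rewrite /D; case: eqVneq => u0.
  rewrite (linear_funZ E_linear) rnormZ rnormV -[leRHS]mulrA ler_pM ?invr_ge0 ?rnorm_ge0//.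
  rewrite (@le_trans _ _ (2 / sin beta))//; last by rewrite ler_peMr// lerDr.
  rewrite (@le_trans _ _ (sin beta)^-1)//; first by rewrite lef_pV2 ?posrE.
  by rewrite ler_peMl ?invr_ge0 ?ler1n// ltW.
have hu1 := pos u0 hu; have [[lS _] _ hS] := res_ok Ll hu1.
have hMx := hM _ _ x Ll hu1; case/andP: (hu1) => up u1.
set z := l / u%:C in hMx hS lS *.
have [ur|ru] := leP u (sin beta / 2).
  have lu : sin beta / 2 <= rnorm (l - u%:C).
    have := ler_rdist u%:C l 0; rewrite !subr0 rnormR (ger0_norm (ltW up)).
    by move: lr ur; lra.
  have lup : 0 < rnorm (l - u%:C) by rewrite (lt_le_trans _ lu)// divr_gt0.
  have lu0 : l - u%:C != 0 by apply/eqP => h; move: lup; rewrite h rnorm0 ltxx.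
  have -> : u^-1%:C *: resolvent z T x = (l - u%:C)^-1 *: ((z - 1) *: resolvent z T x).
    rewrite scalerA; congr (_ *: _); rewrite fmorphV /z.
    by field; rewrite lu0 uC.
  apply: le_trans (E_le _) _.
  have -> : 2 / sin beta * (M + 1) * (1 + cT) * rnorm x =
    (1 + cT) * (2 / sin beta * ((M + 1) * rnorm x)) by ring.
  apply: ler_wpM2l => //; rewrite rnormZ rnormV.
  apply: ler_pM; rewrite ?invr_ge0 ?rnorm_ge0//.
    by rewrite -[2 / _]invf_div lef_pV2 ?posrE// divr_gt0.
  by rewrite (le_trans hMx)// ler_wpM2r ?rnorm_ge0// lerDl.
rewrite (linear_funZ E_linear) rnormRZ (ger0_norm (_ : 0 <= u^-1)) ?invr_ge0 ?(ltW up)//.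
have -> : E (resolvent z T x) = x - (z - 1) *: resolvent z T x.
  have key y : y - T y = (z *: y - T y) - (z - 1) *: y.
    by rewrite scalerBl scale1r opprB [RHS]addrC addrA subrK.
  by rewrite /E key hS.
have h1 : u^-1 <= 2 / sin beta by rewrite -[2 / _]invf_div lef_pV2 ?posrE ?divr_gt0// ltW.
have h2 : rnorm (x - (z - 1) *: resolvent z T x) <= (M + 1) * rnorm x.
  by rewrite (le_trans (ler_rnormB _ _))// mulrDl mul1r addrC lerD2r.
rewrite (le_trans (ler_pM _ (rnorm_ge0 _) h1 h2)) ?invr_ge0 ?(ltW up)//.
by rewrite mulrA ler_wpM2r ?rnorm_ge0// ler_peMr ?lerDl//; apply: mulr_ge0.
Qed.

Let span_t (t xi t' : R) : Prop := [/\ 0 < t, t <= xi, xi <= t' & t' < 3].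

(* [p] has a primitive along the contour, with quadratic remainder, whose increment
   over the whole contour is [0]. *)
Let scalar_prim (p : {poly R[i]}) : Prop :=
  exists (A : R -> R[i]) (c : R), [/\ 0 <= c,
    forall t xi t', span_t t xi t' ->
      rnorm (A t' - A t - (g t' - g t) * p.[g xi]) <= c * (t' - t) ^+ 2 &
    forall u v : R, 0 < u < 3 -> 0 < v < 3 -> rnorm (A v - A u) <= c * (u + (3 - v))].

Let end_ge0 (u v : R) : 0 < u < 3 -> 0 < v < 3 -> 0 <= u + (3 - v).
Proof. by move=> /andP[u0 _] /andP[_ v3]; apply: addr_ge0; rewrite ?subr_ge0 ltW. Qed.

Let scalar_prim_lin a p q : scalar_prim p -> scalar_prim q -> scalar_prim (a *: p + q).
Proof.
move=> [A [c [c0 A1 A2]]] [B [d [d0 B1 B2]]].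
exists (fun t => a * A t + B t), (rnorm a * c + d); split=> [|t xi t' h|u v hu hv].
- by rewrite addr_ge0 ?mulr_ge0 ?rnorm_ge0.
- have -> : a * A t' + B t' - (a * A t + B t) - (g t' - g t) * (a *: p + q).[g xi] =
    a * (A t' - A t - (g t' - g t) * p.[g xi]) + (B t' - B t - (g t' - g t) * q.[g xi]).
    by rewrite hornerD hornerZ; ring.
  rewrite (le_trans (ler_rnormD _ _))// [leRHS]mulrDl lerD ?B1//.
  by rewrite rnormM -mulrA ler_wpM2l ?rnorm_ge0// A1.
- have -> : a * A v + B v - (a * A u + B u) = a * (A v - A u) + (B v - B u) by ring.
  rewrite (le_trans (ler_rnormD _ _))// [leRHS]mulrDl lerD ?B2//.
  by rewrite rnormM -mulrA ler_wpM2l ?rnorm_ge0// A2.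
Qed.

Let mid t xi t' : span_t t xi t' -> [/\ 0 < t < 3, 0 < xi < 3 & 0 < t' < 3].
Proof. by case=> h1 h2 h3 h4; split; apply/andP; split; lra. Qed.

Let scalar_prim_monomial k : scalar_prim 'X^k.
Proof.
have [K K0 hK] := stolz_path_lip hbeta.
have gle t : 0 < t < 3 -> rnorm (g t) <= 2.
  by move=> /andP[t0 t3]; apply: stolz_path_le2 => //; rewrite !ltW.
have glip t xi t' : span_t t xi t' -> rnorm (g t' - g t) <= K * (t' - t).
  by move=> [h1 h2 h3 h4]; apply: hK; lra.
(* By induction: the remainder for the power n + 2 is g t' times the one for n + 1, plus terms with
   two increments of g. *)
have key n : exists2 c : R, 0 <= c & forall t xi t', span_t t xi t' ->
    rnorm (g t' ^+ n.+1 - g t ^+ n.+1 - (g t' - g t) * (n.+1%:R * g xi ^+ n)) <= c * (t' - t) ^+ 2.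
  have lipn m : exists2 c : R, 0 <= c & forall t t' : R, 0 < t -> t <= t' -> t' < 3 ->
      rnorm (g t' ^+ m - g t ^+ m) <= c * (t' - t).
    elim: m => [|m [c c0 hc]]; first by exists 0 => // t t' _ _ _; rewrite subrr rnorm0 mul0r.
    exists (2 * c + K * 2 ^+ m); first by rewrite addr_ge0// mulr_ge0// exprn_ge0.
    move=> t t' h1 h2 h3.
    have -> : g t' ^+ m.+1 - g t ^+ m.+1 = g t' * (g t' ^+ m - g t ^+ m) + (g t' - g t) * g t ^+ m.
      by rewrite !exprS; ring.
    rewrite (le_trans (ler_rnormD _ _))// !rnormM rnormX [leRHS]mulrDl lerD//.
      rewrite -mulrA ler_pM ?rnorm_ge0//; last exact: hc.
      by apply: gle; apply/andP; split; lra.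
    rewrite mulrAC ler_pM ?exprn_ge0 ?rnorm_ge0//; first by apply: hK; lra.
    apply: lerXn2r; rewrite ?nnegrE ?rnorm_ge0//.
    by apply: gle; apply/andP; split; lra.
  elim: n => [|n [cn cn0 hcn]].
    by exists (0 : R) => // t xi t' _; rewrite !expr1 expr0 !mulr1 subrr rnorm0 mul0r.
  have [d d0 hd] := lipn n.+1.
  exists (2 * cn + n.+1%:R * (K * 2 ^+ n * K) + K * d).
    by rewrite !addr_ge0 ?mulr_ge0 ?exprn_ge0.
  move=> t xi t' h; have [ht hx ht'] := mid h.
  have -> : g t' ^+ n.+2 - g t ^+ n.+2 - (g t' - g t) * (n.+2%:R * g xi ^+ n.+1) =
    g t' * (g t' ^+ n.+1 - g t ^+ n.+1 - (g t' - g t) * (n.+1%:R * g xi ^+ n)) +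
    (n.+1%:R * ((g t' - g t) * g xi ^+ n * (g t' - g xi)) -
     (g t' - g t) * (g xi ^+ n.+1 - g t ^+ n.+1)).
    rewrite -[n.+2%:R]natr1 !exprS.
    move: (g t) (g t') (g xi) (n.+1%:R) => a b' x k1; move: (a ^+ n) (b' ^+ n) (x ^+ n) => y1 y2 y3; ring.
  have [h1 h2 h3 h4] := h; have tt0 : 0 <= t' - t by lra.
  apply: le_trans (ler_rnormD _ _) _; rewrite -[X in _ <= X * _]addrA [leRHS]mulrDl; apply: lerD.
    rewrite rnormM -[leRHS]mulrA ler_pM ?rnorm_ge0 ?gle//; exact: hcn.
  apply: le_trans (ler_rnormB _ _) _; rewrite [leRHS]mulrDl; apply: lerD.
    rewrite !rnormM rnorm_nat rnormX -[leRHS]mulrA ler_wpM2l//.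
    have -> : K * 2 ^+ n * K * (t' - t) ^+ 2 = K * (t' - t) * 2 ^+ n * (K * (t' - t)) by ring.
    apply: ler_pM; rewrite ?mulr_ge0 ?exprn_ge0 ?rnorm_ge0//; last first.
      by rewrite (le_trans (hK xi t' _ _ _)) ?ler_wpM2l//; lra.
    apply: ler_pM; rewrite ?exprn_ge0 ?rnorm_ge0//; first exact: glip h.
    by apply: lerXn2r; rewrite ?nnegrE ?rnorm_ge0 ?gle.
  rewrite rnormM.
  have -> : K * d * (t' - t) ^+ 2 = K * (t' - t) * (d * (t' - t)) by ring.
  apply: ler_pM; rewrite ?rnorm_ge0//; first exact: glip h.
  by rewrite (le_trans (hd t xi _ _ _)) ?ler_wpM2l//; lra.
have lipk : exists2 c : R, 0 <= c & forall u v, 0 < u < 3 -> 0 < v < 3 ->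
    rnorm (g v ^+ k.+1 - g u ^+ k.+1) <= c * (u + (3 - v)).
  exists (k.+1%:R * 2 ^+ k * K); first by rewrite !mulr_ge0 ?exprn_ge0.
  move=> u v hu hv; rewrite subrXX rnormM mulrC -[leRHS]mulrA ler_pM ?rnorm_ge0//; last first.
    by apply: stolz_path_closed => //; [move: hu|move: hv] => /andP[? ?]; rewrite !ltW.
  rewrite (le_trans (ler_rnorm_sum _ _ _))// mulr_natl -[in leRHS](card_ord k.+1) -sumr_const ler_sum// => i _.
  rewrite rnormM !rnormX -[k in leRHS](subnK (leq_ord i)) exprD.
  by rewrite /= ler_pM ?exprn_ge0 ?rnorm_ge0//; apply: lerXn2r; rewrite ?nnegrE ?rnorm_ge0 ?gle.
have [c c0 hc] := key k; have [d d0 hd] := lipk.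
have k0 : (k.+1%:R : R[i]) != 0 by rewrite pnatr_eq0.
have k1 : (k.+1%:R : R)^-1 <= 1 by rewrite invf_le1 ?ltr0n ?ler1n.
have k2 : 0 <= (k.+1%:R : R)^-1 by [].
exists (fun t => k.+1%:R^-1 * g t ^+ k.+1), (c + d); split=> [|t xi t' h|u v hu hv].
- exact: addr_ge0.
- rewrite hornerXn.
  have -> : k.+1%:R^-1 * g t' ^+ k.+1 - k.+1%:R^-1 * g t ^+ k.+1 - (g t' - g t) * g xi ^+ k =
     k.+1%:R^-1 * (g t' ^+ k.+1 - g t ^+ k.+1 - (g t' - g t) * (k.+1%:R * g xi ^+ k)).
    by rewrite !mulrBr [X in _ = _ - X]mulrCA mulKf.
  rewrite rnormM rnormV rnorm_nat (le_trans (ler_piMl (rnorm_ge0 _) k1))//.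
  by rewrite (le_trans (hc _ _ _ h))// ler_wpM2r ?sqr_ge0// lerDl.
- rewrite -mulrBr rnormM rnormV rnorm_nat (le_trans (ler_piMl (rnorm_ge0 _) k1))//.
  by rewrite (le_trans (hd _ _ hu hv))// ler_wpM2r ?end_ge0// lerDr.
Qed.

Let scalar_prim_all p : scalar_prim p.
Proof.
rewrite -[p]coefK poly_def; elim/big_ind: _ => [|p1 p2 h1 h2|i _].
- exists (fun=> 0), 0; split=> // [t xi t' _|u v hu hv].
    by rewrite horner0 mulr0 !subrr rnorm0 mul0r.
  by rewrite subrr rnorm0 mul0r.
- by rewrite -[p1]scale1r; exact: scalar_prim_lin.
- rewrite -[_ *: _]addr0; apply: scalar_prim_lin; first exact: scalar_prim_monomial.
  exists (fun=> 0), 0; split=> // [t xi t' _|u v hu hv].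
    by rewrite horner0 mulr0 !subrr rnorm0 mul0r.
  by rewrite subrr rnorm0 mul0r.
Qed.

Let resC z : L z -> is_resolvent T z (resolvent z T).
Proof. by move=> Lz; have := @res_ok z 1 Lz; rewrite divr1 ltr01 lexx; exact. Qed.

Let L_g t : 0 < t < 3 -> L (g t). Proof. by move=> ht; exists t. Qed.

(* [A] is a primitive of [F] along the contour, with quadratic remainder, and [S] is
   its increment over the whole contour. *)
Let contour_prim (A : R -> X -> X) (F : R[i] -> X -> X) (S : X -> X) : Prop :=
  exists c : R, [/\ 0 <= c,
    forall t, 0 < t < 3 -> linear (A t),
    forall t xi t' x, span_t t xi t' ->
      rnorm (A t' x - A t x - (g t' - g t) *: F (g xi) x) <= c * (t' - t) ^+ 2 * rnorm x &
    forall u v x, 0 < u < 3 -> 0 < v < 3 ->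
      rnorm (A v x - A u x - S x) <= c * (u + (3 - v)) * rnorm x].

Let contour_prim_ext A F S F' S' : (forall z x, L z -> F z x = F' z x) ->
  (forall x, S x = S' x) -> contour_prim A F S -> contour_prim A F' S'.
Proof.
move=> eF eS [c [c0 lA A1 A2]]; exists c; split=> // [t xi t' x h|u v x hu hv].
  by have [_ hxi _] := mid h; rewrite -eF ?A1//; exact: L_g.
by rewrite -eS A2.
Qed.

Let sumB (a b a' b' p q : X) : (a + b) - (a' + b') - (p + q) = (a - a' - p) + (b - b' - q).
Proof. by rewrite !opprD (addrACA a) (addrACA (a - a')). Qed.

Let contour_primD A F S A' F' S' : contour_prim A F S -> contour_prim A' F' S' ->
  contour_prim (fun t x => A t x + A' t x) (fun z x => F z x + F' z x) (fun x => S x + S' x).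
Proof.
move=> [c [c0 lA A1 A2]] [d [d0 lB B1 B2]].
exists (c + d); split=> [|t ht|t xi t' x h|u v x hu hv]; first exact: addr_ge0.
- by move=> b x y; rewrite (lA t ht) (lB t ht) scalerDr addrACA.
- rewrite scalerDr sumB (le_trans (ler_rnormD _ _))//.
  by rewrite [X in _ <= X * _]mulrDl [leRHS]mulrDl lerD ?A1 ?B1.
- rewrite sumB (le_trans (ler_rnormD _ _))//.
  by rewrite [X in _ <= X * _]mulrDl [leRHS]mulrDl lerD ?A2 ?B2.
Qed.

Let contour_prim_comp (U : X -> X) (k : R) A F S : linear U -> 0 <= k ->
  (forall x, rnorm (U x) <= k * rnorm x) -> contour_prim A F S ->
  contour_prim (fun t x => U (A t x)) (fun z x => U (F z x)) (fun x => U (S x)).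
Proof.
move=> lU k0 hU [c [c0 lA A1 A2]].
exists (k * c); split=> [|t ht|t xi t' x h|u v x hu hv]; first exact: mulr_ge0.
- by move=> b x y; rewrite (lA t ht) lU.
- rewrite -(linear_funZ lU) -!(linear_funB lU) (le_trans (hU _))//.
  by rewrite -[X in _ <= X * _]mulrA -[leRHS]mulrA ler_wpM2l ?A1.
- by rewrite -!(linear_funB lU) (le_trans (hU _))//
    -[X in _ <= X * _]mulrA -[leRHS]mulrA ler_wpM2l ?A2.
Qed.

(** Cauchy's theorem for a polynomial times a fixed operator. *)
Let contour_prim_scalar p (U : X -> X) (k : R) : linear U -> 0 <= k ->
  (forall x, rnorm (U x) <= k * rnorm x) ->
  exists A, contour_prim A (fun z x => p.[z] *: U x) (fun=> 0).
Proof.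
move=> lU k0 hU; have [A [c [c0 A1 A2]]] := scalar_prim_all p.
exists (fun t x => A t *: U x), (c * k); split=> [|t ht|t xi t' x h|u v x hu hv].
- exact: mulr_ge0.
- by move=> b x y; rewrite lU scalerDr !scalerA mulrC.
- rewrite scalerA -!scalerBl rnormZ.
  have -> : c * k * (t' - t) ^+ 2 * rnorm x = c * (t' - t) ^+ 2 * (k * rnorm x) by ring.
  by rewrite ler_pM ?rnorm_ge0 ?A1.
- rewrite subr0 -!scalerBl rnormZ.
  have -> : c * k * (u + (3 - v)) * rnorm x = c * (u + (3 - v)) * (k * rnorm x) by ring.
  by rewrite ler_pM ?rnorm_ge0 ?A2.
Qed.

(** Cauchy's formula for p: the integral of p(z) R(z, T) over the contour is 2 pi i p(T). *)
Let good (p : {poly R[i]}) : Prop := exists A,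
  contour_prim A (fun z x => p.[z] *: resolvent z T x)
    (fun x => (0 +i* (pi *+ 2)) *: opoly T p x).

Let good_lin a p q : good p -> good q -> good (a *: p + q).
Proof.
move=> [A hA] [B hB]; have la : linear ( *:%R a : X -> X).
  by move=> b x y; rewrite scalerDr !scalerA mulrC.
have na (x : X) : rnorm (a *: x) <= rnorm a * rnorm x by rewrite rnormZ.
have h1 := @contour_prim_comp ( *:%R a) (rnorm a) A _ _ la (rnorm_ge0 a) na hA.
have := contour_primD h1 hB.
move=> h; exists (fun t x => a *: A t x + B t x).
apply: contour_prim_ext h => [z x _|x].
  by rewrite hornerD hornerZ scalerDl scalerA.
by rewrite opolyD opolyZ scalerDr !scalerA mulrC.
Qed.

Let id_le (x : X) : rnorm x <= 1 * rnorm x. Proof. by rewrite mul1r. Qed.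
Let id_linear : linear (fun x : X => x). Proof. by []. Qed.

(** z R(z, T) = T R(z, T) + I, and the integral of p(z) I is 0. *)
Let good_MX p : good p -> good (p * 'X).
Proof.
have [cT cT0 hcT] := T_bound.
move=> [A hA]; have [B hB] := contour_prim_scalar p id_linear ler01 id_le.
have := contour_primD (contour_prim_comp T_linear cT0 hcT hA) hB.
move=> h; exists (fun t x => T (A t x) + B t x); apply: contour_prim_ext h => [z x Lz|x].
  have [_ _ hres] := resC Lz; rewrite hornerMX (linear_funZ T_linear) -scalerDr -scalerA.
  by rewrite -{2}(hres x) [T _ + _]addrC subrK.
by rewrite addr0 opolyMX// (linear_funZ T_linear).
Qed.

Let E3_opoly x : opoly T ((1 - 'X) ^+ 3) x = E (E (E x)).
Proof.
have oE y : opoly T (1 - 'X) y = E y by rewrite opolyB opoly1 opolyX.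
by rewrite !exprS expr0 mulr1 !opolyM ?oE.
Qed.

(** The primitive of z^-1 E^3 is the logarithm times E^3, with increment 2 pi i E^3; the rest of E^3
    R(z, T) has the primitive - J, without increment. *)
Let base_prim : exists A, contour_prim A (fun z x => E (E (E (resolvent z T x))))
  (fun x => (0 +i* (pi *+ 2)) *: E (E (E x))).
Proof.
have [cT cT0 hcT] := T_bound; have [B B0 hB] := ED_bound.
have [K K0 hK] := stolz_path_lip hbeta.
have [l l0 hl] := path_log_primitive hbeta; have [k k0 hk] := path_log_closed hbeta.
pose cE := 1 + cT.
have cE0 : 0 <= cE by rewrite addr_ge0.
have E_le x : rnorm (E x) <= cE * rnorm x.
  by rewrite mulrDl mul1r (le_trans (ler_rnormB _ _))// lerD2l.
have E3_le x : rnorm (E (E (E x))) <= cE ^+ 3 * rnorm x.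
  apply: (le_trans (E_le _)); rewrite exprS -mulrA ler_wpM2l//.
  by apply: (le_trans (E_le _)); rewrite expr2 -mulrA ler_wpM2l.
pose J := log_part T D.
have J_linear t : 0 < t < 3 -> linear (J (g t)).
  by move=> ht; apply: (log_part_linear T_linear hcT cT0 B0 D_linear D_l D_r hB); exact: L_g.
have J_lip t t' x : 0 < t < 3 -> 0 < t' < 3 ->
    rnorm (J (g t) x - J (g t') x) <= cT * (B ^+ 2 * cE) * rnorm (g t' - g t) * rnorm x.
  by move=> ht ht'; apply: (log_part_lip T_linear hcT cT0 B0 D_linear D_l D_r hB); exact: L_g.
have J_der t t' xi x : 0 < t < 3 -> 0 < t' < 3 -> 0 < xi < 3 ->
    rnorm (J (g t') x - J (g t) x + (g t' - g t) *:
      (E (E (E (resolvent (g xi) T x))) - E (E (E ((g xi)^-1 *: x)))))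
    <= cT * B ^+ 3 * rnorm (g t' - g t) * (rnorm (g t' - g xi) + rnorm (g t - g xi)) * rnorm x.
  move=> ht ht' hxi.
  have := log_part_derive T_linear hcT cT0 B0 D_linear D_l D_r hB x (L_g ht) (L_g ht') (L_g hxi).
  by rewrite /D oner_eq0 eqxx invr1 scale1r divr1.
pose c0 := cT * B ^+ 3 * K * (K + K).
have c00 : 0 <= c0 by rewrite !mulr_ge0 ?exprn_ge0 ?addr_ge0.
pose C1 := l * cE ^+ 3 + c0.
pose C2 := k * cE ^+ 3 + cT * (B ^+ 2 * cE) * K.
have C10 : 0 <= C1 by apply: addr_ge0 => //; apply: mulr_ge0 => //; exact: exprn_ge0.
have B20 : 0 <= cT * (B ^+ 2 * cE).
  by apply: mulr_ge0 => //; apply: mulr_ge0 => //; exact: sqr_ge0.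
have C20 : 0 <= C2.
  by apply: addr_ge0; apply: mulr_ge0 => //; exact: exprn_ge0.
have swap (p q p' q' : X) : (p - q) - (p' - q') = (p - p') - (q - q').
  by rewrite [- (p' - q')]opprB [q' - p']addrC addrACA [- q + q']addrC opprB.
have cancel (a v b u : X) : (a - v) - (b + (u - v)) = a - b - u.
  by rewrite opprD opprB addrA [a - v - b]addrAC addrA subrK.
exists (fun t x => path_log beta t *: E (E (E x)) - J (g t) x), (C1 + C2).
split=> [|t ht|t xi t' x h|u v x hu hv].
- exact: addr_ge0.
- move=> a x y; rewrite !E_linear (J_linear t ht).
  move: (E (E (E x))) (E (E (E y))) => p q; rewrite scalerDr !scalerA [_ * a]mulrC.
  by rewrite opprD addrACA scalerBr scalerA.
- have [ht hxi ht'] := mid h.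
  have [h1 h2 h3 h4] := h; have tt0 : 0 <= t' - t by rewrite subr_ge0 (le_trans h2).
  have -> : path_log beta t' *: E (E (E x)) - J (g t') x -
      (path_log beta t *: E (E (E x)) - J (g t) x) -
      (g t' - g t) *: E (E (E (resolvent (g xi) T x))) =
    (path_log beta t' - path_log beta t - (g t' - g t) / g xi) *: E (E (E x)) -
    (J (g t') x - J (g t) x + (g t' - g t) *:
      (E (E (E (resolvent (g xi) T x))) - E (E (E ((g xi)^-1 *: x))))).
    have -> : E (E (E ((g xi)^-1 *: x))) = (g xi)^-1 *: E (E (E x)).
      by do 3 rewrite (linear_funZ E_linear).
    move: (path_log beta t') (path_log beta t) (J (g t') x) (J (g t) x) => a1 a2 b1 b2.
    move: (E (E (E x))) (E (E (E (resolvent (g xi) T x)))) => p q.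
    move: (g t' - g t) (g xi)^-1 => w z.
    by rewrite swap -scalerBl [in RHS]scalerBl (scalerBr _ q) scalerA cancel.
  apply: le_trans (ler_rnormB _ _) _.
  apply: (@le_trans _ _ (C1 * (t' - t) ^+ 2 * rnorm x)); last first.
    by apply: ler_wpM2r; rewrite ?rnorm_ge0//; apply: ler_wpM2r; rewrite ?sqr_ge0// lerDl.
  have -> : C1 * (t' - t) ^+ 2 * rnorm x = l * (t' - t) ^+ 2 * (cE ^+ 3 * rnorm x) +
     cT * B ^+ 3 * (K * (t' - t)) * (K * (t' - t) + K * (t' - t)) * rnorm x.
    by rewrite /C1 /c0; ring.
  apply: lerD.
    rewrite rnormZ ler_pM ?rnorm_ge0//; apply: hl; rewrite ?h2 ?h3 ?(ltW h1) ?(ltW h4)//.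
  apply: (le_trans (J_der t t' xi x ht ht' hxi)).
  have P0 : 0 <= cT * B ^+ 3 by rewrite mulr_ge0 ?exprn_ge0.
  have t0 := ltW h1; have t3 := ltW h4; have x0 := le_trans t0 h2; have x3 := le_trans h3 t3.
  have kt := hK _ _ t0 (le_trans h2 h3) t3.
  apply: ler_wpM2r; rewrite ?rnorm_ge0//.
  apply: ler_pM; rewrite ?mulr_ge0 ?addr_ge0 ?rnorm_ge0//; first by rewrite ler_wpM2l.
  apply: lerD.
    by apply: le_trans (hK _ _ x0 h3 t3) _; rewrite ler_wpM2l// lerD2l lerN2.
  by rewrite rnormB; apply: le_trans (hK _ _ t0 h2 x3) _; rewrite ler_wpM2l// lerD2r.
- have -> : path_log beta v *: E (E (E x)) - J (g v) x -
      (path_log beta u *: E (E (E x)) - J (g u) x) - (0 +i* (pi *+ 2)) *: E (E (E x)) =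
    (path_log beta v - path_log beta u - (0 +i* (pi *+ 2))) *: E (E (E x)) - (J (g v) x - J (g u) x).
    by rewrite swap -scalerBl [in RHS]scalerBl addrAC.
  apply: le_trans (ler_rnormB _ _) _; have s0 := end_ge0 hu hv.
  have hu' : 0 <= u <= 3 by case/andP: hu => ? ?; rewrite !ltW.
  have hv' : 0 <= v <= 3 by case/andP: hv => ? ?; rewrite !ltW.
  apply: (@le_trans _ _ (C2 * (u + (3 - v)) * rnorm x)); last first.
    by apply: ler_wpM2r; rewrite ?rnorm_ge0//; apply: ler_wpM2r => //; rewrite lerDr.
  have -> : C2 * (u + (3 - v)) * rnorm x = k * (u + (3 - v)) * (cE ^+ 3 * rnorm x) +
     cT * (B ^+ 2 * cE) * (K * (u + (3 - v))) * rnorm x.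
    by rewrite /C2; ring.
  apply: lerD; first by rewrite rnormZ ler_pM ?rnorm_ge0// hk.
  apply: (le_trans (J_lip v u x hv hu)).
  apply: ler_wpM2r; rewrite ?rnorm_ge0//; apply: ler_wpM2l => //.
  by rewrite rnormB; apply: stolz_path_closed.
Qed.

(** (1 - z) R = E R - I, used three times, gives (1 - z)^3 R = E^3 R - E^2 - (1 - z) E - (1 - z)^2,
    and the last three terms have integral 0. *)
Let good_base : good ((1 - 'X) ^+ 3).
Proof.
have [cT cT0 hcT] := T_bound; have c10 : 0 <= 1 + cT by rewrite addr_ge0.
have E_le x : rnorm (E x) <= (1 + cT) * rnorm x.
  by rewrite mulrDl mul1r (le_trans (ler_rnormB _ _))// lerD2l.
have E2_linear : linear (fun x => E (E x)) by move=> a x y; rewrite !E_linear.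
have E2_le x : rnorm (E (E x)) <= (1 + cT) * (1 + cT) * rnorm x.
  by apply: (le_trans (E_le _)); rewrite -mulrA ler_wpM2l.
have [A hA] := base_prim.
have [A1 h1] := contour_prim_scalar (-1) E2_linear (mulr_ge0 c10 c10) E2_le.
have [A2 h2] := contour_prim_scalar (- (1 - 'X)) E_linear c10 E_le.
have [A3 h3] := contour_prim_scalar (- (1 - 'X) ^+ 2) id_linear ler01 id_le.
have h := contour_primD (contour_primD (contour_primD hA h1) h2) h3.
exists (fun t x => A t x + A1 t x + A2 t x + A3 t x).
apply: contour_prim_ext h => [z x Lz|x]; last by rewrite !addr0 E3_opoly.
have [_ _ hres] := resC Lz; set S := resolvent z T x.
have e2 : (1 - z) *: S = E S - x.
  have key (y : X) : (1 - z) *: y = (y - T y) - (z *: y - T y).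
    by rewrite scalerBl scale1r opprB addrA subrK.
  by rewrite key hres.
have p1 : (1 - 'X : {poly R[i]}).[z] = 1 - z by rewrite hornerD hornerN hornerX hornerC.
rewrite !hornerN !horner_exp p1 hornerC !scaleNr scale1r.
rewrite [in RHS]exprSr -[in RHS]scalerA e2 (scalerBr _ (E S)); congr (_ - _).
rewrite [in RHS]expr2 -[in RHS]scalerA -[in RHS](linear_funZ E_linear) e2.
rewrite [in RHS](linear_funB E_linear) (scalerBr _ (E (E S))); congr (_ - _).
rewrite -[in RHS](linear_funZ E_linear) -[in RHS](linear_funZ E_linear) e2.
by rewrite (linear_funB E_linear (E S) x) (linear_funB E_linear (E (E S)) (E x)).
Qed.

Let good_all q : good (q * (1 - 'X) ^+ 3).
Proof.
elim/poly_ind: q => [|q c IH].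
  have := good_lin (-1) good_base good_base.
  by rewrite scaleN1r addNr mul0r.
rewrite mulrDl mul_polyC addrC; apply: good_lin; first exact: good_base.
have -> : q * 'X * (1 - 'X) ^+ 3 = q * (1 - 'X) ^+ 3 * 'X by rewrite mulrAC.
exact: good_MX.
Qed.

Lemma calculus_poly q x :
  calculus T beta (horner (q * (1 - 'X) ^+ 3)) x = opoly T (q * (1 - 'X) ^+ 3) x.
Proof.
set p := q * _; have [A [c [c0 lA A1 A2]]] : good p := good_all q.
have pl : linear (opoly T p) by exact: opoly_linear.
have pi0 : (0 +i* (pi *+ 2) : R[i]) != 0.
  rewrite eq_complex /= eqxx /= mulrn_eq0 /= gt_eqF//; exact: pi_gt0.
have Sl : linear ((0 +i* (pi *+ 2)) *: opoly T p : X -> X).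
  by move=> a y z; rewrite !fctE pl scalerDr !scalerA mulrC.
have [cT cT0 hcT] := T_bound.
have [cp cp0 hcp] : exists2 c : R, 0 <= c & forall x, rnorm (opoly T p x) <= c * rnorm x.
  have it n y : rnorm (iter n T y) <= cT ^+ n * rnorm y.
    elim: n => [|n IH]; first by rewrite mul1r.
    by rewrite /= (le_trans (hcT _))// exprS -mulrA ler_wpM2l.
  exists (\sum_(i < size p) rnorm p`_i * cT ^+ i).
    by apply: sumr_ge0 => i _; rewrite mulr_ge0 ?rnorm_ge0 ?exprn_ge0.
  move=> y; rewrite (le_trans (ler_rnorm_sum _ _ _))// mulr_suml ler_sum// => i _.
  by rewrite rnormZ -mulrA ler_wpM2l ?rnorm_ge0.
rewrite /calculus (@improper_path_integralE _ _ _ _ _ _ ((0 +i* (pi *+ 2)) *: opoly T p)) //.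
- by rewrite !fctE scalerA mulVf// scale1r.
- apply: (@bounded_operatorI _ _ _ (rnorm (0 +i* (pi *+ 2) : R[i]) * cp)) => // y.
  by rewrite !fctE rnormZ -mulrA ler_wpM2l ?rnorm_ge0.
exists (fun u v => A v - A u); split.
  move=> u v u0 uv v3; apply: (@path_integral_of_primitive _ _ _ _ _ _ _ c) => // t xi t' y ut /andP[h1 h2] h3.
  by rewrite !fctE; apply: A1; split=> //; [rewrite (lt_le_trans u0)|rewrite (le_lt_trans h3)].
(* Near the ends u + (3 - v) < 2 d, so the error is at most 2 c d < e; the 1 in the denominator
   covers c = 0. *)
move=> e e0; exists (e / (c * 4 + 1)); first by rewrite divr_gt0// ltr_wpDl// mulr_ge0.
move=> u v /andP[u0 ud] /andP[vd v3] uv.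
have hu : 0 < u < 3 by rewrite u0 (lt_trans uv).
have hv : 0 < v < 3 by rewrite v3 andbT (lt_trans u0).
set d := e / _ in ud vd; have d0 : 0 < d by rewrite (lt_trans u0)// -[ltRHS]add0r.
apply: (@le_lt_trans _ _ (c * (d + d))%:E).
  apply: opnorm_le => [|y]; first by rewrite mulr_ge0// addr_ge0// ltW.
  rewrite !fctE (le_trans (A2 _ _ _ hu hv))// ler_wpM2r ?rnorm_ge0// ler_wpM2l//.
  by lra.
have de : d * (c * 4 + 1) = e by rewrite /d divfK// gt_eqF// ltr_wpDl// mulr_ge0.
rewrite lte_fin; have : 0 <= c * d by rewrite mulr_ge0// ltW.
lra.
Qed.

End StolzCalculus.

(** * Nontangential approach to 1 in the Stolz domain *)

Section StolzDomain.
Context (R : realType) (c : R) (hc : 0 < c < pi / 2).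

(** This form of |1 - z| <= C (1 - |z|) is a sublevel set of a convex function, so it need only be
    checked at 1 and on the disc. There |1 - z| <= 1 + sin c and 1 - |z| >= 1 - sin c, which gives
    C. *)
Lemma stolz_nontangential : exists2 C : R, 0 <= C & forall z : R[i],
  stolz c z -> rnorm (1 - z) + C * rnorm z <= C.
Proof.
have s0 : 0 < sin c by exact: sin_gt0_pihalf.
have s1 : sin c < 1.
  move/andP: hc => [c0 cp]; have ph := pihalf_ge1 R.
  rewrite -(sin_pihalf R) ltr_sin// in_itv/=; apply/andP; split; lra.
have d0 : 0 < 1 - sin c by rewrite subr_gt0.
have sp : 0 < 1 + sin c by lra.
have Cp : 0 < (1 + sin c) / (1 - sin c) by rewrite divr_gt0.
exists ((1 + sin c) / (1 - sin c)); first exact: ltW.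
set C := _ / _; have CE : C * (1 - sin c) = 1 + sin c by rewrite /C divfK// gt_eqF.
have C0 : 0 < C by [].
move=> z; apply: (@convex_sub_stolz R c [set z | rnorm (1 - z) + C * rnorm z <= C]) => /=.
- apply: sublevel_convex => z1 z2 t /andP[t0 t1].
  have -> : 1 - (t%:C * z1 + (1 - t)%:C * z2) = t%:C * (1 - z1) + (1 - t)%:C * (1 - z2).
    by rewrite rmorphB/=; ring.
  have t1' : 0 <= 1 - t by rewrite subr_ge0.
  have h1 : rnorm (t%:C * (1 - z1) + (1 - t)%:C * (1 - z2)) <= t * rnorm (1 - z1) + (1 - t) * rnorm (1 - z2).
    by rewrite (le_trans (ler_rnormD _ _))// !rnormRM !ger0_norm.
  have h2 : rnorm (t%:C * z1 + (1 - t)%:C * z2) <= t * rnorm z1 + (1 - t) * rnorm z2.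
    by rewrite (le_trans (ler_rnormD _ _))// !rnormRM !ger0_norm.
  have := ler_wpM2l (ltW C0) h2; lra.
- by rewrite subrr rnorm0 rnorm1 add0r mulr1.
- move=> w wc; have := ler_rnormB 1 w; rewrite rnorm1 => h.
  have := ler_wpM2l (ltW C0) (ltW wc); lra.
Qed.

Lemma stolz_le1 (z : R[i]) : stolz c z -> rnorm z <= 1.
Proof.
apply: (@convex_sub_stolz R c [set z | rnorm z <= 1]) => /=.
- apply: sublevel_convex => z1 z2 t /andP[t0 t1].
  have t1' : 0 <= 1 - t by rewrite subr_ge0.
  by rewrite (le_trans (ler_rnormD _ _))// !rnormRM !ger0_norm.
- by rewrite rnorm1.
- by move=> w /ltW wc; rewrite (le_trans wc)// sin_le1.
Qed.

End StolzDomain.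

(** * Polynomial estimates from the functional calculus *)

Section PolynomialCalculus.
Context (R : realType) (X : completeNormedModType R[i]) (T : X -> X) (gamma : R).
Hypotheses (hgamma : 0 < gamma < pi / 2) (hcalc : bounded_Hinfty_calculus gamma T).

Lemma rnorm_horner_le (p : {poly R[i]}) (z : R[i]) : rnorm z <= 1 ->
  rnorm p.[z] <= \sum_(i < size p) rnorm p`_i.
Proof.
move=> z1; rewrite horner_coef (le_trans (ler_rnorm_sum _ _ _))//.
apply: ler_sum => i _; rewrite rnormM rnormX ler_piMr ?rnorm_ge0//.
by rewrite exprn_ile1 ?rnorm_ge0.
Qed.

Lemma derivable_complex_horner (p : {poly R[i]}) (z : R[i]^o) :
  derivable (horner p : R[i]^o -> R[i]^o) z 1.
Proof.
elim/poly_ind: p => [|p c IH].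
  have -> : (horner 0 : R[i]^o -> R[i]^o) = cst 0 by apply/funext => w; rewrite horner0.
  exact: derivable_cst.
have -> : (horner (p * 'X + c%:P) : R[i]^o -> R[i]^o) = (horner p : R[i]^o -> R[i]^o) * id + cst c.
  by apply/funext => w; rewrite hornerMXaddC !fctE.
have h1 := @derivable_id R[i] R[i]^o z 1.
have h2 := @derivable_cst R[i] R[i]^o R[i]^o c z 1.
have h3 := @derivableM R[i] R[i]^o (horner p) id z 1 IH h1.
exact: (@derivableD R[i] R[i]^o R[i]^o _ _ z 1 h3 h2).
Qed.

Lemma Hinfty0_poly q : Hinfty0 gamma (horner (q * (1 - 'X) ^+ 3)).
Proof.
split.
- by move=> z _; exact: derivable_complex_horner.
- exists (\sum_(i < size (q * (1 - 'X) ^+ 3)) rnorm (q * (1 - 'X) ^+ 3)`_i) => z sz.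
  exact: (rnorm_horner_le (q * (1 - 'X) ^+ 3) (stolz_le1 sz)).
- pose M := \sum_(i < size q) rnorm q`_i.
  have M0 : 0 <= M by apply: sumr_ge0 => i _; exact: rnorm_ge0.
  exists 1, (M * 4 + 1); split=> [//||z sz]; first by rewrite ltr_wpDl// mulr_ge0.
  have z1 := stolz_le1 sz.
  have h2 : rnorm (1 - z) <= 2 by have := ler_rnormB 1 z; rewrite rnorm1; lra.
  rewrite hornerM horner_exp hornerD hornerN hornerX hornerC powRr1 ?rnorm_ge0//.
  rewrite exprSr mulrA rnormM ler_wpM2r ?rnorm_ge0// rnormM rnormX.
  rewrite (@le_trans _ _ (M * 4)) ?lerDl// ler_pM ?exprn_ge0 ?rnorm_ge0//.
    exact: (rnorm_horner_le q z1).
  have -> : 4 = 2 ^+ 2 :> R by rewrite -natrX.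
  by apply: lerXn2r; rewrite ?nnegrE ?rnorm_ge0.
Qed.

Lemma poly_bound3 : exists2 K : R, 0 < K & forall (q : {poly R[i]}) (b : R), 0 <= b ->
  (forall z, stolz gamma z -> rnorm (q * (1 - 'X) ^+ 3).[z] <= b) ->
  forall x, rnorm (opoly T (q * (1 - 'X) ^+ 3) x) <= K * b * rnorm x.
Proof.
have [alpha [hT ag [K K0 hK]]] := hcalc; exists K => // q b b0 hb x.
have hbeta1 : alpha < (alpha + gamma) / 2 < gamma by apply/andP; split; lra.
have hbeta2 : alpha < (alpha + gamma) / 2 < pi / 2.
  by move: hbeta1 hgamma => /andP[-> /lt_trans h] /andP[_ /h ->].
have := hK _ (Hinfty0_poly q) _ hbeta1.
have -> : calculus T ((alpha + gamma) / 2) (horner (q * (1 - 'X) ^+ 3)) = opoly T (q * (1 - 'X) ^+ 3).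
  by apply/funext => y; exact: (calculus_poly hT hbeta2).
have T_linear : linear T by case: hT => -[[]].
move=> h; apply: opnorm_le_apply; first exact: opoly_linear.
apply: (le_trans h); rewrite lee_fin ler_wpM2l ?(ltW K0)//.
(* The supremum of the empty set is 0 by convention. *)
set S := [set _ | _ in _]; have [->|/set0P S0] := eqVneq S set0; first by rewrite sup0.
by apply: ge_sup => // _ [z sz <-]; exact: hb.
Qed.

(* Multiplying by [(1 - 'X^N)^2] provides the missing factors; as N tends to
   infinity its effect on T disappears, because N (T^N - T^(N-1)) is bounded. *)
Lemma poly_bound1 : exists2 K : R, 0 < K & forall (q : {poly R[i]}) (b : R), 0 <= b ->
  (forall z, stolz gamma z -> rnorm (q * (1 - 'X)).[z] <= b) ->
  forall x, rnorm (opoly T (q * (1 - 'X)) x) <= K * b * rnorm x.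
Proof.
have [alpha [[[bT _ [M hM]] _ _ _] _ _]] := hcalc.
have T_linear : linear T by case: bT.
have [K K0 hK] := poly_bound3; exists (K * 4); first by rewrite mulr_gt0.
move=> q b b0 hb x.
have il n : linear (iter n T).
  by elim: n => [//|n IH] c u v /=; rewrite IH T_linear.
pose y := opoly T q x; pose w := opoly T (q * (1 - 'X)) x.
have wE : w = y - T y.
  rewrite /w mulrC (opolyM T_linear) opolyB opoly1 opolyX//.
have small n : (0 < n)%N -> rnorm (iter n T w) <= `|M| / n%:R * rnorm y.
  move=> n0; rewrite wE (linear_funB (il n)) -iterSr.
  have lS : linear ((n.+1%:R : R[i]) *: (iter n.+1 T - iter n T : X -> X)).
    by move=> c u v; rewrite !fctE !il opprD addrACA -scalerBr scalerDr !scalerA mulrC.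
  have hn : (opnorm ((n.+1%:R : R[i]) *: (iter n.+1 T - iter n T : X -> X)) <= M%:E)%E.
    by apply: hM; exists n.+1.
  have := opnorm_le_apply y lS hn; rewrite !fctE rnormZ rnorm_nat rnormB => h.
  rewrite mulrAC ler_pdivlMr ?ltr0n// mulrC.
  rewrite (le_trans _ (le_trans h _))//; first by rewrite ler_wpM2r ?rnorm_ge0// ler_nat.
  by rewrite ler_wpM2r ?rnorm_ge0// ler_norm.
apply: (@ler_addgeom _ _ _ (3 * `|M| * rnorm y)) => n.
pose N := (2 ^ n)%N; have N0 : (0 < N)%N by rewrite expn_gt0.
pose s : {poly R[i]} := \sum_(i < N) 'X^i.
(* So (1 - 'X^N)^2 contains two factors 1 - 'X, while it is at most 4 on the unit disc, whatever
   N. *)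
have sE : (1 - 'X) * s = 1 - 'X^N.
  by rewrite -[LHS]opprK -mulNr opprB -subrX1 opprB.
have pE : q * s ^+ 2 * (1 - 'X) ^+ 3 = q * (1 - 'X) * (1 - 'X^N) ^+ 2.
  by rewrite -sE; ring.
have := hK (q * s ^+ 2) (b * 4) (mulr_ge0 b0 (ler0n _ 4)) _ x.
rewrite pE => h.
have /h : forall z, stolz gamma z -> rnorm (q * (1 - 'X) * (1 - 'X^N) ^+ 2).[z] <= b * 4.
  move=> z sz; rewrite hornerM rnormM ler_pM ?rnorm_ge0 ?hb//.
  rewrite horner_exp rnormX hornerD hornerN hornerXn hornerC.
  have -> : 4 = 2 ^+ 2 :> R by rewrite -natrX.
  apply: lerXn2r; rewrite ?nnegrE ?rnorm_ge0//.
  rewrite (le_trans (ler_rnormB _ _))// rnorm1 rnormX.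
  by rewrite -[leRHS]/(1 + 1) lerD2l exprn_ile1 ?rnorm_ge0// (stolz_le1 sz).
have -> : opoly T (q * (1 - 'X) * (1 - 'X^N) ^+ 2) x = w - iter N T w - (iter N T w - iter (N + N) T w).
  rewrite mulrC (opolyM T_linear) -/w expr2.
  have o1 v : opoly T (1 - 'X^N) v = v - iter N T v by rewrite opolyB opoly1 opolyXn.
  by rewrite (opolyM T_linear) !o1 (linear_funB (il N)) iterD.
move=> h1; rewrite -/w.
have h2 := small N N0; have h3 := small (N + N)%N (ltn_addl _ N0).
have -> : w = (w - iter N T w - (iter N T w - iter (N + N) T w)) + (iter N T w + (iter N T w - iter (N + N) T w)).
  by rewrite addrACA [- (_ - _) + _]addrC subrr addr0 subrK.
apply: le_trans (ler_rnormD _ _) _; apply: lerD; first by rewrite [K * 4 * b]mulrAC -[K * b * 4]mulrA.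
have h3' : rnorm (iter (N + N) T w) <= `|M| / N%:R * rnorm y.
  rewrite (le_trans h3)// ler_wpM2r ?rnorm_ge0// ler_wpM2l// lef_pV2 ?posrE ?ltr0n ?addn_gt0 ?N0//.
  by rewrite ler_nat leq_addr.
apply: le_trans (ler_rnormD _ _) _.
have := ler_rnormB (iter N T w) (iter (N + N) T w).
rewrite natrX in h2 h3'; move: h2 h3'.
have -> : `|M| / 2 ^+ n * rnorm y = `|M| * rnorm y / 2 ^+ n by rewrite mulrAC.
have -> : 3 * `|M| * rnorm y / 2 ^+ n = 3 * (`|M| * rnorm y / 2 ^+ n) by rewrite !mulrA.
lra.
Qed.

End PolynomialCalculus.

(** * Cotype and sums of rare variables *)

Section FiniteAverages.
Context (R : realType).

Definition avg (O : finType) (f : O -> R) : R := (#|O|%:R)^-1 * \sum_w f w.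

Lemma avg_le (O : finType) (f h : O -> R) : (forall w, f w <= h w) -> avg f <= avg h.
Proof. by move=> fh; rewrite ler_wpM2l ?invr_ge0// ler_sum. Qed.

Lemma avg_ge0 (O : finType) (f : O -> R) : (forall w, 0 <= f w) -> 0 <= avg f.
Proof. by move=> f0; rewrite mulr_ge0 ?invr_ge0// sumr_ge0. Qed.

(** The sign of c matters when O is empty: its averages are 0. *)
Lemma avg_le_cst (O : finType) (f : O -> R) c : 0 <= c -> (forall w, f w <= c) -> avg f <= c.
Proof.
move=> c0 fc; rewrite /avg mulrC; have [z0|z0] := posnP #|O|.
  by rewrite z0 invr0 mulr0.
rewrite ler_pdivrMr ?ltr0n// mulr_natr -sumr_const.
by apply: ler_sum.
Qed.

Lemma avg_reindex (O : finType) (t : O -> O) (f : O -> R) : injective t ->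
  avg (fun w => f (t w)) = avg f.
Proof. by move=> tI; rewrite /avg [in RHS](reindex_inj tI). Qed.

Lemma avgZ (O : finType) (f : O -> R) c : avg (fun w => c * f w) = c * avg f.
Proof. by rewrite /avg -mulr_sumr mulrCA. Qed.

Lemma avg_sum (O I : finType) (Q : pred I) (f : I -> O -> R) :
  avg (fun w => \sum_(i | Q i) f i w) = \sum_(i | Q i) avg (f i).
Proof. by rewrite /avg exchange_big mulr_sumr. Qed.

Lemma avgD (O : finType) (f h : O -> R) : avg (fun w => f w + h w) = avg f + avg h.
Proof. by rewrite /avg big_split mulrDr. Qed.

Lemma avg_exchange (O O' : finType) (f : O -> O' -> R) :
  avg (fun w => avg (f w)) = avg (fun w' => avg (f^~ w')).
Proof.
rewrite /avg -[in LHS]mulr_sumr -[in RHS]mulr_sumr exchange_big mulrCA.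
by [].
Qed.

(** Weighted Cauchy-Schwarz; with geometric weights it sums the layers in [cotype_tail_sum]. *)
Lemma sum_sqr_weighted (I : Type) (r : seq I) (b w : I -> R) : (forall i, 0 < w i) ->
  (\sum_(i <- r) b i) ^+ 2 <= (\sum_(i <- r) w i) * (\sum_(i <- r) b i ^+ 2 / w i).
Proof.
move=> w0; elim: r => [|i r IH]; first by rewrite !big_nil mul0r expr0n.
rewrite !big_cons; set S := \sum_(j <- r) b j in IH *; set W := \sum_(j <- r) w j in IH *.
set Q := \sum_(j <- r) _ / _ in IH *.
have W0 : 0 <= W by apply: sumr_ge0 => j _; exact: ltW.
have wi := w0 i.
have e : b i ^+ 2 / w i * w i = b i ^+ 2 by rewrite divfK// gt_eqF.
have Q0 : 0 <= Q by apply: sumr_ge0 => j _; rewrite divr_ge0 ?sqr_ge0// ltW.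
suff : 2 * (S * b i) <= W * (b i ^+ 2 / w i) + w i * Q by move: IH e; lra.
move: W0; rewrite le_eqVlt => /predU1P[W0|W0].
  have : S ^+ 2 <= 0 by rewrite (le_trans IH)// -W0 mul0r.
  rewrite le_eqVlt ltNge sqr_ge0 orbF sqrf_eq0 => /eqP ->.
  by rewrite mul0r mulr0 -W0 mul0r add0r mulr_ge0// ltW.
rewrite -(ler_pM2l W0) -(ler_pM2l wi).
have h1 : 0 <= (W * b i - w i * S) ^+ 2 by exact: sqr_ge0.
have h2 : w i ^+ 2 * S ^+ 2 <= w i ^+ 2 * (W * Q) by rewrite ler_wpM2l ?sqr_ge0.
have -> : w i * (W * (W * (b i ^+ 2 / w i) + w i * Q)) =
   W ^+ 2 * (b i ^+ 2 / w i * w i) + w i ^+ 2 * (W * Q) by ring.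
rewrite e; move: h1 h2; lra.
Qed.

Lemma sum_sqr_le (n : nat) (b : 'I_n -> R) :
  (\sum_(i < n) b i) ^+ 2 <= n%:R * \sum_(i < n) b i ^+ 2.
Proof.
have := @sum_sqr_weighted _ (index_enum 'I_n) b (fun=> 1) (fun=> ltr01).
rewrite [X in X * _]sumr_const card_ord; under [X in _ * X]eq_bigr do rewrite divr1.
by [].
Qed.

End FiniteAverages.

(** * Shifts that make a small set disjoint from itself *)

Section CyclicShifts.
Context (O : finType) (A : {set O}) (n : nat) (nA : (n * #|A| <= #|O|)%N).
Let s := enum A ++ enum (~: A).
Let M := #|O|.

Let s_uniq : uniq s.
Proof.
rewrite cat_uniq !enum_uniq andbT/=; apply/hasPn => x.
by rewrite !mem_enum inE.
Qed.

Let s_size : size s = M.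
Proof. by rewrite size_cat -!cardE cardsC. Qed.

Let s_mem x : x \in s.
Proof. by rewrite mem_cat !mem_enum inE orbN. Qed.

(** A is enumerated first, so its preimages under the shifts are consecutive cyclic intervals of
    length #|A|; n of them fit into O without overlap. *)
Definition cyclic_shift (c : nat) (x : O) : O := nth x s ((index x s + c * #|A|) %% M).

Let M_gt0 (x : O) : (0 < M)%N.
Proof. by apply/card_gt0P; exists x. Qed.

Lemma cyclic_shift_inj c : injective (cyclic_shift c).
Proof.
move=> x y; rewrite /cyclic_shift (set_nth_default x y) ?s_size ?ltn_pmod ?(M_gt0 x)//.
move=> /eqP; rewrite nth_uniq ?s_size ?ltn_pmod ?(M_gt0 x)// eqn_modDr !modn_small.
- by move=> /eqP e; rewrite -(nth_index x (s_mem x)) e nth_index.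
- by rewrite -s_size index_mem.
- by rewrite -s_size index_mem.
Qed.

Lemma cyclic_shift_disjoint c c' x : (c < n)%N -> (c' < n)%N ->
  cyclic_shift c x \in A -> cyclic_shift c' x \in A -> c = c'.
Proof.
have M0 := M_gt0 x.
have key k : cyclic_shift k x \in A -> ((index x s + k * #|A|) %% M < #|A|)%N.
  rewrite /cyclic_shift; set i := (_ %% M)%N; rewrite nth_cat -cardE; case: ltnP => // Ai.
  have iM : (i < M)%N by rewrite ltn_pmod.
  have : nth x (enum (~: A)) (i - #|A|) \in enum (~: A).
    by rewrite mem_nth// -cardE; have := cardsC A; rewrite -/M; lia.
  by rewrite mem_enum inE => /negbTE ->.
have arith k k' : (k < k')%N -> (k' < n)%N -> ((index x s + k * #|A|) %% M < #|A|)%N ->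
    ((index x s + k' * #|A|) %% M < #|A|)%N -> False.
  have nA' : (n * #|A| <= M)%N := nA.
  set i := index x s; set a := #|A| in nA' *.
  have := divn_eq (i + k * a) M; have := divn_eq (i + k' * a) M.
  set q := ((i + k * a) %/ M)%N; set q' := ((i + k' * a) %/ M)%N.
  set r := ((i + k * a) %% M)%N; set r' := ((i + k' * a) %% M)%N.
  move=> e' e kk' kn ra r'a.
  have h1 : ((k.+1) * a <= k' * a)%N by rewrite leq_mul2r kk' orbT.
  have h2 : ((k'.+1) * a <= n * a)%N by rewrite leq_mul2r kn orbT.
  rewrite !mulSn in h1 h2.
  have [qq|qq] := leqP q' q.
    have h3 : (q' * M <= q * M)%N by rewrite leq_mul2r qq orbT.
    by move: e e' h1 h2 h3 ra r'a; move: (k * a)%N (k' * a)%N (q * M)%N (q' * M)%N; lia.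
  have h3 : (q.+1 * M <= q' * M)%N by rewrite leq_mul2r qq orbT.
  rewrite mulSn in h3.
  move: e e' h1 h2 h3 ra r'a nA'.
  by move: (k * a)%N (k' * a)%N (q * M)%N (q' * M)%N (n * a)%N; lia.
move=> cn c'n /key h /key h'; case: (ltngtP c c') => // cc'.
  by case: (arith c c').
by case: (arith c' c).
Qed.

End CyclicShifts.

Section SignedSums.
Context (R : realType) (X : completeNormedModType R[i]).
Implicit Types (x y : nat -> X).

Definition sgn (b : bool) : R := if b then -1 else 1.

Lemma sgn_norm b : `|sgn b| = 1.
Proof. by case: b; rewrite ?normrN1 ?normr1. Qed.

Definition signed_sum n x (s : {ffun 'I_n -> bool}) : X :=
  \sum_(k < n) (sgn (s k))%:C *: x k.

(** The squared norm in Rad(X) of a finite sum, free of the probability space; [moment2_rademacher]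
    links the two. *)
Definition radsq n x : R := avg (fun s : {ffun 'I_n -> bool} => rnorm (signed_sum x s) ^+ 2).

Lemma radsq_ge0 n x : 0 <= radsq n x.
Proof. by apply: avg_ge0 => s; rewrite sqr_ge0. Qed.

(* Finite cotype, as used: [rho = 2^(-2/q)] when X has cotype q. *)
Definition dyadic_cotype (C rho : R) : Prop := forall t y,
  \sum_(c < 2 ^ t) rnorm (y c) ^+ 2 <= C * 2 ^+ t * rho ^+ t * radsq (2 ^ t) y.

End SignedSums.

Section CotypeShift.
Context (R : realType) (X : completeNormedModType R[i]) (C rho : R).
Hypotheses (C_ge0 : 0 <= C) (rho_ge0 : 0 <= rho) (cot : dyadic_cotype X C rho).

(* The [2^t] shifted copies of the sum are identically distributed, and a signed
   combination of them has coefficients bounded by 1 since the shifted supports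
   are disjoint: cotype improves the trivial bound [K^2]. *)
Lemma cotype_rare_sum (t J : nat) (O : finType) (zeta : 'I_J -> O -> R) (y : 'I_J -> X) (K : R) :
  (forall j w, `|zeta j w| <= 1) ->
  (forall j, (2 ^ t * #|[set w | (zeta j w != 0)%R]%SET| <= #|O|)%N) ->
  0 <= K ->
  (forall a : 'I_J -> R, (forall j, `|a j| <= 1) -> rnorm (\sum_j (a j)%:C *: y j) <= K) ->
  avg (fun w : {ffun 'I_J -> O} => rnorm (\sum_j (zeta j (w j))%:C *: y j) ^+ 2)
    <= C * rho ^+ t * K ^+ 2.
Proof.
move=> z1 zn K0 hK; pose n := (2 ^ t)%N.
pose A j := [set w | zeta j w != 0]%SET.
pose sh c (w : {ffun 'I_J -> O}) : {ffun 'I_J -> O} := [ffun j => cyclic_shift (A j) c (w j)].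
have shI c : injective (sh c).
  move=> w w' /ffunP e; apply/ffunP => j; have := e j; rewrite !ffunE.
  exact: cyclic_shift_inj.
pose Y (w : {ffun 'I_J -> O}) := \sum_j (zeta j (w j))%:C *: y j.
have p0 : 0 < 2 ^+ t :> R by rewrite exprn_gt0.
rewrite -(ler_pM2l p0).
have -> : 2 ^+ t * avg (fun w => rnorm (Y w) ^+ 2) =
    avg (fun w => \sum_(c < n) rnorm (Y (sh c w)) ^+ 2).
  rewrite avg_sum; under eq_bigr do rewrite (avg_reindex (fun w => rnorm (Y w) ^+ 2) (shI _)).
  by rewrite sumr_const card_ord -[_ *+ n]mulr_natl /n natrX.
apply: avg_le_cst => [|w].
  by rewrite mulr_ge0 ?exprn_ge0// !mulr_ge0 ?exprn_ge0.
apply: le_trans (cot t (fun c => Y (sh c w))) _.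
have -> : 2 ^+ t * (C * rho ^+ t * K ^+ 2) = C * 2 ^+ t * rho ^+ t * K ^+ 2 by ring.
apply: ler_wpM2l; first by rewrite !mulr_ge0 ?exprn_ge0.
apply: avg_le_cst => [|s]; first exact: sqr_ge0.
apply: lerXn2r; rewrite ?nnegrE ?rnorm_ge0//.
have -> : signed_sum (fun c => Y (sh c w)) s =
    \sum_j (\sum_(c < n) sgn R (s c) * zeta j (sh c w j))%:C *: y j.
  rewrite /signed_sum /Y; under eq_bigr do rewrite scaler_sumr.
  rewrite exchange_big; apply: eq_bigr => j _.
  rewrite rmorph_sum scaler_suml; apply: eq_bigr => c _.
  by rewrite rmorphM scalerA.
apply: hK => j.
have [c0|hc] := pickP (fun c : 'I_n => zeta j (sh c w j) != 0); last first.
  by rewrite big1 ?normr0// => c _; have /negbFE/eqP -> := hc c; rewrite mulr0.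
move=> h0; rewrite (bigD1 c0)//= big1 ?addr0 => [|c cc0].
  by rewrite normrM sgn_norm mul1r.
apply/eqP; rewrite mulf_eq0; apply/orP; right; apply/negPn/negP => hc; case/negP: cc0.
apply/eqP/val_inj.
apply: (cyclic_shift_disjoint (zn j) (x := w j)); rewrite ?ltn_ord//.
  by move: hc; rewrite ffunE inE.
by move: h0; rewrite ffunE inE.
Qed.

(** The part of x between the levels t and t + 1, with the sign of x. *)
Definition clip (t : nat) (x : R) : R :=
  Num.sg x * (Num.min `|x| t.+1%:R - Num.min `|x| t%:R).

Lemma clip_le1 t x : `|clip t x| <= 1.
Proof.
rewrite normrM -[leRHS]mulr1 ler_pM//; first by rewrite normr_sg; case: (x != 0).
rewrite ler_norml; apply/andP; split; rewrite /Num.min -!natr1; case: ltP => ?; case: ltP => ?; lra.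
Qed.

Lemma clip_eq0 t x : `|x| <= t%:R -> clip t x = 0.
Proof.
move=> h; have h' : `|x| <= t.+1%:R by rewrite (le_trans h)// ler_nat.
by rewrite /clip !min_l// subrr mulr0.
Qed.

Lemma sum_clip n x : `|x| <= n%:R -> \sum_(t < n) clip t x = x.
Proof.
move=> h; rewrite -mulr_sumr -(big_mkord xpredT (fun t => Num.min `|x| t.+1%:R - Num.min `|x| t%:R)).
rewrite (telescope_sumr (fun t => Num.min `|x| t%:R))//.
by rewrite min_l// min_r ?normr_ge0// subr0 mulr_sg_norm.
Qed.

Lemma geometric_sum_le (l : R) n : 0 <= l < 1 -> \sum_(t < n) l ^+ t <= (1 - l)^-1.
Proof.
move=> /andP[l0 l1]; have h : 0 < 1 - l by rewrite subr_gt0.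
rewrite -(ler_pM2l h) mulfV ?gt_eqF//.
have -> : (1 - l) * \sum_(t < n) l ^+ t = 1 - l ^+ n.
  by rewrite -[RHS]opprB subrX1 -mulNr opprB.
by rewrite gerBl exprn_ge0.
Qed.

(** The layer t lives where |eta_j| > t, a set of probability at most 8 / 2^t, so [cotype_rare_sum]
    applies to it with the exponent t - 3. *)
Lemma cotype_tail_sum : 0 < rho < 1 -> exists2 C' : R, 0 <= C' &
  forall (J : nat) (O : finType) (eta : 'I_J -> O -> R) (y : 'I_J -> X) (K : R),
  (forall j (t : nat), (2 ^ t * #|[set w | (t%:R < `|eta j w|)%R]%SET| <= 8 * #|O|)%N) ->
  0 <= K ->
  (forall a : 'I_J -> R, (forall j, `|a j| <= 1) -> rnorm (\sum_j (a j)%:C *: y j) <= K) ->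
  avg (fun w : {ffun 'I_J -> O} => rnorm (\sum_j (eta j (w j))%:C *: y j) ^+ 2) <= C' * K ^+ 2.
Proof.
(* With the weights l^t, the weights and the quotients rho^t / l^t = l^t are both summable. *)
move=> /andP[r0 r1]; pose l := Num.sqrt rho.
have l0 : 0 < l by rewrite sqrtr_gt0.
have l1 : l < 1 by rewrite -sqrtr1 ltr_sqrt.
have ll : l ^+ 2 = rho by rewrite sqr_sqrtr// ltW.
have li : 0 <= (1 - l)^-1 by rewrite invr_ge0 subr_ge0 ltW.
have ri : 0 <= (rho ^+ 3)^-1 by rewrite invr_ge0 exprn_ge0// ltW.
exists ((1 - l)^-1 * (C * (rho ^+ 3)^-1 * (1 - l)^-1)); first by rewrite !mulr_ge0.
move=> J O eta y K tail K0 hK.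
pose n := (\max_j \max_w (Num.truncn `|eta j w|).+1)%N.
have etan j w : `|eta j w| <= n%:R.
  rewrite (le_trans (ltW (truncnS_gt _)))// ler_nat /n.
  by rewrite (leq_trans _ (leq_bigmax j))// (leq_trans _ (leq_bigmax w)).
pose Z t (w : {ffun 'I_J -> O}) := \sum_j (clip t (eta j (w j)))%:C *: y j.
have ZE (w : {ffun 'I_J -> O}) : \sum_j (eta j (w j))%:C *: y j = \sum_(t < n) Z t w.
  rewrite exchange_big; apply: eq_bigr => j _; rewrite -scaler_suml -rmorph_sum.
  by congr (_%:C *: _); rewrite sum_clip.
have Zt t : avg (fun w => rnorm (Z t w) ^+ 2) <= C * (rho ^+ 3)^-1 * rho ^+ t * K ^+ 2.
  (* The subtraction is truncated: for t <= 3 the claim is trivial, and the factor rho^-3 makes up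
     for the missing gain. *)
  have h : forall j, (2 ^ (t - 3) * #|[set w | (clip t (eta j w) != 0)%R]%SET| <= #|O|)%N.
    move=> j; have [t3|t3] := leqP t 3.
      by move: (t3); rewrite -subn_eq0 => /eqP ->; rewrite mul1n max_card.
    have sub : (#|[set w | (clip t (eta j w) != 0)%R]%SET| <= #|[set w | (t%:R < `|eta j w|)%R]%SET|)%N.
      apply: subset_leq_card; apply/fintype.subsetP => w; rewrite !inE; apply: contraNT.
      by rewrite -leNgt => /clip_eq0 ->.
    rewrite -(leq_pmul2l (isT : 0 < 8)%N) (leq_trans _ (tail j t))// mulnA.
    have -> : (8 * 2 ^ (t - 3) = 2 ^ t)%N by rewrite -(expnD 2 3) subnKC// ltnW.
    by rewrite leq_mul2l sub orbT.
  have := @cotype_rare_sum (t - 3) J O (fun j w => clip t (eta j w)) y K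
     (fun j w => clip_le1 _ _) h K0 hK.
  move=> /le_trans; apply; apply: ler_wpM2r; first exact: sqr_ge0.
  rewrite -mulrA ler_wpM2l// ler_pdivlMl ?exprn_gt0// -exprD.
  have [t3|t3] := leqP t 3; last by rewrite subnKC// ltnW.
  rewrite (_ : (t - 3 = 0)%N) ?addn0; last by apply/eqP; rewrite subn_eq0.
  by apply: ler_wiXn2l => //; apply: ltW.
apply: (@le_trans _ _ (avg (fun w => (1 - l)^-1 * \sum_(t < n) (rnorm (Z t w) ^+ 2 / l ^+ t)))).
  apply: avg_le => w; rewrite ZE.
  have h : rnorm (\sum_(t < n) Z t w) ^+ 2 <= (\sum_(t < n) rnorm (Z t w)) ^+ 2.
    apply: lerXn2r; rewrite ?nnegrE ?rnorm_ge0 ?sumr_ge0//.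
      by move=> t _; exact: rnorm_ge0.
    exact: ler_rnorm_sum.
  apply: (le_trans h).
  apply: le_trans (@sum_sqr_weighted R _ (index_enum 'I_n) (fun t => rnorm (Z t w)) (fun t => l ^+ t) _) _.
    by move=> t; rewrite exprn_gt0.
  apply: ler_wpM2r; last by rewrite geometric_sum_le// l1 andbT ltW.
  by apply: sumr_ge0 => t _; rewrite divr_ge0 ?sqr_ge0// exprn_ge0// ltW.
rewrite avgZ avg_sum -[leRHS]mulrA ler_wpM2l//.
apply: (@le_trans _ _ (\sum_(t < n) (C * (rho ^+ 3)^-1 * K ^+ 2) * l ^+ t)).
  apply: ler_sum => t _.
  have -> : avg (fun w => rnorm (Z t w) ^+ 2 / l ^+ t) = (l ^+ t)^-1 * avg (fun w => rnorm (Z t w) ^+ 2).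
    by rewrite -avgZ; congr avg; apply/funext => w; rewrite mulrC.
  rewrite ler_pdivrMl ?exprn_gt0// (le_trans (Zt t))//.
  rewrite -ll -exprM mulnC exprM expr2 exprMn.
  by rewrite le_eqVlt; apply/orP; left; apply/eqP; ring.
rewrite -mulr_sumr [leRHS]mulrAC; apply: ler_wpM2l; first by rewrite !mulr_ge0 ?sqr_ge0.
by rewrite geometric_sum_le// l1 andbT ltW.
Qed.

End CotypeShift.

(** * Exponential tails of Rademacher sums *)

Section Subgaussian.
Context (R : realType).

(** From exp(-a/2) >= 1 - a/2, (1 - a/2)^2 exp a <= 1; and (1 - a/2)^2 (1 + a + a^2) - 1 = a^2 (1 -
    3 a + a^2) / 4 >= 0. *)
Lemma expR_le_quadratic (a : R) : `|a| <= 3^-1 -> expR a <= 1 + a + a ^+ 2.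
Proof.
rewrite ler_norml => /andP[a1 a2].
have h := expR_ge1Dx (- (a / 2)).
have d0 : 0 < 1 - a / 2 by lra.
have h1 : (1 - a / 2) ^+ 2 * expR a <= 1.
  have e : expR (- (a / 2)) ^+ 2 * expR a = 1.
    by rewrite -expRM_natl -expRD -[RHS]expR0; congr expR; lra.
  rewrite -[leRHS]e ler_wpM2r ?expR_ge0//.
  by apply: lerXn2r; rewrite ?nnegrE ?expR_ge0// ltW.
rewrite -(ler_pM2l (_ : 0 < (1 - a / 2) ^+ 2)) ?exprn_gt0// (le_trans h1)//.
have : 0 <= a ^+ 2 * (1 - 3 * a + a ^+ 2).
  by rewrite mulr_ge0 ?sqr_ge0//; have := sqr_ge0 a; lra.
lra.
Qed.

Lemma expR_cosh_le (a : R) : `|a| <= 3^-1 -> expR a + expR (- a) <= 2 * expR (a ^+ 2).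
Proof.
move=> ha; have h1 := expR_le_quadratic ha.
have h2 : expR (- a) <= 1 + - a + (- a) ^+ 2 by apply: expR_le_quadratic; rewrite normrN.
have h3 := expR_ge1Dx (a ^+ 2); rewrite sqrrN in h2; lra.
Qed.

Lemma expR_sum_prod (I : Type) (r : seq I) (f : I -> R) :
  expR (\sum_(i <- r) f i) = \prod_(i <- r) expR (f i).
Proof. by apply: (big_morph expR (@expRD R) (@expR0 R)). Qed.

Lemma exp_moment (N : nat) (a : 'I_N -> R) : (forall k, `|a k| <= 3^-1) ->
  \sum_(w : {ffun 'I_N -> bool}) expR (\sum_k a k * sgn R (w k))
    <= 2 ^+ N * expR (\sum_k a k ^+ 2).
Proof.
move=> ha; under eq_bigr do rewrite expR_sum_prod.
rewrite -(bigA_distr_bigA (fun k b => expR (a k * sgn R b))) expR_sum_prod.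
have -> : 2 ^+ N = \prod_(k < N) 2 :> R by rewrite prodr_const card_ord.
rewrite -big_split/=; apply: ler_prod => k _.
rewrite big_bool /= mulr1 mulrN1 addrC addr_ge0 ?expR_ge0//=.
exact: expR_cosh_le.
Qed.

(** Markov's inequality for exp eta + exp (- eta). The bound 1/9 forces |a_k| <= 1/3, as
    [expR_le_quadratic] wants, and makes each moment at most 2 times 2^N; finally 2^t <= exp t. *)
Lemma rademacher_tail (N : nat) (a : 'I_N -> R) (t : nat) : \sum_k a k ^+ 2 <= 9^-1 ->
  (2 ^ t * #|[set w : {ffun 'I_N -> bool} | (t%:R < `|\sum_k a k * sgn R (w k)|)%R]%SET|
    <= 8 * #|{ffun 'I_N -> bool}|)%N.
Proof.
move=> ha; pose eta (w : {ffun 'I_N -> bool}) : R := \sum_k a k * sgn R (w k).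
have hk k : `|a k| <= 3^-1.
  have h : a k ^+ 2 <= 3^-1 ^+ 2.
    rewrite exprVn -natrX (le_trans _ ha)// (bigD1 k)//= lerDl.
    by apply: sumr_ge0 => i _; rewrite sqr_ge0.
  by rewrite -(@ler_pXn2r _ 2) ?nnegrE// real_normK ?num_real.
set A := [set _ | _]%SET.
have cardO : #|{ffun 'I_N -> bool}|%:R = 2 ^+ N :> R.
  by rewrite card_ffun card_bool card_ord natrX.
have m1 := exp_moment hk.
have m2 : \sum_(w : {ffun 'I_N -> bool}) expR (- eta w) <= 2 ^+ N * expR (\sum_k a k ^+ 2).
  have hk' k : `|- a k| <= 3^-1 by rewrite normrN.
  have := exp_moment hk'; congr (_ <= _).
    by apply: eq_bigr => w _; rewrite /eta -sumrN; congr expR; apply: eq_bigr => k _; rewrite mulNr.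
  by congr (_ * expR _); apply: eq_bigr => k _; rewrite sqrrN.
set S := \sum_k a k ^+ 2 in ha m1 m2.
have S0 : 0 <= S by apply: sumr_ge0 => i _; rewrite sqr_ge0.
have eS : expR S <= 2.
  have h : `|S| <= 3^-1 by rewrite ger0_norm// (le_trans ha)// lef_pV2 ?posrE// ler_nat.
  rewrite (le_trans (expR_le_quadratic h))//.
  have S1 : S ^+ 2 <= 9^-1 * 9^-1 by rewrite expr2 ler_pM.
  lra.
have e2 : 2 <= expR 1 :> R by have := expR_ge1Dx (1 : R); lra.
have et : 2 ^+ t <= expR t%:R :> R.
  rewrite -[t%:R]mulr1 expRM_natl; apply: lerXn2r; rewrite ?nnegrE ?expR_ge0//.
have mk : #|A|%:R * expR t%:R <= \sum_(w : {ffun 'I_N -> bool}) (expR (eta w) + expR (- eta w)).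
  rewrite mulr_natl -sumr_const big_mkcond/=; apply: ler_sum => w _.
  case: ifP => [|_]; last by rewrite addr_ge0 ?expR_ge0.
  rewrite inE => tw; have [e0|e0] := leP 0 (eta w).
    rewrite ger0_norm// in tw; rewrite (@le_trans _ _ (expR (eta w)))//; last by rewrite lerDl expR_ge0.
    by rewrite ler_expR ltW.
  rewrite ltr0_norm// in tw; rewrite (@le_trans _ _ (expR (- eta w)))//; last by rewrite lerDr expR_ge0.
  by rewrite ler_expR ltW.
rewrite big_split/= in mk.
rewrite -(ler_nat R) !natrM natrX cardO.
have : 2 ^+ N * expR S <= 2 ^+ N * 2 by rewrite ler_wpM2l ?exprn_ge0.
have := ler_wpM2l (ler0n R #|A|) et.
have : 0 <= 2 ^+ N :> R by rewrite exprn_ge0.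
rewrite [2 ^+ t * _]mulrC.
move: m1 m2 mk; rewrite -/eta.
set s1 := \sum_(w : {ffun 'I_N -> bool}) expR (eta w); set s2 := \sum_w expR (- eta w).
move: (2 ^+ N) (_ * 2 ^+ t) (expR S) (_ * expR t%:R) s1 s2 => p q u v s1 s2; lra.
Qed.

(* Signs taken from independent copies, one for each block, are again independent. *)
Lemma avg_diagonal (J N : nat) (jk : 'I_N -> 'I_J) (F : {ffun 'I_N -> bool} -> R) :
  avg F = avg (fun w : {ffun 'I_J -> {ffun 'I_N -> bool}} => F [ffun k => w (jk k) k]).
Proof.
pose flip (u s : {ffun 'I_N -> bool}) : {ffun 'I_N -> bool} := [ffun k => u k (+) s k].
have flipI s : injective (flip s).
  move=> u v /ffunP e; apply/ffunP => k; have := e k; rewrite !ffunE.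
  by move: (s k) (u k) (v k) => [] [] [].
pose flips s (w : {ffun 'I_J -> {ffun 'I_N -> bool}}) := [ffun j => flip s (w j)].
have flipsI s : injective (flips s).
  by move=> u v /ffunP e; apply/ffunP => j; have := e j; rewrite !ffunE; exact: flipI.
pose D (w : {ffun 'I_J -> {ffun 'I_N -> bool}}) : {ffun 'I_N -> bool} := [ffun k => w (jk k) k].
have DE s w : D (flips s w) = flip (D w) s.
  by apply/ffunP => k; rewrite !ffunE addbC.
have avg_cst (O : finType) (c : R) : (0 < #|O|)%N -> avg (fun _ : O => c) = c.
  move=> h; rewrite /avg sumr_const -[c *+ _]mulr_natl mulKf// pnatr_eq0.
  by rewrite -lt0n.
have card0 : (0 < #|{ffun 'I_N -> bool}|)%N by apply/card_gt0P; exists [ffun=> true].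
have card1 : (0 < #|{ffun 'I_J -> {ffun 'I_N -> bool}}|)%N.
  by apply/card_gt0P; exists [ffun=> [ffun=> true]].
(* An additional random flip s: for fixed w it makes D w uniform, and for fixed s it only permutes
   the families w. *)
transitivity (avg (fun w => avg (fun s => F (flip (D w) s)))).
  under [in RHS]eq_fun do rewrite (avg_reindex F (flipI _)).
  by rewrite avg_cst.
rewrite avg_exchange -[RHS](avg_cst {ffun 'I_N -> bool} _ card0).
congr avg; apply/funext => s.
rewrite -(avg_reindex (fun w => F (D w)) (flipsI s)).
by congr avg; apply/funext => w; rewrite DE.
Qed.

End Subgaussian.

Section SubgaussianSum.
Context (R : realType) (X : completeNormedModType R[i]) (C rho : R).
Hypotheses (C_ge0 : 0 <= C) (rho01 : 0 < rho < 1) (cot : dyadic_cotype X C rho).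

(** The blocks use disjoint sets of signs, so [avg_diagonal] turns the coefficients into functions
    of separate coordinates. Moving a factor 3 from the coefficients to the vectors brings the
    variances down to 1/9; this is the 9 of the constant. *)
Lemma subgaussian_sum : exists2 C' : R, 0 <= C' &
  forall (J N : nat) (jk : 'I_N -> 'I_J) (a : 'I_J -> 'I_N -> R) (y : 'I_J -> X) (K : R),
  (forall j, \sum_k a j k ^+ 2 <= 1) ->
  (forall j k, jk k != j -> a j k = 0) -> 0 <= K ->
  (forall b : 'I_J -> R, (forall j, `|b j| <= 1) -> rnorm (\sum_j (b j)%:C *: y j) <= K) ->
  avg (fun s : {ffun 'I_N -> bool} =>
    rnorm (\sum_j (\sum_k a j k * sgn R (s k))%:C *: y j) ^+ 2) <= C' * K ^+ 2.
Proof.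
have rho0 : 0 <= rho by case/andP: rho01 => /ltW.
have [C' C'0 h] := cotype_tail_sum C_ge0 rho0 cot rho01.
exists (C' * 9); first by rewrite mulr_ge0.
move=> J N jk a y K ha a0 K0 hK.
rewrite (avg_diagonal jk).
pose eta j (w : {ffun 'I_N -> bool}) : R := \sum_k (a j k / 3) * sgn R (w k).
have := h J {ffun 'I_N -> bool} eta (fun j => 3%:C *: y j) (3 * K) _ _ _.
have -> : C' * 9 * K ^+ 2 = C' * (3 * K) ^+ 2 by ring.
move=> H; apply: le_trans (H _ _ _).
- rewrite le_eqVlt; apply/orP; left; apply/eqP; congr avg; apply/funext => w.
  congr (rnorm _ ^+ 2); apply: eq_bigr => j _; rewrite scalerA -rmorphM; congr (_%:C *: _).
  rewrite /eta mulr_suml; apply: eq_bigr => k _; rewrite ffunE.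
  have [->|kj] := eqVneq (jk k) j; first by field.
  by rewrite a0// !mul0r.
- move=> j t; apply: rademacher_tail.
  under eq_bigr do rewrite exprMn; rewrite -mulr_suml exprVn -natrX.
  by rewrite ler_piMl.
- by rewrite mulr_ge0.
- move=> b hb; under eq_bigr do rewrite scalerA -rmorphM mulrC rmorphM -scalerA.
  rewrite -scaler_sumr rnormRZ ger0_norm// ler_wpM2l//.
  exact: hK.
Qed.

End SubgaussianSum.

(** * The square function of finite sums *)

Section DyadicPolynomials.
Context (R : realType).

(** The first p + 2 terms are bounded one by one. For j = p + 2 + i and n = 2^i, the exponent 2^j -
    1 is at least 2 n p, so the term is at most a constant times the p-th power of n (1 - u) u^(2n),
    hence of d n <= 1, and the d (2^i) telescope. *)
Lemma dyadic_weight_le (p : nat) : (0 < p)%N -> exists2 B : R, 0 <= B &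
  forall (J : nat) (u : R), 0 <= u <= 1 ->
  \sum_(j < J) (2 ^ j)%:R ^+ p * u ^+ (2 ^ j - 1) * (1 - u) ^+ p <= B.
Proof.
move=> p0; pose P := (p.+1)%N.
have Pp : (2 * p <= 2 ^ P)%N by rewrite /P expnS leq_mul2l ltnW// ltn_expl.
pose c := (2 ^ P.+1)%:R ^+ p : R.
exists (\sum_(j < P.+1) (2 ^ j)%:R ^+ p + c) => [|J u /andP[u0 u1]].
  by rewrite addr_ge0 ?exprn_ge0// sumr_ge0// => j _; rewrite exprn_ge0.
have v0 : 0 <= 1 - u by rewrite subr_ge0.
have v1 : 1 - u <= 1 by rewrite gerBl.
pose f j := (2 ^ j)%:R ^+ p * u ^+ (2 ^ j - 1) * (1 - u) ^+ p : R.
have f0 j : 0 <= f j by rewrite !mulr_ge0 ?exprn_ge0.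
have f1 j : f j <= (2 ^ j)%:R ^+ p.
  rewrite /f -mulrA ler_piMr ?exprn_ge0// mulr_ile1 ?exprn_ge0//; exact: exprn_ile1.
pose d n := u ^+ n - u ^+ (2 * n) : R.
have d0 n : 0 <= d n by rewrite /d subr_ge0 mul2n -addnn exprD ler_piMl ?exprn_ge0// exprn_ile1.
have d1 n : d n <= 1 by rewrite /d (@le_trans _ _ (u ^+ n)) ?gerBl ?exprn_ge0// exprn_ile1.
have key n : n%:R * (1 - u) * u ^+ (2 * n) <= d n.
  (* [n (1 - u) u^(2n) <= u^n - u^(2n)], which telescopes along [n = 2^j]. *)
  have g : (1 - u) * \sum_(i < n) u ^+ i = 1 - u ^+ n by rewrite -[RHS]opprB subrX1 -mulNr opprB.
  have e : d n = u ^+ n * ((1 - u) * \sum_(i < n) u ^+ i).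
    by rewrite g mulrBr mulr1 /d mul2n -addnn exprD.
  rewrite e mul2n -addnn exprD.
  have -> : n%:R * (1 - u) * (u ^+ n * u ^+ n) = u ^+ n * ((1 - u) * (n%:R * u ^+ n)).
    by move: (u ^+ n) (n%:R : R) => y k; ring.
  rewrite ler_wpM2l ?exprn_ge0// ler_wpM2l//.
  have -> : n%:R * u ^+ n = \sum_(i < n) u ^+ n by rewrite sumr_const card_ord mulr_natl.
  by apply: ler_sum => i _; rewrite ler_wiXn2l// ltnW.
have fP i : f (P.+1 + i)%N <= c * d (2 ^ i)%N.
  have e : (2 ^ (P.+1 + i) = 2 ^ P.+1 * 2 ^ i)%N by rewrite expnD.
  have h : (p * (2 * 2 ^ i) <= 2 ^ (P.+1 + i) - 1)%N.
    rewrite e expnS; have := Pp; have : (0 < 2 ^ i)%N by rewrite expn_gt0.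
    move: (2 ^ i)%N (2 ^ P)%N => x y x0 py.
    have : (2 * p * x <= y * x)%N by rewrite leq_mul2r py orbT.
    have : (0 < y * x)%N by rewrite muln_gt0 x0 andbT; lia.
    lia.
  apply: (@le_trans _ _ (c * (((2 ^ i)%:R * (1 - u) * u ^+ (2 * 2 ^ i)) ^+ p))).
    have -> : ((2 ^ i)%:R * (1 - u) * u ^+ (2 * 2 ^ i)) ^+ p =
        (2 ^ i)%:R ^+ p * (u ^+ (2 * 2 ^ i * p) * (1 - u) ^+ p).
      by rewrite !exprMn -exprM mulrAC mulrA.
    rewrite /f e natrM exprMn -/c -[c * _ * _]mulrA -[c * _ * _]mulrA.
    apply: ler_wpM2l; first by rewrite exprn_ge0.
    rewrite -mulrA; apply: ler_wpM2l; first by rewrite exprn_ge0.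
    apply: ler_wpM2r; first by rewrite exprn_ge0.
    by rewrite -e mulnC ler_wiXn2l.
  rewrite ler_wpM2l ?exprn_ge0//.
  apply: (@le_trans _ _ (d (2 ^ i)%N ^+ p)).
    by apply: lerXn2r; rewrite ?nnegrE ?key ?d0// !mulr_ge0 ?exprn_ge0.
  by rewrite -(prednK p0) exprS ler_piMr ?d0// exprn_ile1 ?d0.
apply: (@le_trans _ _ (\sum_(j < P.+1 + J) f j)).
  rewrite -!(big_mkord xpredT f) (big_cat_nat (leq0n J) (leq_addl P.+1 J))/= lerDl.
  by apply: sumr_ge0.
rewrite big_split_ord/= lerD//; first by apply: ler_sum.
apply: (@le_trans _ _ (\sum_(i < J) c * d (2 ^ i)%N)); first by apply: ler_sum.
rewrite -mulr_sumr ler_piMr ?exprn_ge0//.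
have -> : \sum_(i < J) d (2 ^ i)%N = \sum_(i < J) - (u ^+ (2 ^ i.+1) - u ^+ (2 ^ i)).
  by apply: eq_bigr => i _; rewrite /d expnS opprB.
rewrite sumrN -(big_mkord xpredT (fun i => u ^+ (2 ^ i.+1) - u ^+ (2 ^ i))).
rewrite (telescope_sumr (fun i => u ^+ (2 ^ i)))// opprB expn0 expr1.
by rewrite (le_trans _ u1)// gerBl exprn_ge0.
Qed.

End DyadicPolynomials.

(** Block j holds the exponents k with 2^j <= k + 1 < 2^(j+1); r is the offset of k in it. *)
Lemma dyadic_block (k : nat) : let j := trunc_log 2 k.+1 in let r := (k.+1 - 2 ^ j)%N in
  [/\ (j <= k)%N, (k.+1 <= 2 ^ j.+1)%N, (r <= 2 ^ j)%N & k = (2 ^ j - 1 + r)%N].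
Proof.
move=> j r; have /andP[h1 h2] := @trunc_log_bounds 2 k.+1 isT isT.
have h3 := ltn_expl j (isT : 1 < 2)%N; have h4 : (0 < 2 ^ j)%N by rewrite expn_gt0.
rewrite -/j in h1 h2; rewrite /r expnS; move: h1 h2 h3 h4; rewrite expnS.
clear r; move: (2 ^ j)%N; clearbody j => p h1 h2 h3 h4; split; lia.
Qed.

Section FiniteSquareFunction.
Context (R : realType) (X : completeNormedModType R[i]) (T : X -> X) (gamma : R).
Hypotheses (hgamma : 0 < gamma < pi / 2) (hcalc : bounded_Hinfty_calculus gamma T).
Let E x := x - T x.

Let T_linear : linear T.
Proof. by case: hcalc => alpha [[[[]]]]. Qed.

(** On the domain |z| <= 1 and |1 - z| <= C (1 - |z|), so [dyadic_weight_le] with u = |z| bounds the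
    polynomial. Larger exponents e j only help; this freedom is needed for the vectors inside a
    block. *)
Lemma unconditional_blocks (p : nat) : (0 < p)%N -> exists2 K : R, 0 <= K &
  forall (J : nat) (e : 'I_J -> nat) (a : 'I_J -> R) (x : X),
  (forall j : 'I_J, (2 ^ j - 1 <= e j)%N) -> (forall j, `|a j| <= 1) ->
  rnorm (\sum_j (a j)%:C *: ((2 ^ j)%:R ^+ p *: iter (e j) T (iter p E x))) <= K * rnorm x.
Proof.
move=> p0; have [K K0 hK] := poly_bound1 hgamma hcalc.
have [C C0 hC] := stolz_nontangential hgamma.
have [B B0 hB] := dyadic_weight_le R p0.
exists (K * (C ^+ p * B)) => [|J e a x he ha].
  by rewrite !mulr_ge0 ?exprn_ge0// ltW.
pose s : {poly R[i]} := \sum_j ((a j)%:C * (2 ^ j)%:R ^+ p) *: 'X^(e j).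
pose q := s * (1 - 'X) ^+ p.-1.
have qE : q * (1 - 'X) = s * (1 - 'X) ^+ p by rewrite /q -mulrA -exprSr prednK.
have -> : \sum_j (a j)%:C *: ((2 ^ j)%:R ^+ p *: iter (e j) T (iter p E x)) =
    opoly T (q * (1 - 'X)) x.
  rewrite qE (opolyM T_linear).
  have -> : opoly T ((1 - 'X) ^+ p) x = iter p E x.
    elim: p {p0 hB s q qE} => [|n IH]; first by rewrite expr0 opoly1.
    by rewrite exprS (opolyM T_linear) IH opolyB opoly1 opolyX.
  have add y (I : seq 'I_J) : opoly T (\sum_(j <- I) ((a j)%:C * (2 ^ j)%:R ^+ p) *: 'X^(e j)) y =
      \sum_(j <- I) ((a j)%:C * (2 ^ j)%:R ^+ p) *: iter (e j) T y.
    elim: I => [|j I IH]; first by rewrite !big_nil opoly0.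
    by rewrite !big_cons opolyD IH opolyZ opolyXn.
  by rewrite add; apply: eq_bigr => j _; rewrite scalerA.
apply: hK => [|z sz]; first by rewrite mulr_ge0 ?exprn_ge0.
have z1 := stolz_le1 sz; have zC := hC z sz.
rewrite qE hornerM horner_exp hornerD hornerN hornerX hornerC horner_sum rnormM rnormX.
have z01 : 0 <= rnorm z <= 1 by rewrite rnorm_ge0.
have c1 : rnorm (1 - z) ^+ p <= C ^+ p * (1 - rnorm z) ^+ p.
  rewrite -exprMn; apply: lerXn2r; rewrite ?nnegrE ?rnorm_ge0//.
    by rewrite mulr_ge0// subr_ge0.
  by move: zC; lra.
apply: le_trans (ler_pM (rnorm_ge0 _) _ (ler_rnorm_sum _ _ _) c1) _.
  by rewrite exprn_ge0 ?rnorm_ge0.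
rewrite mulrCA ler_wpM2l ?exprn_ge0// (le_trans _ (hB J _ z01))// mulr_suml.
apply: ler_sum => j _; rewrite ler_wpM2r ?exprn_ge0 ?subr_ge0//.
rewrite hornerZ hornerXn !rnormM rnormR !rnormX rnorm_nat -[leLHS]mulrA.
apply: le_trans (ler_piMl _ (ha j)) _; first by rewrite mulr_ge0 ?exprn_ge0 ?rnorm_ge0.
by rewrite ler_wpM2l ?exprn_ge0// ler_wiXn2l ?rnorm_ge0.
Qed.

Let iterT_linear n : linear (iter n T).
Proof. by elim: n => [//|n IH] c u v /=; rewrite IH T_linear. Qed.

Lemma iter_telescope n (y : X) : iter n T y = y - \sum_(i < n) iter i T (E y).
Proof.
elim: n => [|n IH]; first by rewrite big_ord0 subr0.
rewrite big_ord_recr /= opprD addrA -IH /E (linear_funB (iterT_linear n)) -iterSr iterS.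
by rewrite opprB addrC subrK.
Qed.

Lemma sum_divn (f : nat -> X) (a b : nat) : (0 < b)%N ->
  \sum_(u < a * b) f (u %/ b)%N = \sum_(i < a) f i *+ b.
Proof.
move=> b0; elim: a => [|a IH]; first by rewrite mul0n !big_ord0.
rewrite mulSnr big_split_ord/= IH big_ord_recr/=; congr (_ + _).
rewrite (eq_bigr (fun=> f a)) ?sumr_const ?card_ord// => i _.
by rewrite divnMDl// divn_small ?addn0.
Qed.

Lemma sum_ord_lt (N M : nat) (c : R) :
  \sum_(k < N) (if (k < M)%N then c else 0) = c *+ minn N M.
Proof.
elim: N => [|N IH]; first by rewrite big_ord0 min0n mulr0n.
rewrite big_ord_recr/= IH; case: ltnP => h; rewrite ?addr0 -?mulrSr; congr (_ *+ _); lia.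
Qed.

Lemma collapse_blocks (J N : nat) (jk : 'I_N -> 'I_J) (c : 'I_J -> 'I_N -> R) (s : 'I_N -> R)
    (Y : 'I_J -> X) :
  \sum_j (\sum_k (if jk k == j then c j k else 0) * s k)%:C *: Y j =
  \sum_k (c (jk k) k * s k)%:C *: Y (jk k).
Proof.
under eq_bigr do rewrite rmorph_sum scaler_suml.
rewrite exchange_big; apply: eq_bigr => k _ /=.
rewrite (bigD1 (jk k))//= eqxx big1 ?addr0// => j /negbTE jn.
by rewrite eq_sym jn mul0r scale0r.
Qed.

(** Only the size of w is prescribed, so that bounded multipliers can be inserted, as the proof of
    convergence will do. *)
Lemma finite_square_function (C rho : R) (m : nat) : 0 <= C -> 0 < rho < 1 ->
  dyadic_cotype X C rho -> (0 < m)%N -> exists2 K : R, 0 <= K &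
  forall (N : nat) (w : nat -> R) (x : X), (forall k, w k ^+ 2 <= k.+1%:R ^+ (2 * m).-1) ->
  radsq N (fun k => (w k)%:C *: iter k T (iter m E x)) <= K * rnorm x ^+ 2.
Proof.
move=> C0 rho01 cot m0.
have [G G0 hG] := subgaussian_sum C0 rho01 cot.
have [K1 K10 hK1] := unconditional_blocks m0.
have [K2 K20 hK2] := @unconditional_blocks m.+1 isT.
have p2 : 0 <= 2 ^+ m :> R by rewrite exprn_ge0.
exists (2 * (G * (2 ^+ m * K1) ^+ 2) + 2 * (G * (2 ^+ m * K2) ^+ 2)).
  by rewrite addr_ge0// mulr_ge0// mulr_ge0// sqr_ge0.
move=> N w x hw; pose J := N.+1; pose z := iter m E x.
pose lg k := trunc_log 2 k.+1.
pose r k := (k.+1 - 2 ^ lg k)%N.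
have lgJ (k : 'I_N) : (lg k < J)%N.
  by have [h _ _ _] := dyadic_block k; rewrite ltnS (leq_trans h)// ltnW.
pose jk (k : 'I_N) : 'I_J := Ordinal (lgJ k).
have rlt k : (r k <= 2 ^ lg k)%N by case: (dyadic_block k).
have kE k : k = (2 ^ lg k - 1 + r k)%N by case: (dyadic_block k).
have klt k : (k.+1 <= 2 ^ (lg k).+1)%N by case: (dyadic_block k).
(* Q j dominates (k + 1)^m on block j: dividing w k by it leaves a coefficient whose square is at
   most 2^-(j+1). *)
pose Q (j : nat) : R := (2 ^ j.+1)%:R ^+ m.
have Q0 j : 0 < Q j by rewrite exprn_gt0// ltr0n expn_gt0.
have QE j : Q j = 2 ^+ m * (2 ^ j)%:R ^+ m by rewrite /Q expnS natrM exprMn.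
(* An inner sum over [i < r k] is an average over [i < 2^j], hence over [u < 2^N]
   uniformly in j: for fixed u, one vector per block remains. *)
pose idx (j u : nat) := (u %/ 2 ^ (N - j))%N.
pose a (j : 'I_J) (k : 'I_N) : R := if jk k == j then w k / Q j else 0.
pose b (u : nat) (j : 'I_J) (k : 'I_N) : R :=
  if jk k == j then (if (idx j u < r k)%N then w k / Q j else 0) else 0.
have wQ (j : 'I_J) (k : 'I_N) : jk k == j -> (w k / Q j) ^+ 2 <= (2 ^ j.+1)%:R^-1.
  move=> /eqP <-; have h := klt k.
  have d0 : 0 < (2 ^ (lg k).+1)%:R :> R by rewrite ltr0n expn_gt0.
  rewrite exprMn exprVn ler_pdivrMr ?exprn_gt0//= (le_trans (hw k))//.
  apply: (@le_trans _ _ ((2 ^ (lg k).+1)%:R ^+ (2 * m).-1)).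
    by apply: lerXn2r; rewrite ?nnegrE ?ler_nat.
  rewrite /Q -exprM [(m * 2)%N]mulnC.
  rewrite -{2}[(2 * m)%N]prednK ?muln_gt0// [in leRHS]exprS mulKf ?gt_eqF//.
(* Block j has at most 2^(j+1) indices, so its variance is at most 1. *)
have cnt (j : 'I_J) (f : 'I_N -> R) : (forall k, jk k == j -> f k ^+ 2 <= (2 ^ j.+1)%:R^-1) ->
    \sum_k (if jk k == j then f k else 0) ^+ 2 <= 1.
  move=> hf; apply: (@le_trans _ _ (\sum_(k < N) (if (k < 2 ^ j.+1)%N then (2 ^ j.+1)%:R^-1 else 0))).
    apply: ler_sum => k _; case: ifPn => [e|_]; last first.
      by rewrite expr0n; case: ifP => // _; rewrite invr_ge0.
    have -> : (k < 2 ^ j.+1)%N by rewrite -(eqP e); exact: klt.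
    exact: hf.
  rewrite sum_ord_lt -[_ *+ minn _ _]mulr_natr ler_pdivrMl ?ltr0n ?expn_gt0// mulr1 ler_nat.
  exact: geq_minr.
have ha j : \sum_k a j k ^+ 2 <= 1 by apply: cnt => k; exact: wQ.
have hb u j : \sum_k b u j k ^+ 2 <= 1.
  apply: cnt => k e; case: ifP => _; first exact: wQ.
  by rewrite expr0n invr_ge0.
have a0 j k : jk k != j -> a j k = 0 by rewrite /a => /negbTE ->.
have b0 u j k : jk k != j -> b u j k = 0 by rewrite /b => /negbTE ->.
pose Y (j : 'I_J) : X := (2 ^+ m)%:C *: ((2 ^ j)%:R ^+ m *: iter (2 ^ j - 1) T z).
pose Y' u (j : 'I_J) : X :=
  (2 ^+ m)%:C *: ((2 ^ j)%:R ^+ m.+1 *: iter (2 ^ j - 1 + idx j u) T (iter m.+1 E x)).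
have hY (c : 'I_J -> R) : (forall j, `|c j| <= 1) ->
    rnorm (\sum_j (c j)%:C *: Y j) <= 2 ^+ m * K1 * rnorm x.
  move=> hc; under eq_bigr do rewrite scalerA mulrC -scalerA.
  by rewrite -scaler_sumr rnormRZ ger0_norm// -mulrA ler_wpM2l// hK1.
have hY' u (c : 'I_J -> R) : (forall j, `|c j| <= 1) ->
    rnorm (\sum_j (c j)%:C *: Y' u j) <= 2 ^+ m * K2 * rnorm x.
  move=> hc; under eq_bigr do rewrite scalerA mulrC -scalerA.
  rewrite -scaler_sumr rnormRZ ger0_norm// -mulrA ler_wpM2l// hK2// => j.
  exact: leq_addr.
pose A (s : {ffun 'I_N -> bool}) := \sum_j (\sum_k a j k * sgn R (s k))%:C *: Y j.
pose B u (s : {ffun 'I_N -> bool}) := \sum_j (\sum_k b u j k * sgn R (s k))%:C *: Y' u j.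
have avgA : avg (fun s => rnorm (A s) ^+ 2) <= G * (2 ^+ m * K1 * rnorm x) ^+ 2.
  by apply: (hG J N jk) => //; rewrite !mulr_ge0 ?rnorm_ge0.
have avgB u : avg (fun s => rnorm (B u s) ^+ 2) <= G * (2 ^+ m * K2 * rnorm x) ^+ 2.
  by apply: (hG J N jk) => //; [exact: b0|rewrite !mulr_ge0 ?rnorm_ge0|exact: hY'].
(* T^k z is T^(2^j - 1) z minus the r k vectors T^(2^j - 1 + i) (I - T) z. The first part gives A;
   the second gives the average of the B u, where the exponent m + 1 in Y' supplies the factor 2^j
   that averaging divides out. *)
have dec s : signed_sum (fun k => (w k)%:C *: iter k T z) s =
    A s - ((2 ^ N)%:R^-1)%:C *: \sum_(u < 2 ^ N) B u s.
  have -> : A s = \sum_(k < N) (w k / Q (jk k) * sgn R (s k))%:C *: Y (jk k).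
    exact: (collapse_blocks jk (fun j k => w k / Q j) (fun k => sgn R (s k)) Y).
  have BE u : B u s = \sum_(k < N) ((if (idx (jk k) u < r k)%N then w k / Q (jk k) else 0) * sgn R (s k))%:C *: Y' u (jk k).
    exact: (collapse_blocks jk (fun j (k : 'I_N) => if (idx j u < r k)%N then w k / Q j else 0)
      (fun k => sgn R (s k)) (Y' u)).
  rewrite [X in _ - _ *: X](eq_bigr _ (fun (u : 'I_(2 ^ N)) _ => BE u)).
  rewrite exchange_big scaler_sumr -sumrB; apply: eq_bigr => k _.
  pose j := lg k; pose v := (sgn R (s k) * w k)%:C.
  pose F i := iter (2 ^ j - 1 + i) T (E z).
  have j0 : (2 ^ j)%:R ^+ m != 0 :> R by rewrite expf_neq0// pnatr_eq0 expn_eq0.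
  have j1 : 2 ^+ m != 0 :> R by rewrite expf_neq0.
  have natC i : i%:R = (i%:R : R)%:C :> R[i] by rewrite rmorph_nat.
  have natX i p : i%:R ^+ p = (i%:R ^+ p : R)%:C :> R[i] by rewrite rmorphXn/= rmorph_nat.
  have coef (c : R) : (w k / Q j * sgn R (s k))%:C * ((2 ^+ m)%:C * ((2 ^ j)%:R ^+ m * c%:C)) = v * c%:C.
    rewrite /v natX -!(rmorphM (real_complex R)) QE; congr (real_complex _ _).
    by field; rewrite j1 j0.
  have -> : (w k / Q (jk k) * sgn R (s k))%:C *: Y (jk k) = v *: iter (2 ^ j - 1) T z.
    by have := coef 1; rewrite rmorph1 !mulr1 => c1; rewrite /Y !scalerA -mulrA c1.
  have term (u : 'I_(2 ^ N)) : ((if (idx (jk k) u < r k)%N then w k / Q (jk k) else 0) * sgn R (s k))%:C *: Y' u (jk k)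
      = (v * (2 ^ j)%:R) *: (if (u %/ 2 ^ (N - j) < r k)%N then F (u %/ 2 ^ (N - j))%N else 0).
    case: ifP => h; last by rewrite mul0r scale0r scaler0.
    rewrite /Y' !scalerA; congr (_ *: _).
    by have := coef (2 ^ j)%:R; rewrite -natC => <-; rewrite exprSr !mulrA.
  rewrite (eq_bigr _ (fun u _ => term u)) -scaler_sumr.
  have jN : (j <= N)%N by have := lgJ k; rewrite ltnS.
  have := @sum_divn (fun i => if (i < r k)%N then F i else 0) (2 ^ j) (2 ^ (N - j)).
  rewrite -expnD subnKC// expn_gt0 => /(_ isT) ->.
  have -> : \sum_(i < 2 ^ j) (if (i < r k)%N then F i else 0) *+ 2 ^ (N - j) =
      (2 ^ (N - j))%:R *: \sum_(i < r k) F i.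
    rewrite sumrMnl -(scaler_nat _ (\sum_(i < 2 ^ j) _)); congr (_ *: _).
    by rewrite -big_mkcond (big_ord_widen _ F (rlt k)).
  have -> : iter k T z = iter (2 ^ j - 1) T z - \sum_(i < r k) F i.
    rewrite {1}(kE k) iterD (iter_telescope (r k)) (linear_funB (iterT_linear _)); congr (_ - _).
    rewrite (linear_fun_sum (iterT_linear _)); apply: eq_bigr => i _.
    by rewrite /F iterD.
  rewrite scalerA -rmorphM -/v scalerBr; congr (_ - _); rewrite !scalerA; congr (_ *: _).
  rewrite !natC /v -!(rmorphM (real_complex R)); congr (real_complex _ _).
  have -> : (2 ^ N)%:R = (2 ^ j)%:R * (2 ^ (N - j))%:R :> R by rewrite -natrM -expnD subnKC.
  by field; rewrite !pnatr_eq0 !expn_eq0.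
pose n := (2 ^ N)%N; have n0 : 0 < n%:R :> R by rewrite ltr0n expn_gt0.
apply: (@le_trans _ _ (avg (fun s => 2 * rnorm (A s) ^+ 2 +
    2 * (n%:R^-1 * \sum_(u < n) rnorm (B u s) ^+ 2)))).
  apply: avg_le => s; rewrite dec.
  set y := _ *: _; have hy : rnorm y ^+ 2 <= n%:R^-1 * \sum_(u < n) rnorm (B u s) ^+ 2.
    rewrite /y rnormRZ ger0_norm ?invr_ge0// exprMn -/n.
    rewrite expr2 -mulrA ler_wpM2l ?invr_ge0// ler_pdivrMl//.
    rewrite (le_trans _ (sum_sqr_le _))//.
    by apply: lerXn2r; rewrite ?nnegrE ?rnorm_ge0 ?ler_rnorm_sum// sumr_ge0// => u _; exact: rnorm_ge0.
  apply: (@le_trans _ _ (2 * rnorm (A s) ^+ 2 + 2 * rnorm y ^+ 2)); last by lra.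
  apply: (@le_trans _ _ ((rnorm (A s) + rnorm y) ^+ 2)).
    by apply: lerXn2r; rewrite ?nnegrE ?addr_ge0 ?rnorm_ge0// ler_rnormB.
  have := sqr_ge0 (rnorm (A s) - rnorm y); lra.
have eK K' : 2 * (G * (2 ^+ m * K') ^+ 2) * rnorm x ^+ 2 = 2 * (G * (2 ^+ m * K' * rnorm x) ^+ 2).
  by rewrite [(2 ^+ m * K' * _) ^+ 2]exprMn !mulrA.
rewrite avgD avgZ avgZ avgZ avg_sum [leRHS]mulrDl !eK lerD//; first by rewrite ler_wpM2l.
rewrite ler_wpM2l// ler_pdivrMl//.
apply: (@le_trans _ _ (\sum_(u < n) G * (2 ^+ m * K2 * rnorm x) ^+ 2)).
  by apply: ler_sum => u _; exact: avgB.
by rewrite sumr_const card_ord -[leLHS]mulr_natl.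
Qed.

End FiniteSquareFunction.

(** * Convergence of the Rademacher series *)

Section FiniteRange.
Context (R : realType) (d : measure_display) (M : measurableType d).

(** [simple_function] with any codomain, so that it covers pairs and real functions. *)
Definition finite_range_measurable (Y : Type) (f : M -> Y) : Prop :=
  finite_set (range f) /\ forall y, measurable (f @^-1` [set y]).

Lemma finite_range_cst (Y : Type) (y : Y) : finite_range_measurable (fun=> y).
Proof.
split=> [|z].
  by apply: (@sub_finite_set _ _ [set y]) => [_ [w _ <-]|]; [|exact: finite_set1].
have [yz|yz] := pselect (y = z).
  by rewrite (_ : _ @^-1` _ = setT)//; apply/seteqP; split.
by rewrite (_ : _ @^-1` _ = set0)//; apply/seteqP; split.
Qed.

Lemma finite_range_preimage (Y : Type) (f : M -> Y) (B : set Y) :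
  finite_range_measurable f -> measurable (f @^-1` B).
Proof.
move=> [ff mf]; have -> : f @^-1` B = \bigcup_(y in range f `&` B) (f @^-1` [set y]).
  apply/seteqP; split=> [w /= Bw|w [y [_ By] /= ->//]].
  by exists (f w) => //; split=> //; exists w.
by apply: fin_bigcup_measurable => [|y _]; [exact: finite_setIl|exact: mf].
Qed.

Lemma finite_range_comp (Y Z : Type) (f : M -> Y) (h : Y -> Z) :
  finite_range_measurable f -> finite_range_measurable (fun w => h (f w)).
Proof.
move=> mf; split=> [|z]; last exact: (finite_range_preimage (h @^-1` [set z]) mf).
have -> : range (fun w => h (f w)) = h @` range f.
  by apply/seteqP; split=> [_ [w _ <-]|_ [_ [w _ <-] <-]]; [exists (f w) => //; exists w|exists w].
by apply: finite_image; case: mf.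
Qed.

Lemma finite_range_pair (Y Z : Type) (f : M -> Y) (h : M -> Z) :
  finite_range_measurable f -> finite_range_measurable h ->
  finite_range_measurable (fun w => (f w, h w)).
Proof.
move=> [ff mf] [fh mh]; split=> [|[y z]].
  apply: (@sub_finite_set _ _ (range f `*` range h)); last exact: finite_setX.
  by move=> _ [w _ <-]; split; exists w.
have -> : (fun w => (f w, h w)) @^-1` [set (y, z)] = (f @^-1` [set y]) `&` (h @^-1` [set z]).
  by apply/seteqP; split=> w /= => [[-> ->]|[-> ->]].
exact: measurableI.
Qed.

End FiniteRange.

Lemma ler_dist_rnorm (R : realType) (V : normedZmodType R[i]) (x y : V) :
  `|rnorm x - rnorm y| <= rnorm (x - y).
Proof.
rewrite ler_norml; apply/andP; split.
  by rewrite lerNl opprB lerBlDr rnormB -{1}(subrK x y) ler_rnormD.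
by rewrite lerBlDr -{1}(subrK y x) ler_rnormD.
Qed.

(** * Strong measurability and second moments *)

Section StrongMeasurability.
Context (R : realType) (d : measure_display) (M : measurableType d).
Context (X : completeNormedModType R[i]).
Implicit Types f s : M -> X.

Lemma strongly_measurable_rnorm f : strongly_measurable f ->
  measurable_fun setT (fun w => rnorm (f w)).
Proof.
move=> [s hs cs]; apply: (@measurable_fun_cvg _ _ _ setT (fun n w => rnorm (s n w))) => [n|w _].
  move=> _ B mB; rewrite setTI.
  exact: (finite_range_preimage (fun x => B (rnorm x)) (hs n)).
apply/cvgrPdist_lt => e e0; have /real_cvgP/(_ e e0)[N hN] := cs w.
exists N => // n Nn /=; apply: le_lt_trans (hN n Nn).
by rewrite distrC ler_dist_rnorm.
Qed.

Lemma strongly_measurable_sub f s : strongly_measurable f -> strongly_measurable s ->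
  strongly_measurable (f - s).
Proof.
move=> [u hu cu] [v hv cv]; exists (fun n => u n - v n) => [n|w].
  exact: (finite_range_comp (fun p => p.1 - p.2) (finite_range_pair (hu n) (hv n))).
by apply: cvgB; [exact: cu|exact: cv].
Qed.

Lemma strongly_measurable_add f s : strongly_measurable f -> strongly_measurable s ->
  strongly_measurable (f + s).
Proof.
move=> [u hu cu] [v hv cv]; exists (fun n => u n + v n) => [n|w].
  exact: (finite_range_comp (fun p => p.1 + p.2) (finite_range_pair (hu n) (hv n))).
by apply: cvgD; [exact: cu|exact: cv].
Qed.

Lemma strongly_measurable_scale (h : M -> R) (x : X) : measurable_fun setT h ->
  strongly_measurable (fun w => (h w)%:C *: x).
Proof.
move=> mh; have mh' : measurable_fun setT (EFin \o h) by exact/measurable_EFinP.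
have [g hg] := approximation_sfun measurableT mh'.
exists (fun n w => (g n w)%:C *: x) => [n|w].
  apply: (finite_range_comp (fun r : R => r%:C *: x)); split; first exact: fimfunP.
  by move=> y; exact: measurable_sfunP.
have := hg w I; move=> /fine_cvgP[_] /cvgrPdist_lt hc.
apply/real_cvgP => e e0.
have x0 : 0 < rnorm x + 1 by rewrite ltr_wpDl// rnorm_ge0.
have [N _ hN] := hc (e / (rnorm x + 1)) (divr_gt0 e0 x0).
exists N => n Nn; rewrite -scalerBl -rmorphB rnormRZ.
have := hN n Nn; rewrite /= distrC ltr_pdivlMr//; apply: le_lt_trans.
by rewrite ler_wpM2l// lerDl.
Qed.

Lemma strongly_measurable0 : strongly_measurable (0 : M -> X).
Proof.
by exists (fun=> 0) => [n|w]; [exact: finite_range_cst|exact: cvg_cst].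
Qed.

Lemma strongly_measurable_rademacher (P : probability M R) (eps : nat -> {RV P >-> R})
  (x : nat -> X) n : strongly_measurable (rademacher_sum eps x n).
Proof.
elim: n => [|n IH].
  by have := strongly_measurable0; congr strongly_measurable; apply/funext => w; rewrite /rademacher_sum big_ord0.
have -> : rademacher_sum eps x n.+1 = rademacher_sum eps x n + (fun w => (eps n w)%:C *: x n).
  by apply/funext => w; rewrite /rademacher_sum big_ord_recr.
by apply: strongly_measurable_add => //; exact: strongly_measurable_scale.
Qed.

Context (P : probability M R).

Definition moment2 f : \bar R := (\int[P]_w (rnorm (f w) ^+ 2)%:E)%E.

Lemma moment2_measurable f : strongly_measurable f ->
  measurable_fun setT (fun w => (rnorm (f w) ^+ 2)%:E : \bar R).
Proof.
move=> mf; apply/measurable_EFinP; apply: measurable_funX.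
exact: strongly_measurable_rnorm.
Qed.

Lemma moment2_ge0 f : (0 <= moment2 f)%E.
Proof. by apply: integral_ge0 => w _; rewrite lee_fin sqr_ge0. Qed.

Lemma L2norm_sqr f : (L2norm P f `^ 2 = moment2 f)%E.
Proof.
rewrite /L2norm powR_Lnorm ?pnatr_eq0//; apply: eq_integral => w _ /=.
by rewrite ger0_norm ?rnorm_ge0// powR_mulrn ?rnorm_ge0.
Qed.

Lemma L2normE f : (L2norm P f = moment2 f `^ 2^-1)%E.
Proof.
rewrite -L2norm_sqr -poweRrM mulfV ?pnatr_eq0// poweRe1//.
exact: Lnorm_ge0.
Qed.

Lemma L2norm_le f (c : R) : 0 <= c -> (moment2 f <= (c ^+ 2)%:E)%E -> (L2norm P f <= c%:E)%E.
Proof.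
move=> c0 h; rewrite L2normE.
have -> : c%:E = ((c ^+ 2)%:E `^ 2^-1)%E.
  rewrite poweR_EFin -(powR_mulrn 2 c0) -powRrM mulfV ?pnatr_eq0// powRr1//.
apply: gt0_ler_poweR => //; rewrite ?in_itv/= ?leey ?andbT ?moment2_ge0 ?lee_fin ?sqr_ge0//.
Qed.

Lemma moment2_le f (c : R) : 0 <= c -> (L2norm P f <= c%:E)%E -> (moment2 f <= (c ^+ 2)%:E)%E.
Proof.
move=> c0 h; rewrite -L2norm_sqr.
have -> : (c ^+ 2)%:E = (c%:E `^ 2)%E by rewrite poweR_EFin powR_mulrn.
apply: gt0_ler_poweR => //; rewrite ?in_itv/= ?leey ?andbT ?Lnorm_ge0 ?lee_fin//.
Qed.

End StrongMeasurability.

(** * Moments of Rademacher sums as averages over signs *)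

Section RademacherMoment.
Context (R : realType) (d : measure_display) (M : measurableType d).
Context (P : probability M R) (eps : nat -> {RV P >-> R}).
Hypothesis heps : rademacher_sequence eps.

Lemma prod_EFin_const (c : R) (r : seq nat) : (\prod_(k <- r) c%:E = (c ^+ size r)%:E)%E.
Proof.
by elim: r => [|k r IH]; rewrite ?big_nil// big_cons IH exprS EFinM.
Qed.

Lemma sgn_inj : injective (sgn R).
Proof. by move=> [] [] //= /eqP; rewrite -subr_eq0 /sgn; rewrite ?opprK -?opprD ?oppr_eq0 -?(natrD R 1 1) ?pnatr_eq0. Qed.

Lemma rademacher_half k (b : bool) : P (eps k @^-1` [set sgn R b]) = (2^-1)%:E.
Proof. by have [_ /(_ k)[h1 h2]] := heps; case: b. Qed.

(** The event that the first n variables have the signs s, in the shape of [independent_variables];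
    the default [false] is never reached, as k < n. *)
Definition cylinder n (s : {ffun 'I_n -> bool}) : set M :=
  \bigcap_(k in [set` [fset k in iota 0 n]%fset]) (eps k @^-1` [set sgn R (oapp s false (insub k))]).

Lemma cylinder_sgn n (s : {ffun 'I_n -> bool}) w (k : 'I_n) : cylinder s w -> eps k w = sgn R (s k).
Proof.
move=> /(_ (k : nat)) /=; rewrite valK; apply.
by rewrite !inE mem_iota/=.
Qed.

Lemma cylinder_measurable n (s : {ffun 'I_n -> bool}) : measurable (cylinder s).
Proof.
by apply: fin_bigcap_measurable => // k _; rewrite -[X in measurable X]setTI; apply: measurable_funP.
Qed.

Lemma cylinder_prob n (s : {ffun 'I_n -> bool}) : P (cylinder s) = (2^-1 ^+ n)%:E.
Proof.
have [ind _] := heps; rewrite /cylinder ind; last by move=> k; exact: measurable_set1.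
under eq_bigr do rewrite rademacher_half.
rewrite prod_EFin_const; congr ((_ ^+ _)%:E).
rewrite -[RHS](size_iota 0 n) -[in RHS](undup_id (iota_uniq 0 n)).
exact: card_fseq.
Qed.

Lemma integral_cylinder n (s : {ffun 'I_n -> bool}) (c : R) :
  (\int[P]_(w in cylinder s) c%:E = (c * 2^-1 ^+ n)%:E)%E.
Proof.
rewrite integral_cst; last exact: cylinder_measurable.
rewrite EFinM; congr (_ * _)%E; exact: cylinder_prob.
Qed.

Lemma cylinder_trivIset n : trivIset setT (@cylinder n).
Proof.
move=> s s' _ _ [w [ws ws']]; apply/ffunP => k; apply: sgn_inj.
by rewrite -(cylinder_sgn k ws) (cylinder_sgn k ws').
Qed.

Lemma card_signs n : #|{ffun 'I_n -> bool}| = (2 ^ n)%N.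
Proof. by rewrite card_ffun card_bool card_ord. Qed.

Lemma moment2_rademacher (X : completeNormedModType R[i]) (x : nat -> X) n :
  moment2 P (rademacher_sum eps x n) = (radsq n x)%:E.
Proof.
pose U := \big[setU/set0]_(s <- index_enum {ffun 'I_n -> bool}) cylinder s.
have mU : measurable U by apply: bigsetU_measurable => s _; exact: cylinder_measurable.
have mS := moment2_measurable (strongly_measurable_rademacher eps x n).
have tI (r : set {ffun 'I_n -> bool}) : trivIset r (@cylinder n).
  by move=> s s' _ _; exact: cylinder_trivIset.
have iU (f : M -> R) : measurable_fun setT (EFin \o f) -> (forall w, 0 <= f w) ->
   (\int[P]_(w in U) (f w)%:E = \sum_(s : {ffun 'I_n -> bool}) \int[P]_(w in cylinder s) (f w)%:E)%E.
  move=> mf f0; rewrite ge0_integral_bigsetU ?index_enum_uniq//.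
  - by move=> s; exact: cylinder_measurable.
  - exact: measurable_funTS.
  - by move=> w _; rewrite lee_fin.
(* The 2^n cylinders are disjoint and have probability 2^-n, so they exhaust the space up to a null
   set. *)
have PU : P U = 1%E.
  have := iU (fun=> 1) (measurable_cst _) (fun=> ler01).
  rewrite integral_cst// mul1e => ->.
  under eq_bigr do rewrite integral_cylinder mul1r.
  rewrite sumEFin sumr_const card_signs -[_ *+ _]mulr_natl natrX -exprMn.
  by rewrite mulfV ?pnatr_eq0// expr1n.
have PUC : P (~` U) = 0%E by rewrite probability_setC// PU subee.
rewrite /moment2 (ge0_negligible_integral (measurableC mU))//; last by move=> w _; rewrite lee_fin sqr_ge0.
rewrite setTD setCK (iU (fun w => rnorm (rademacher_sum eps x n w) ^+ 2))//; last by move=> w; exact: sqr_ge0.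
rewrite /radsq /avg card_signs mulr_sumr -sumEFin; apply: eq_bigr => s _.
under eq_integral => w.
  rewrite inE => ws.
  have -> : rademacher_sum eps x n w = signed_sum x s.
    by apply: eq_bigr => k _; rewrite (cylinder_sgn k ws).
  over.
by rewrite integral_cylinder mulrC natrX exprVn.
Qed.

Lemma rademacher_sign_ae : exists B : set M,
  [/\ measurable B, P (~` B) = 0%E & forall w, B w -> forall k, eps k w = 1 \/ eps k w = -1].
Proof.
pose B k := eps k @^-1` [set 1] `|` eps k @^-1` [set -1].
have mE k c : measurable (eps k @^-1` [set c]).
  by rewrite -[X in measurable X]setTI; apply: measurable_funP => //; exact: measurable_set1.
have mB k : measurable (B k) by exact: measurableU.
have PB k : P (~` B k) = 0%E.
  rewrite probability_setC// /B measureU//; last first.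
    apply/seteqP; split=> // w [/= -> /eqP]; rewrite -subr_eq0 opprK -(natrD R 1 1) pnatr_eq0//.
  rewrite [X in (1 - X)%E](_ : _ = 1%E) ?subee//.
  transitivity (2^-1%:E + 2^-1%:E : \bar R)%E.
    by congr (_ + _)%E; [exact: (rademacher_half k false)|exact: (rademacher_half k true)].
  by rewrite -EFinD -mulr2n -[_ *+ _]mulr_natl mulfV ?pnatr_eq0.
exists (\bigcap_k B k); split.
- exact: bigcap_measurable.
- apply/(negligibleP P); first exact/measurableC/bigcap_measurable.
  rewrite setC_bigcap; apply: negligible_bigcup => k; apply/(negligibleP P); [exact: measurableC|exact: PB].
- by move=> w Bw k; case: (Bw k I); [left|right].
Qed.

End RademacherMoment.

(** * From cotype q to the dyadic inequality *)

Section PowerMean.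
Context (R : realType).
Implicit Types (p x : R).

(** For p > 1, Young's inequality for x and 1, with the exponents p and p / (p - 1). *)
Lemma powR_bernoulli p x : 1 <= p -> 0 <= x -> 1 + p * (x - 1) <= x `^ p.
Proof.
rewrite le_eqVlt => /predU1P[<-|p1] x0; first by rewrite powRr1// mul1r addrC subrK.
have p0 : 0 < p by rewrite (lt_trans _ p1).
have q0 : 0 < p - 1 by rewrite subr_gt0.
have pq : p^-1 + (p / (p - 1))^-1 = 1 by field; rewrite !gt_eqF.
have := conjugate_powR x0 ler01 p0 (divr_gt0 p0 q0) pq.
rewrite mulr1 powR1 div1r -(ler_pM2l p0).
have -> : p * (x `^ p / p + (p / (p - 1))^-1) = x `^ p + (p - 1) by field; rewrite !gt_eqF.
lra.
Qed.

(** Jensen's inequality: [powR_bernoulli] is the tangent line of the power at the mean B, and the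
    linear terms sum to 0. *)
Lemma power_mean (n : nat) p (b : 'I_n -> R) : 1 <= p -> (0 < n)%N -> (forall i, 0 <= b i) ->
  n%:R * ((\sum_i b i) / n%:R) `^ p <= \sum_i b i `^ p.
Proof.
move=> p1 n0 b0; set B := _ / _.
have p0 : 0 < p by rewrite (lt_le_trans _ p1).
have nn : 0 < n%:R :> R by rewrite ltr0n.
have B0 : 0 <= B by rewrite divr_ge0 ?sumr_ge0// ltW.
move: (B0); rewrite le_eqVlt => /predU1P[<-|Bp].
  by rewrite powR0 ?gt_eqF// mulr0 sumr_ge0// => i _; exact: powR_ge0.
have sB : \sum_i b i = n%:R * B by rewrite /B; field; rewrite gt_eqF.
apply: (@le_trans _ _ (\sum_i B `^ p * (1 + p * (b i / B - 1)))).
  rewrite -mulr_sumr big_split/= -mulr_sumr sumrB -mulr_suml sB !sumr_const card_ord.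
  rewrite -[_ *+ _]mulr_natl mulr1 mulfK ?gt_eqF// subrr mulr0 addr0.
  by rewrite mulrC.
apply: ler_sum => i _.
have -> : b i `^ p = B `^ p * (b i / B) `^ p.
  rewrite -powRM//; last exact: divr_ge0.
  by rewrite [B * _]mulrC divfK// gt_eqF.
by rewrite ler_wpM2l ?powR_ge0// powR_bernoulli// divr_ge0.
Qed.

End PowerMean.

Section FiniteCotype.
Context (R : realType) (d : measure_display) (M : measurableType d).
Context (P : probability M R) (eps : nat -> {RV P >-> R}).
Hypothesis heps : rademacher_sequence eps.
Context (X : completeNormedModType R[i]).

Lemma L2norm_rademacher (x : nat -> X) n :
  L2norm P (rademacher_sum eps x n) = (Num.sqrt (radsq n x))%:E.
Proof. by rewrite L2normE moment2_rademacher// poweR_EFin powR12_sqrt ?radsq_ge0. Qed.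

(** Passing from the exponent q to 2 costs n^(1 - 2/q), which is 2^t rho^t for n = 2^t. As q is
    finite, rho < 1. *)
Lemma finite_cotype_dyadic : finite_cotype eps X ->
  exists C rho : R, [/\ 0 <= C, 0 < rho < 1 & dyadic_cotype X C rho].
Proof.
move=> [q q2 [C C0 hC]].
have q0 : 0 < q by rewrite (lt_le_trans _ q2).
have p1 : 1 <= q / 2 by rewrite ler_pdivlMr// mul1r.
have p0 : 0 < q / 2 by rewrite divr_gt0.
pose rho := (2 : R) `^ (- (q / 2)^-1).
exists (C ^+ 2), rho; split; first exact: sqr_ge0.
  rewrite powR_gt0//= /rho powRN invf_lt1 ?powR_gt0// [ltLHS](_ : 1 = 1 `^ (q / 2)^-1); last by rewrite powR1.
  by apply: gt0_ltr_powR; rewrite ?invr_gt0 ?nnegrE ?ltr1n.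
move=> t y; set n := (2 ^ t)%N.
have n0 : (0 < n)%N by rewrite expn_gt0.
have nn : 0 < n%:R :> R by rewrite ltr0n.
set r := radsq n y; have r0 : 0 <= r by exact: radsq_ge0.
set S := \sum_(c < n) rnorm (y c) ^+ 2.
have S0 : 0 <= S by apply: sumr_ge0 => i _; exact: sqr_ge0.
have h1 : \sum_(k < n) rnorm (y k) `^ q <= C `^ q * r `^ (q / 2).
  have := hC n y; rewrite L2norm_rademacher -EFinM lee_fin => h.
  have s0 : 0 <= \sum_(k < n) rnorm (y k) `^ q by apply: sumr_ge0 => i _; exact: powR_ge0.
  have -> : \sum_(k < n) rnorm (y k) `^ q = ((\sum_(k < n) rnorm (y k) `^ q) `^ q^-1) `^ q.
    by rewrite -powRrM mulVf ?gt_eqF// powRr1.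
  have -> : C `^ q * r `^ (q / 2) = (C * Num.sqrt r) `^ q.
    rewrite powRM ?sqrtr_ge0 ?(ltW C0)// -powR12_sqrt// -powRrM; congr (_ * _ `^ _).
    by rewrite mulrC.
  apply: ge0_ler_powR => //; rewrite ?nnegrE ?(ltW q0) ?powR_ge0//.
  by rewrite mulr_ge0 ?sqrtr_ge0// ltW.
have h2 : n%:R * (S / n%:R) `^ (q / 2) <= C `^ q * r `^ (q / 2).
  apply: le_trans h1; apply: (le_trans (power_mean p1 n0 _)) => [i|]; first exact: sqr_ge0.
  apply: ler_sum => i _; rewrite -(powR_mulrn 2 (rnorm_ge0 _)) -powRrM.
  by rewrite mulrCA mulfV ?pnatr_eq0// mulr1.
have h3 : n%:R `^ (q / 2)^-1 * (S / n%:R) <= C ^+ 2 * r.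
  have -> : n%:R `^ (q / 2)^-1 * (S / n%:R) = (n%:R * (S / n%:R) `^ (q / 2)) `^ (q / 2)^-1.
    by rewrite powRM ?powR_ge0 ?(ltW nn)// -powRrM mulfV ?gt_eqF// powRr1// divr_ge0 ?(ltW nn).
  have -> : C ^+ 2 * r = (C `^ q * r `^ (q / 2)) `^ (q / 2)^-1.
    rewrite powRM ?powR_ge0// -!powRrM mulfV ?gt_eqF// powRr1// -(powR_mulrn 2 (ltW C0)).
    by congr (_ `^ _ * _); field; rewrite gt_eqF.
  apply: ge0_ler_powR => //; rewrite ?nnegrE ?invr_ge0 ?(ltW p0)//.
    by rewrite mulr_ge0 ?powR_ge0// ltW.
  by rewrite mulr_ge0 ?powR_ge0.
have rn : rho ^+ t * n%:R `^ (q / 2)^-1 = 1.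
  rewrite /n natrX -(powR_mulrn t (ler0n _ 2)) -powR_mulrn ?powR_ge0// /rho -!powRrM.
  rewrite -powRD ?pnatr_eq0 ?implybT//.
  by rewrite mulNr mulrC addNr powRr0.
have -> : S = rho ^+ t * n%:R * (n%:R `^ (q / 2)^-1 * (S / n%:R)).
  have -> : rho ^+ t * n%:R * (n%:R `^ (q / 2)^-1 * (S / n%:R)) =
      rho ^+ t * n%:R `^ (q / 2)^-1 * (n%:R * (S / n%:R)) by ring.
  by rewrite rn mul1r mulrC divfK// gt_eqF.
have -> : C ^+ 2 * 2 ^+ t * rho ^+ t * r = rho ^+ t * n%:R * (C ^+ 2 * r).
  by rewrite /n natrX; ring.
by apply: ler_wpM2l => //; rewrite mulr_ge0// exprn_ge0// powR_ge0.
Qed.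
End FiniteCotype.

(** * Smallness of the tails *)

Section Tails.
Context (R : realType) (d : measure_display) (M : measurableType d).
Context (P : probability M R) (eps : nat -> {RV P >-> R}).
Hypothesis heps : rademacher_sequence eps.
Context (X : completeNormedModType R[i]).
Implicit Types (v : nat -> X).

Definition tail_of v (a k : nat) : X := if (a <= k)%N then v k else 0.

Lemma rademacher_sum_widen v (b n : nat) : (b <= n)%N -> (forall k, (b <= k)%N -> v k = 0) ->
  rademacher_sum eps v n = rademacher_sum eps v b.
Proof.
move=> bn h; apply/funext => w; rewrite /rademacher_sum.
rewrite (big_ord_widen n (fun k => (eps k w)%:C *: v k) bn) [RHS]big_mkcond.
by apply: eq_bigr => k _; case: ltnP => // bk; rewrite h// scaler0.
Qed.

Lemma radsq_widen v (b n : nat) : (b <= n)%N -> (forall k, (b <= k)%N -> v k = 0) ->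
  radsq n v = radsq b v.
Proof.
move=> bn h; apply: EFin_inj.
by rewrite -!(moment2_rademacher heps) (rademacher_sum_widen bn h).
Qed.

Lemma rademacher_sum_tail v (a n : nat) : (a <= n)%N ->
  rademacher_sum eps v n - rademacher_sum eps v a = rademacher_sum eps (tail_of v a) n.
Proof.
move=> an; apply/funext => w.
have -> : (rademacher_sum eps v n - rademacher_sum eps v a) w =
  rademacher_sum eps v n w - rademacher_sum eps v a w by [].
rewrite /rademacher_sum (big_ord_widen n (fun k => (eps k w)%:C *: v k) an) [X in _ - X]big_mkcond.
rewrite -sumrB; apply: eq_bigr => k _; rewrite /tail_of.
by case: leqP => _; rewrite ?subr0// subrr scaler0.
Qed.

Context (C rho B : R) (v : nat -> X).
Hypotheses (C_ge0 : 0 <= C) (rho01 : 0 < rho < 1) (cot : dyadic_cotype X C rho).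
Hypothesis (B_ge0 : 0 <= B).
(** Multipliers are included because a signed combination of disjoint blocks of v has coefficients
    in {-1, 0, 1}. *)
Hypothesis vB : forall (N : nat) (c : nat -> R), (forall k, `|c k| <= 1) ->
  radsq N (fun k => (c k)%:C *: v k) <= B.

(* The signed combinations of disjoint blocks are bounded by B on average, whereas
   cotype bounds the sum of 2^t blocks by a factor [C 2^t rho^t] only. *)
Lemma disjoint_blocks_le (t : nat) (p a b : nat -> nat) (delta : R) :
  {homo p : i j / (i <= j)%N} -> (forall j, (p j <= a j)%N) -> (forall j, (b j <= p j.+1)%N) ->
  (forall j, delta <= radsq (b j) (tail_of v (a j))) ->
  delta <= C * B * rho ^+ t.
Proof.
move=> pm pa bp hd; pose J := (2 ^ t)%N; pose N := p J.
pose u j k : X := if (a j <= k < b j)%N then v k else 0.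
have uE j : (j < J)%N -> radsq (b j) (tail_of v (a j)) = radsq N (u j).
  move=> jJ; rewrite (@radsq_widen (u j) (b j) N) ?(leq_trans (bp j)) ?pm//; last first.
    by move=> k bk; rewrite /u [(k < _)%N]ltnNge bk andbF.
  congr avg; apply/funext => s; congr (rnorm _ ^+ 2); apply: eq_bigr => k _.
  by rewrite /u /tail_of ltn_ord andbT.
have J0 : 0 < 2 ^+ t :> R by rewrite exprn_gt0.
rewrite -(ler_pM2l J0).
apply: (@le_trans _ _ (\sum_(j < J) radsq N (u j))).
  have -> : 2 ^+ t * delta = \sum_(j < J) delta.
    by rewrite sumr_const card_ord -[RHS]mulr_natl /J natrX.
  by apply: ler_sum => j _; rewrite -uE.
rewrite /radsq -avg_sum.
pose Y s j := signed_sum (n := N) (u j) s.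
apply: (@le_trans _ _ (avg (fun s => C * 2 ^+ t * rho ^+ t * radsq J (Y s)))).
  by apply: avg_le => s; exact: (cot t (Y s)).
have -> : 2 ^+ t * (C * B * rho ^+ t) = C * 2 ^+ t * rho ^+ t * B by ring.
have [r0 _] := andP rho01.
rewrite avgZ; apply: ler_wpM2l; first by rewrite !mulr_ge0 ?exprn_ge0// ltW.
rewrite /radsq avg_exchange; apply: avg_le_cst => // c.
pose c' k := \sum_(j < J) sgn R (c j) * (a j <= k < b j)%N%:R.
have c'1 k : `|c' k| <= 1.
  have [j0 hj0|hj] := pickP (fun j : 'I_J => (a j <= k < b j)%N); last first.
    by rewrite /c' big1 ?normr0// => j _; rewrite hj mulr0.
  rewrite /c' (bigD1 j0)//= big1 ?addr0 => [|j jj0].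
    by rewrite normrM sgn_norm mul1r hj0 normr1.
  apply/eqP; rewrite mulf_eq0; apply/orP; right; rewrite pnatr_eq0 eqb0.
  apply/negP => /andP[aj bj]; move: hj0 => /andP[aj0 bj0]; case/negP: jj0; apply/eqP/val_inj => /=.
  case: (ltngtP j j0) => // h.
    have := leq_trans (leq_trans bj (bp j)) (leq_trans (pm _ _ h) (leq_trans (pa j0) aj0)).
    by rewrite ltnn.
  have := leq_trans (leq_trans bj0 (bp j0)) (leq_trans (pm _ _ h) (leq_trans (pa j) aj)).
  by rewrite ltnn.
apply: le_trans (vB N c'1); rewrite /radsq le_eqVlt; apply/orP; left; apply/eqP.
congr avg; apply/funext => s; congr (rnorm _ ^+ 2).
rewrite /Y /signed_sum; under eq_bigr do rewrite scaler_sumr.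
rewrite exchange_big; apply: eq_bigr => k _.
rewrite scalerA -rmorphM mulr_sumr rmorph_sum scaler_suml; apply: eq_bigr => j _.
rewrite scalerA -rmorphM mulrCA mulrA [sgn R (c j) * _]mulrC /u.
by case: ifP => _; rewrite ?mulr1// mulr0 scale0r scaler0.
Qed.

(** Otherwise blocks of size at least delta exist beyond every index. The recursion p places each
    one after the end of the previous one, and [disjoint_blocks_le] gives delta <= C B rho^t for all
    t. *)
Lemma radsq_tail_cauchy (delta : R) : 0 < delta -> exists N0 : nat,
  forall a b : nat, (N0 <= a)%N -> radsq b (tail_of v a) < delta.
Proof.
move=> d0; apply: contrapT => /forallNP h.
have /choice[ab hab] : forall N0 : nat, exists ab : nat * nat, (N0 <= ab.1)%N /\ delta <= radsq ab.2 (tail_of v ab.1).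
  move=> N0; apply: contrapT => /forallNP h'; apply: (h N0) => a b Na.
  by rewrite ltNge; apply/negP => hd; apply: (h' (a, b)).
pose p := fix p j := if j is i.+1 then maxn (p i) (ab (p i)).2 else 0%N.
have pm : {homo p : i j / (i <= j)%N}.
  by apply: homo_leq => [//|? ? ?|i /=]; [exact: leq_trans|exact: leq_maxl].
have key t : delta <= C * B * rho ^+ t.
  apply: (@disjoint_blocks_le t p (fun j => (ab (p j)).1) (fun j => (ab (p j)).2)) => // j.
  - by have [] := hab (p j).
  - exact: leq_maxr.
  - by have [] := hab (p j).
have [r0 r1] := andP rho01.
have := @cvg_expr R rho; rewrite gtr0_norm// => /(_ r1) /cvgrPdist_lt hc.
have CB : 0 <= C * B by exact: mulr_ge0.
have CB1 : 0 < C * B + 1 by rewrite ltr_wpDl.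
have [t _ /(_ t (leqnn _))] := hc (delta / (C * B + 1)) (divr_gt0 d0 CB1).
rewrite /= sub0r normrN ger0_norm ?exprn_ge0 ?(ltW r0)// ltr_pdivlMr//.
have := key t; have : 0 <= rho ^+ t by rewrite exprn_ge0// ltW.
move: (rho ^+ t) (C * B) => r c; nra.
Qed.

End Tails.

(** * Second moments and almost sure limits *)

Section Moments.
Context (R : realType) (d : measure_display) (M : measurableType d).
Context (X : completeNormedModType R[i]) (P : probability M R).
Implicit Types f g : M -> X.

Lemma moment2_subC f g : moment2 P (f - g) = moment2 P (g - f).
Proof. by apply: eq_integral => w _; rewrite rnormB. Qed.

Lemma rnorm_sqr_le (V : normedZmodType R[i]) (x y : V) :
  rnorm x ^+ 2 <= 2 * rnorm y ^+ 2 + 2 * rnorm (y - x) ^+ 2.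
Proof.
have : rnorm x <= rnorm y + rnorm (y - x).
  by have := ler_rnormB y (y - x); rewrite opprB addrC subrK.
have := rnorm_ge0 x; have := rnorm_ge0 y; have := rnorm_ge0 (y - x).
move: (rnorm x) (rnorm y) (rnorm (y - x)) => a b c c0 b0 a0 abc.
have : a ^+ 2 <= (b + c) ^+ 2 by apply: lerXn2r; rewrite ?nnegrE ?addr_ge0.
have : 0 <= (b - c) ^+ 2 by exact: sqr_ge0.
lra.
Qed.

Lemma moment2_le_add f g : strongly_measurable f -> strongly_measurable g ->
  (moment2 P f <= 2%:E * moment2 P g + 2%:E * moment2 P (g - f)%R)%E.
Proof.
move=> mf mg; have mgf := strongly_measurable_sub mg mf.
have m1 := moment2_measurable mf; have m2 := moment2_measurable mg; have m3 := moment2_measurable mgf.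
rewrite /moment2 -!ge0_integralZl//; do ?by move=> w _; rewrite lee_fin sqr_ge0.
rewrite -ge0_integralD//.
- apply: ge0_le_integral => //.
  + by move=> w _; rewrite lee_fin sqr_ge0.
  + by apply: emeasurable_funD; exact: measurable_funeM.
  + by move=> w _; rewrite -!EFinM -EFinD lee_fin rnorm_sqr_le.
- by move=> w _; rewrite mule_ge0// lee_fin sqr_ge0.
- exact: measurable_funeM.
- by move=> w _; rewrite mule_ge0// lee_fin sqr_ge0.
- exact: measurable_funeM.
Qed.

Lemma moment2_ae f g (A : set M) : measurable A -> P (~` A) = 0%E ->
  strongly_measurable f -> strongly_measurable g -> (forall w, A w -> f w = g w) ->
  moment2 P f = moment2 P g.
Proof.
move=> mA PA mf mg fg; rewrite /moment2.
have nn (h : M -> X) w : setT w -> (0 <= (rnorm (h w) ^+ 2)%:E :> \bar R)%E.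
  by rewrite lee_fin sqr_ge0.
rewrite (ge0_negligible_integral (measurableC mA) measurableT (moment2_measurable mf) (nn f) PA).
rewrite (ge0_negligible_integral (measurableC mA) measurableT (moment2_measurable mg) (nn g) PA).
by rewrite setTD setCK; apply: eq_integral => w; rewrite inE => /fg ->.
Qed.

Lemma limn_einf_le_bound (u : nat -> \bar R) (c : \bar R) : (forall n, (u n <= c)%E) ->
  (limn_einf u <= c)%E.
Proof.
move=> uc; rewrite limn_einf_lim; apply: lime_le; first exact: is_cvg_einfs.
apply: nearW => n; apply: le_trans (uc n).
by apply: ereal_inf_lbound; exists n => //=.
Qed.

Lemma moment2_fatou (s : nat -> M -> X) f g (c : R) :
  (forall n, strongly_measurable (s n)) -> strongly_measurable g ->
  (forall w, s n w @[n --> \oo] --> f w) -> (forall n, moment2 P (g - s n)%R <= c%:E)%E ->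
  (moment2 P (g - f)%R <= c%:E)%E.
Proof.
move=> ms mg sf hc.
have hf : forall n, measurable_fun setT (fun w => (rnorm ((g - s n) w) ^+ 2)%:E : \bar R).
  by move=> n; exact/moment2_measurable/strongly_measurable_sub.
have := @fatou _ _ R P setT measurableT (fun n w => (rnorm ((g - s n) w) ^+ 2)%:E) hf.
have h0 : forall n w, setT w -> (0 <= (rnorm ((g - s n) w) ^+ 2)%:E :> \bar R)%E.
  by move=> n w _; rewrite lee_fin sqr_ge0.
move=> /(_ h0) F; have := le_trans F (limn_einf_le_bound hc); apply: le_trans.
rewrite le_eqVlt; apply/orP; left; apply/eqP; apply: eq_integral => w _.
suff hcv : (fun n => (rnorm ((g - s n) w) ^+ 2)%:E : \bar R) @ \oo --> (rnorm ((g - f) w) ^+ 2)%:E.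
  rewrite is_cvg_limn_einfE; last by apply/cvg_ex; exists (rnorm ((g - f) w) ^+ 2)%:E.
  by apply/esym/cvg_lim.
apply: cvg_EFin; first by apply: nearW.
suff hr : rnorm ((g - s n) w) @[n --> \oo] --> rnorm ((g - f) w).
  by rewrite expr2; under eq_cvg do rewrite /= expr2; exact: cvgM.
apply/cvgrPdist_lt => e e0; have /real_cvgP/(_ e e0)[N hN] := sf w.
exists N => // n Nn /=; apply: le_lt_trans (hN n Nn).
rewrite (le_trans (ler_dist_rnorm _ _))//.
have -> : (g - f) w - (g - s n) w = s n w - f w.
  by rewrite (_ : (g - f) w = g w - f w)// (_ : (g - s n) w = g w - s n w)// opprB addrC addrA subrK.
by [].
Qed.

(** The sum h of 4^j |S_(j+1) - S_j|^2 has integral at most 2, the sum of (4/8)^j, so it is almost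
    surely finite; there the increments are at most sqrt(h) / 2^j. *)
Lemma limit_of_summable_increments (S : nat -> M -> X) (B : set M) : measurable B -> P (~` B) = 0%E ->
  (forall j, strongly_measurable (S j)) ->
  (forall j, (moment2 P (S j.+1 - S j)%R <= (8^-1 ^+ j)%:E)%E) ->
  exists A : set M, [/\ measurable A, P (~` A) = 0%E, A `<=` B &
    forall w, A w -> exists l : X, S j w @[j --> \oo] --> l].
Proof.
move=> mB PB mS hS.
pose D j w := (4 ^+ j * rnorm (S j.+1 w - S j w) ^+ 2)%:E : \bar R.
have D0 j w : (0 <= D j w)%E.
  by rewrite lee_fin; apply: mulr_ge0; [exact: exprn_ge0|exact: sqr_ge0].
have mD j : measurable_fun setT (D j).
  have -> : D j = (fun w => (4 ^+ j)%:E * (rnorm ((S j.+1 - S j) w) ^+ 2)%:E)%E by apply/funext.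
  apply: measurable_funeM; exact: moment2_measurable (strongly_measurable_sub (mS j.+1) (mS j)).
pose h w := (\sum_(0 <= j <oo) D j w)%E.
have h0 w : (0 <= h w)%E by apply: nneseries_ge0 => j _ _; exact: D0.
have mh : measurable_fun setT h by apply: ge0_emeasurable_sum => [j w _ _|j _]; [exact: D0|exact: mD].
have ih : (\int[P]_w h w <= 2%:E)%E.
  rewrite /h integral_nneseries//.
  apply: lime_le.
    apply: is_cvg_nneseries => j _ _; apply: integral_ge0 => w _; exact: D0.
  apply: nearW => n.
  apply: (@le_trans _ _ (\sum_(0 <= j < n) (2^-1 ^+ j)%:E)%E).
    apply: lee_sum => j _; rewrite /D.
    under eq_integral do rewrite EFinM.
    rewrite ge0_integralZl//; last 2 first.
      exact: moment2_measurable (strongly_measurable_sub (mS j.+1) (mS j)).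
      by move=> w _; rewrite lee_fin sqr_ge0.
    apply: (@le_trans _ _ ((4 ^+ j)%:E * (8^-1 ^+ j)%:E)%E).
      by apply: lee_wpmul2l; [rewrite lee_fin exprn_ge0|exact: hS].
    rewrite -EFinM lee_fin -exprMn (_ : 4 * 8^-1 = 2^-1 :> R)//.
    by field.
  rewrite sumEFin lee_fin big_mkord.
  apply: le_trans (@geometric_sum_le R 2^-1 n _) _; first lra.
  by rewrite (_ : 1 - 2^-1 = 2^-1 :> R) ?invrK//; field.
have /(integrable_ae measurableT)[N [mN PN hN]] : P.-integrable setT h.
  apply/integrableP; split=> //.
  under eq_integral do rewrite gee0_abs//.
  exact: le_lt_trans ih (ltry _).
exists (B `&` ~` N); split.
- exact/measurableI/measurableC.
- rewrite setCI setCK; apply/eqP; rewrite eq_le measure_ge0 andbT.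
  apply: (le_trans (measureU2 _ _ _)) => //; first exact: measurableC.
  suff e : (P (~` B) + P N <= 0)%E by exact: e.
  by rewrite PB PN adde0.
- by move=> w [].
move=> w [_ Nw]; have hw : h w \is a fin_num.
  apply: contrapT => hw; apply: Nw; by apply: hN => hh; exact: hw (hh I).
pose H := fine (h w); have H0 : 0 <= H by exact: fine_ge0.
have hH j : rnorm (S j.+1 w - S j w) <= Num.sqrt H / 2 ^+ j.
  rewrite ler_pdivlMr ?exprn_gt0// -(ler_pXn2r (_ : 0 < 2)%N) ?nnegrE ?sqrtr_ge0 ?mulr_ge0 ?rnorm_ge0 ?exprn_ge0//.
  rewrite sqr_sqrtr// exprMn -exprM mulnC exprM mulrC -lee_fin /H fineK//.
  have := @nneseries_lim_ge R (fun j => D j w) xpredT 0 j.+1 (fun i _ _ => D0 i w).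
  move=> /(le_trans _); apply; rewrite big_nat_recr//=.
  rewrite (_ : 2 ^+ 2 = 4 :> R); last by ring.
  by apply: leeDr; apply: sume_ge0.
have [l hl] := geometric_cauchy_cvg hH.
exists l; apply/real_cvgP => e e0.
pose c := Num.sqrt H *+ 2.
have c0 : 0 <= c / e by rewrite divr_ge0 ?mulrn_wge0 ?sqrtr_ge0// ltW.
exists (Num.truncn (c / e)).+1 => n Nn; apply: le_lt_trans (hl n) _.
rewrite ltr_pdivrMr ?exprn_gt0// mulrC -ltr_pdivrMr// (lt_le_trans (truncnS_gt _))//.
by rewrite -natrX ler_nat (leq_trans Nn)// ltnW// ltn_expl.
Qed.

End Moments.

(** * Convergence in L^2 of the Rademacher series *)

Section Series.
Context (R : realType) (d : measure_display) (M : measurableType d).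
Context (P : probability M R) (eps : nat -> {RV P >-> R}).
Hypothesis heps : rademacher_sequence eps.
Context (X : completeNormedModType R[i]) (v : nat -> X).
Hypothesis tail_cauchy : forall delta : R, 0 < delta -> exists N0 : nat,
  forall a b : nat, (N0 <= a)%N -> radsq b (tail_of v a) < delta.
Let S n := rademacher_sum eps v n.

Let mS n : strongly_measurable (S n).
Proof. exact: strongly_measurable_rademacher. Qed.

Let moment2_sub a n : (a <= n)%N -> moment2 P (S n - S a) = (radsq n (tail_of v a))%:E.
Proof. by move=> an; rewrite rademacher_sum_tail// moment2_rademacher. Qed.

Let small_increments : exists p : nat -> nat, {homo p : i j / (i <= j)%N} /\
  forall j a b, (p j <= a)%N -> (p j <= b)%N -> (moment2 P (S a - S b)%R <= (8^-1 ^+ j)%:E)%E.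
Proof.
have h8 j : 0 < 8^-1 ^+ j :> R by rewrite exprn_gt0.
have /choice[q hq] := fun j => tail_cauchy (h8 j).
pose p := fix p j := if j is i.+1 then maxn (p i) (q i.+1) else q 0%N.
exists p; split.
  by apply: homo_leq => [//|? ? ?|i /=]; [exact: leq_trans|exact: leq_maxl].
have qp j : (q j <= p j)%N by case: j => [|j] //=; exact: leq_maxr.
move=> j a b pa pb; wlog ba : a b pa pb / (b <= a)%N.
  by move=> h; case: (leqP b a) => [/h|/ltnW /h h']; [apply|rewrite moment2_subC; apply: h'].
by rewrite moment2_sub// lee_fin ltW// hq// (leq_trans (qp j)).
Qed.

(* Off a null set, the signs are replaced by [0]: the partial sums then take
   finitely many values, as strong measurability requires. *)
Lemma rademacher_series_cvg : exists f, is_rademacher_series eps v f.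
Proof.
have [p [pm hp]] := small_increments.
have [B [mB PB hB]] := rademacher_sign_ae heps.
have [A [mA PA AB hA]] := limit_of_summable_increments mB PB (fun j => mS (p j))
  (fun j => hp j _ _ (pm _ _ (leqnSn j)) (leqnn _)).
pose e k w : R := \1_A w * eps k w.
have e1 k w : A w -> e k w = eps k w by move=> Aw; rewrite /e indicE mem_set// mul1r.
have e0 k w : ~ A w -> e k w = 0 by move=> Aw; rewrite /e indicE memNset// mul0r.
have me k : finite_range_measurable (e k).
  split=> [|y].
    apply: (@sub_finite_set _ _ [set 1; -1; 0]); last by [].
    move=> _ [w _ <-]; have [Aw|Aw] := pselect (A w); last by right; exact: e0.
    by rewrite e1//; case: (hB w (AB w Aw) k) => ->; left; [left|right].
  rewrite -[X in measurable X]setTI; apply: measurable_funM => //; exact: measurable_indic.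
pose S' n w := \sum_(k < n) (e k w)%:C *: v k.
have mS' n : finite_range_measurable (S' n).
  elim: n => [|n IH].
    have -> : S' 0%N = fun=> 0 by apply/funext => w; rewrite /S' big_ord0.
    exact: finite_range_cst.
  have -> : S' n.+1 = (fun w => (fun z : X * R => z.1 + z.2%:C *: v n) (S' n w, e n w)).
    by apply/funext => w; rewrite /S' big_ord_recr.
  exact: (finite_range_comp (fun z : X * R => z.1 + z.2%:C *: v n) (finite_range_pair IH (me n))).
have S_on w n : A w -> S' n w = S n w.
  by move=> Aw; apply: eq_bigr => k _; rewrite e1.
have S_off w n : ~ A w -> S' n w = 0.
  by move=> Aw; rewrite /S' big1// => k _; rewrite e0// scale0r.
have /choice[f hf] : forall w, exists l : X, (fun j => S' (p j) w) @ \oo --> l.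
  move=> w; have [Aw|Aw] := pselect (A w).
    have [l hl] := hA w Aw; exists l.
    rewrite (_ : (fun j => _) = (fun j => S (p j) w))//.
    by apply/funext => j; rewrite S_on.
  exists 0; rewrite (_ : (fun j => _) = cst 0); first exact: cvg_cst.
  by apply/funext => j; rewrite S_off.
have mf : strongly_measurable f by exists (fun j => S' (p j)) => [n|]; [exact: mS'|exact: hf].
have mS'' j : strongly_measurable (S' (p j)).
  by exists (fun=> S' (p j)) => [n|w]; [exact: mS'|exact: cvg_cst].
(* Fatou's lemma along the subsequence p (i + j), each term of which is within 8^-j of S n in second
   moment. *)
have key (delta : R) : 0 < delta -> exists N, forall n, (N <= n)%N -> (moment2 P (S n - f)%R <= delta%:E)%E.
  move=> d0; have [j hj] : exists j, 8^-1 ^+ j <= delta.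
    have := @cvg_expr R 8^-1; rewrite ger0_norm// => /(_ _)/cvgrPdist_le hc.
    have h8 : 8^-1 < 1 :> R by lra.
    have [j _ /(_ j (leqnn _))] := hc h8 delta d0.
    by rewrite /= sub0r normrN ger0_norm ?exprn_ge0// => h; exists j.
  exists (p j) => n jn.
  apply: (@moment2_fatou _ _ _ _ _ (fun i => S' (p (i + j)%N))) => // [w|i].
    have := hf w; move=> /(cvg_comp _ _ (cvg_addnr j)); exact.
  have jij : (p j <= p (i + j))%N by apply: pm; exact: leq_addl.
  apply: le_trans (_ : (8^-1 ^+ j)%:E <= _)%E; last by rewrite lee_fin.
  apply: le_trans (hp j n (p (i + j)%N) jn jij); rewrite le_eqVlt; apply/orP; left; apply/eqP.
  apply: (moment2_ae mA PA) => [||w Aw]; do ?exact: strongly_measurable_sub.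
  by rewrite (_ : (S n - S' (p (i + j)%N)) w = S n w - S' (p (i + j)%N) w)// S_on.
exists f; split; last first.
  apply/fine_cvgP; split.
    have [N hN] := key 1 ltr01; exists N => // n Nn /=.
    rewrite ge0_fin_numE ?Lnorm_ge0//; apply: le_lt_trans (ltry 1).
    by apply: L2norm_le => //; rewrite expr1n; exact: hN.
  apply/cvgrPdist_le => e' e'0; have e2 : 0 < e' ^+ 2 by rewrite exprn_gt0.
  have [N hN] := key _ e2; exists N => // n Nn /=.
  have h := L2norm_le (ltW e'0) (hN n Nn).
  have h0 : (0 <= L2norm P (S n - f)%R)%E by exact: Lnorm_ge0.
  rewrite sub0r normrN ger0_norm ?fine_ge0//.
  rewrite -lee_fin fineK//.
  by rewrite ge0_fin_numE//; exact: le_lt_trans h (ltry _).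
split=> //; have [N /(_ N (leqnn _)) hN] := key 1 ltr01.
set r := radsq N v.
have hb : (moment2 P f <= (2 * r + 2 * 1)%:E)%E.
  apply: (le_trans (@moment2_le_add _ _ _ _ P f (S N) mf (mS N))).
  have -> : (2 * r + 2 * 1)%:E = (2%:E * r%:E + 2%:E * 1%:E :> \bar R)%E by rewrite -!EFinM -EFinD.
  rewrite {1}/S moment2_rademacher//; apply: leeD => //.
  by apply: lee_wpmul2l => //; rewrite lee_fin.
apply: le_lt_trans (ltry (Num.sqrt (2 * r + 2 * 1))).
apply: L2norm_le; first exact: sqrtr_ge0.
have r0 : 0 <= r by exact: radsq_ge0.
by rewrite sqr_sqrtr//; apply: addr_ge0; exact: mulr_ge0.
Qed.

(** The sum f is chosen by [cid], so the bound is proved for an arbitrary one; the factor 2 is that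
    of [moment2_le_add]. *)
Lemma rademacher_norm_le (B : R) : (forall n, radsq n v <= B) ->
  (rademacher_norm eps v <= (Num.sqrt (2 * B))%:E)%E.
Proof.
move=> hB; have B0 : 0 <= B by exact: le_trans (radsq_ge0 0 v) (hB 0%N).
rewrite /rademacher_norm; case: pselect => [H|]; last by case; exact: rademacher_series_cvg.
case: (cid H) => f /= [[mf _] hf].
apply: L2norm_le; rewrite ?sqrtr_ge0// sqr_sqrtr ?mulr_ge0//.
apply/lee_addgt0Pr => e e0.
have e2 : 0 < Num.sqrt (e / 2) by rewrite sqrtr_gt0 divr_gt0.
have /fine_cvgP[[N1 _ hN1] /cvgrPdist_le/(_ _ e2)[N2 _ hN2]] := hf.
pose n := maxn N1 N2; have := hN1 n (leq_maxl _ _); have := hN2 n (leq_maxr _ _).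
have h0 : (0 <= L2norm P (S n - f)%R)%E by exact: Lnorm_ge0.
rewrite /= sub0r normrN ger0_norm ?fine_ge0// => h1 h2.
have : (L2norm P (S n - f)%R <= (Num.sqrt (e / 2))%:E)%E by rewrite -(fineK h2) lee_fin.
move=> /(moment2_le (ltW e2)); rewrite sqr_sqrtr ?divr_ge0 ?(ltW e0)// => h3.
apply: (le_trans (@moment2_le_add _ _ _ _ P f (S n) mf (mS n))).
rewrite {1}/S moment2_rademacher// [(2 * B)%:E]EFinM; apply: leeD.
  by apply: lee_wpmul2l; rewrite lee_fin.
apply: le_trans (_ : (2%:E * (e / 2)%:E <= _)%E); first by apply: lee_wpmul2l; rewrite ?lee_fin.
by rewrite -EFinM lee_fin mulrC divfK.
Qed.

End Series.

Theorem corollary6p9 (R : realType) (X : completeNormedModType R[i])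
    (d : measure_display) (M : measurableType d) (P : probability M R)
    (eps : nat -> {RV P >-> R}) (heps : rademacher_sequence eps)
    (hX : finite_cotype eps X)
    (T : X -> X) (hT : ritt T)
    (gamma : R) (hgamma : 0 < gamma < pi / 2)
    (hcalc : bounded_Hinfty_calculus gamma T)
    (m : nat) (hm : (1 <= m)%N) :
  exists2 C : R, 0 < C &
    forall x : X, (square_function eps T m x <= (C * rnorm x)%:E)%E.
Proof.
have [C0 [rho [C00 rho01 cot]]] := finite_cotype_dyadic heps hX.
have [K K0 hK] := finite_square_function hgamma hcalc C00 rho01 cot hm.
exists (Num.sqrt (2 * K) + 1) => [|x]; first by rewrite ltr_wpDl ?sqrtr_ge0.
pose w k : R := k.+1%:R `^ (m%:R - 2^-1).
have w2 k : w k ^+ 2 = k.+1%:R ^+ (2 * m).-1.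
  rewrite -powR_mulrn ?powR_ge0// -powRrM -powR_mulrn//; congr (_ `^ _).
  by rewrite mulrBl mulVf ?pnatr_eq0// -natrM mulnC -[in RHS]subn1 natrB// muln_gt0.
set B := K * rnorm x ^+ 2.
have B0 : 0 <= B by apply: mulr_ge0 => //; exact: sqr_ge0.
pose v k := (w k)%:C *: iter k T (iter m (fun v => v - T v) x).
(* The multipliers are absorbed into the weights, which only get smaller. *)
have vB N (c : nat -> R) : (forall k, `|c k| <= 1) -> radsq N (fun k => (c k)%:C *: v k) <= B.
  move=> c1; apply: le_trans (hK N (fun k => c k * w k) x _) => [|k].
    rewrite le_eqVlt; apply/orP; left; apply/eqP; congr radsq; apply/funext => k.
    by rewrite /v scalerA -rmorphM.
  rewrite exprMn w2 -[leRHS]mul1r; apply: ler_wpM2r; first exact: exprn_ge0.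
  by rewrite -[c k ^+ 2]real_normK ?num_real// exprn_ile1.
have cau := radsq_tail_cauchy heps C00 rho01 cot B0 vB.
have vb n : radsq n v <= B.
  have := vB n (fun=> 1) (fun=> _); rewrite normr1 => /(_ (fun=> lexx _)).
  by congr (radsq _ _ <= _); apply/funext => k; rewrite scale1r.
apply: le_trans (rademacher_norm_le heps cau vb) _; rewrite lee_fin.
have -> : Num.sqrt (2 * B) = Num.sqrt (2 * K) * rnorm x.
  by rewrite /B mulrA sqrtrM ?mulr_ge0// sqrtr_sqr ger0_norm ?rnorm_ge0.
by rewrite ler_wpM2r ?rnorm_ge0// lerDl.
Qed.
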